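(* Let $a>0$ and $q>0$. If $u\in\mathcal{D}$ is a positive distribution solution of $-\Delta u+a^2\Delta^2u=u^q$ in $\mathbb{R}^3$, then $u$ is differentiable in $\mathbb{R}^3$ and $u\in L^{q+1}(\mathbb{R}^3)$.
   Context: $D^{1,2}(\mathbb{R}^3)$ is the homogeneous Sobolev space, and $\mathcal{D}=\{u\in D^{1,2}(\mathbb{R}^3):\Delta u\in L^2(\mathbb{R}^3)\}$, which is the completion of $C_0^\infty(\mathbb{R}^3)$ with respect to the norm $\|\phi\|_{\mathcal{D}}=\big(\|\nabla\phi\|_{L^2(\mathbb{R}^3)}^2+a^2\|\Delta\phi\|_{L^2(\mathbb{R}^3)}^2\big)^{1/2}$. A positive function $u\in\mathcal{D}$ is a distribution solution of $-\Delta u+a^2\Delta^2u=u^q$ in $\mathbb{R}^3$ if $$-\int_{\mathbb{R}^3}u\,\Delta\phi\,dx+a^2\int_{\mathbb{R}^3}u\,\Delta^2\phi\,dx=\int_{\mathbb{R}^3}u^q\phi\,dx\quad\text{for all }\phi\in C_0^\infty(\mathbb{R}^3).$$ As usual for elements of a Sobolev space, $u$ is identified with functions equal to it almost everywhere (differentiability refers to a suitable representative). *)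

(* Defs.v *)
From HB Require Import structures.
From mathcomp Require Import all_boot all_order all_algebra.
From mathcomp Require Import all_classical all_reals all_analysis.

Set Implicit Arguments.
Unset Strict Implicit.
Unset Printing Implicit Defensive.

Import Order.TTheory GRing.Theory Num.Theory.
Import numFieldNormedType.Exports.

Local Open Scope classical_set_scope.
Local Open Scope ring_scope.

(* R^3 is R * R * R. Its library norm is the sup norm, equivalent to the
   Euclidean one: compact sets and differentiability are the usual ones. *)

(* Lebesgue measure on the Borel sets of R^3.  Nothing is lost by using Borel
   functions: every Lebesgue measurable function is a.e. equal to one. *)
Definition leb3 (R : realType) :=
  (((@lebesgue_measure R) \x (@lebesgue_measure R)) \x (@lebesgue_measure R))%E.
Arguments leb3 : clear implicits.
HB.instance Definition _ (R : realType) := Measure.on (leb3 R).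

Definition basis3 (R : realType) (i : 'I_3) : R * R * R :=
  ((i == 0%N :> nat)%:R, (i == 1%N :> nat)%:R, (i == 2%N :> nat)%:R).
Arguments basis3 : clear implicits.

Definition partial (R : realType) (i : 'I_3) (f : R * R * R -> R) :
    R * R * R -> R :=
  fun x => 'D_(basis3 R i) f x.

Definition iter_partial (R : realType) (s : seq 'I_3) (f : R * R * R -> R) :
    R * R * R -> R :=
  foldr (@partial R) f s.

Definition laplacian (R : realType) (f : R * R * R -> R) : R * R * R -> R :=
  fun x => \sum_(i < 3) partial i (partial i f) x.

(* C^oo: partial derivatives of every order exist and are continuous. *)
Definition smooth (R : realType) (f : R * R * R -> R) : Prop :=
  forall s : seq 'I_3,
    continuous (iter_partial s f) /\
    (forall x i, derivable (iter_partial s f) x (basis3 R i)).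

Definition test_function (R : realType) (phi : R * R * R -> R) : Prop :=
  smooth phi /\ compact (closure [set x | phi x != 0]).

Definition loc_integrable (R : realType) (f : R * R * R -> R) : Prop :=
  forall K : set (R * R * R), compact K -> (leb3 R).-integrable K (EFin \o f).

(* g is the i-th distributional partial derivative of u. *)
Definition weak_partial (R : realType) (i : 'I_3) (u g : R * R * R -> R) :
    Prop :=
  [/\ loc_integrable u, loc_integrable g &
    forall phi, test_function phi ->
      (\int[leb3 R]_x (u x * partial i phi x)) =
      - (\int[leb3 R]_x (g x * phi x))].

(* h is the distributional Laplacian of u. *)
Definition weak_laplacian (R : realType) (u h : R * R * R -> R) : Prop :=
  [/\ loc_integrable u, loc_integrable h &
    forall phi, test_function phi ->
      (\int[leb3 R]_x (u x * laplacian phi x)) =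
      (\int[leb3 R]_x (h x * phi x))].

(* The homogeneous Sobolev space D^{1,2}(R^3), realized as a space of functions
   through the critical Sobolev exponent 2^* = 6: it consists of the u in L^6
   whose distributional gradient is in L^2. *)
Definition D12 (R : realType) (u : R * R * R -> R) : Prop :=
  u \in Lfun (leb3 R) 6%:E /\
  (forall i : 'I_3, exists g : R * R * R -> R,
     g \in Lfun (leb3 R) 2%:E /\ weak_partial i u g).

Definition spaceD (R : realType) (u : R * R * R -> R) : Prop :=
  D12 u /\
  exists h : R * R * R -> R,
    h \in Lfun (leb3 R) 2%:E /\ weak_laplacian u h.

(* Local integrability of u and u^q is what makes the integrals below
   meaningful. *)
Definition distribution_solution (R : realType) (a q : R)
    (u : R * R * R -> R) : Prop :=
  [/\ loc_integrable u, loc_integrable (fun x => u x `^ q) &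
    forall phi, test_function phi ->
      - (\int[leb3 R]_x (u x * laplacian phi x))
        + a ^+ 2 * (\int[leb3 R]_x (u x * laplacian (laplacian phi) x))
      = (\int[leb3 R]_x (u x `^ q * phi x))].

(* Main.v *)
Require Import Defs.
From HB Require Import structures.
From mathcomp Require Import all_boot all_order all_algebra.
From mathcomp Require Import all_classical all_reals all_analysis.
From mathcomp Require Import measurable_realfun ring lra.
Import Order.TTheory GRing.Theory Num.Theory.
Import numFieldNormedType.Exports.
Local Open Scope classical_set_scope.
Local Open Scope ring_scope.

(** Let [h] be the weak Laplacian of [u], which lies in L^2, and put
    [f = u ^ q + h].  The equation says that [a ^ 2] times the bilaplacian of
    [u] is [f] as a distribution, [u] and [f] being locally integrable.

    Differentiability.  In dimension three the function |z| is, up to a factor,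
    a fundamental solution of the bilaplacian.  With s = |z|^2 + d, the
    bilaplacian of sqrt s is -15 d^2 s^(-7/2), a smooth approximation of a
    multiple of the Dirac mass at the scale sqrt d.  Multiplying sqrt s by a
    smooth cutoff [step] of s gives compactly supported test functions whose
    bilaplacian is the difference of a bounded kernel living on
    1 <= s <= 2 and of this approximate Dirac mass ([parametrix]).  Testing the
    equation with their translates to x and letting d tend to 0, the averages
    of [u] against the approximate Dirac masses converge at every x to
      T x = int u(y) w0 (|x - y|^2) dy - a^-2 int f(y) k (|x - y|^2) dy,
    where w0 is of class C^1 and k (|z|^2) is |z| near 0 ([regularization]).  Both
    kernels are Lipschitz, compactly supported, and differentiable away from
    the origin, which is a null set; by dominated convergence their
    convolutions with locally integrable functions are differentiable
    everywhere ([differentiable_convN]).  On the other hand the averages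
    converge to a positive multiple of [u] almost everywhere: it is enough to
    compare the integrals over boxes ([approximate_identity]).  Hence a multiple
    of T is a differentiable representative of [u]
    ([continuous_representative]).

    Integrability.  Formally one tests the equation with [u] itself and gets
    int u^(q+1) = int |grad u|^2 + a^2 int |lap u|^2, which is finite.  Since
    [u] is not an admissible test function, one takes instead the mollification
    at scale e of [u * X], where X is a cutoff equal to 1 on the ball of radius
    1/e.  Fubini's theorem moves all derivatives onto [u * X]
    ([energy_identity]).  By the inequality |AB| <= A^2 + B^2 the result is
    bounded by the L^2 norms of the gradient and the Laplacian of [u], and by
    those of [u * grad X] and [u * lap X]; as |grad X| and |lap X| are O(e) and
    vanish outside a cube of side O(1/e), the inequality
    u^2 w^2 <= u^6 + |w|^3 bounds the latter by int u^6 plus a constant which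
    does not depend on e: this is where the critical exponent 6 enters
    ([uniform_bound]).  The mollifications converge pointwise to a multiple of
    the continuous representative, and Fatou's lemma gives a finite bound for
    int u^(q+1) ([integral_le_of_moll]). *)

Set Implicit Arguments.
Unset Strict Implicit.
Unset Printing Implicit Defensive.

(** * Partial derivatives of radial functions *)

Section smooth_calculus.
Context {R : realType}.
Local Notation E := (R * R * R)%type.
Implicit Types (f g : E -> R) (c z : E) (k : R -> R).

Definition coord (i : 'I_3) z : R :=
  if i == 0%N :> nat then z.1.1 else if i == 1%N :> nat then z.1.2 else z.2.

Lemma coord_linear i : linear (coord i).
Proof. by move=> a x y; rewrite /coord; case: ifP => // _; case: ifP. Qed.

HB.instance Definition _ i :=
  GRing.isLinear.Build R E R *:%R (coord i) (@coord_linear i).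

Lemma coord_continuous i : continuous (coord i).
Proof.
move=> z; rewrite /coord.
case: (nat_of_ord i == 0%N); last case: (nat_of_ord i == 1%N).
- by apply: (@continuous_comp E (R * R)%type R fst fst z); exact: cvg_fst.
- apply: (@continuous_comp E (R * R)%type R fst snd z).
    exact: cvg_fst.
  exact: cvg_snd.
- exact: cvg_snd.
Qed.

Lemma coord_basis i j : coord i (basis3 R j) = (i == j)%:R.
Proof.
by rewrite /coord /basis3; case: i => -[|[|[|//]]] ?; case: j => -[|[|[|//]]] ?.
Qed.

Lemma differentiable_coord3 i z : differentiable (coord i) z.
Proof. exact/linear_differentiable/coord_continuous. Qed.

Lemma partialE i f z : differentiable f z -> partial i f z = 'd f z (basis3 R i).
Proof. exact: deriveE. Qed.

Lemma partial_coord i j z : partial i (coord j) z = (i == j)%:R.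
Proof.
rewrite partialE; last exact: differentiable_coord3.
rewrite diff_lin; last exact: coord_continuous.
by rewrite [LHS](coord_basis j i) eq_sym.
Qed.

Lemma partial_cst i (r : R) : partial i (cst r) = cst 0.
Proof. by apply/funext => z; rewrite /partial derive_cst. Qed.

Lemma partialD i f g z : differentiable f z -> differentiable g z ->
  partial i (f \+ g) z = partial i f z + partial i g z.
Proof. by move=> df dg; rewrite /partial deriveD//; exact: diff_derivable. Qed.

Lemma partialM i f g z : differentiable f z -> differentiable g z ->
  partial i (f \* g) z = f z * partial i g z + g z * partial i f z.
Proof. by move=> df dg; rewrite /partial deriveM//; exact: diff_derivable. Qed.

(** Differentiability of every derivative up to order [n] is used in place of
    continuity: it passes through products and compositions with no side
    condition, and at all orders it gives smoothness. *)
Fixpoint Ck3 n f : Prop :=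
  (forall z, differentiable f z) /\
  if n is m.+1 then forall i, Ck3 m (partial i f) else True.

Lemma Ck3_diff n f z : Ck3 n f -> differentiable f z.
Proof. by case: n => [|n] []. Qed.

Lemma Ck3W n f : Ck3 n.+1 f -> Ck3 n f.
Proof.
elim: n f => [|n IH] f [df h]; first by split.
by split => // i; apply: IH; exact: h.
Qed.

Lemma Ck3_cst n r : Ck3 n (cst r).
Proof.
elim: n r => [|n IH] r; split => //; try by move=> z; exact: differentiable_cst.
by move=> i; rewrite partial_cst.
Qed.

Lemma Ck3_coord n i : Ck3 n (coord i).
Proof.
case: n => [|n]; split => //; try by move=> z; exact: differentiable_coord3.
move=> j; rewrite (_ : partial j _ = cst (j == i)%:R); first exact: Ck3_cst.
by apply/funext => z; rewrite partial_coord.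
Qed.

Lemma Ck3D n f g : Ck3 n f -> Ck3 n g -> Ck3 n (f \+ g).
Proof.
elim: n f g => [|n IH] f g [df f1] [dg g1]; split => //;
  try by move=> z; apply: differentiableD.
move=> i; rewrite (_ : partial i _ = partial i f \+ partial i g).
  by apply: IH; [exact: f1|exact: g1].
by apply/funext => z; rewrite partialD.
Qed.

Lemma Ck3M n f g : Ck3 n f -> Ck3 n g -> Ck3 n (f \* g).
Proof.
elim: n f g => [|n IH] f g.
  by move=> [df _] [dg _]; split => // z; exact: differentiableM.
move=> hf hg; have [df f1] := hf; have [dg g1] := hg.
split; first by move=> z; exact: differentiableM.
move=> i.
rewrite (_ : partial i _ = (f \* partial i g) \+ (g \* partial i f)).
  by apply: Ck3D; apply: IH; [exact: Ck3W|exact: g1|exact: Ck3W|exact: f1].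
by apply/funext => z; rewrite partialM.
Qed.

Lemma smooth_Ck3 f : (forall n, Ck3 n f) -> smooth f.
Proof.
move=> hf s; have : forall n, Ck3 n (iter_partial s f).
  elim: s => [//|i s IH] n /=.
  by have [_] := IH n.+1; apply.
move=> /(_ 0%N) [ds _]; split.
- by move=> z; exact/differentiable_continuous.
- by move=> z i; exact: diff_derivable.
Qed.

(** The derivatives are existential witnesses, so that a function on the line
    need only be known on [D], for instance where a square root is smooth. *)
Fixpoint Ck1 (D : set R) n k : Prop :=
  exists k', (forall s, D s -> is_derive s 1 k (k' s)) /\
    if n is m.+1 then Ck1 D m k' else True.

Lemma Ck1W D n k : Ck1 D n.+1 k -> Ck1 D n k.
Proof.
elim: n k => [|n IH] k [k' [kk' hk']]; exists k' => //.
by split => //; exact: IH.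
Qed.

(** The squared Euclidean distance; the norm of the product type is the
    supremum norm, which is not smooth. *)
Definition sqd c z : R := \sum_(i < 3) (coord i z - coord i c) ^+ 2.

Definition rad k c z : R := k (sqd c z).

Lemma sqd_ge0 c z : 0 <= sqd c z.
Proof. by apply: sumr_ge0 => i _; exact: sqr_ge0. Qed.

Lemma sqdC c z : sqd c z = sqd z c.
Proof. by apply: eq_bigr => i _; rewrite -sqrrN opprB. Qed.

Lemma is_derive_sqd c z i :
  is_derive z (basis3 R i) (sqd c) (2 * (coord i z - coord i c)).
Proof.
have H j : is_derive z (basis3 R i) (fun z => (coord j z - coord j c))
   (i == j)%:R.
  rewrite -(partial_coord i j z) -[partial _ _ _]subr0.
  apply: is_deriveB; apply: derivableP.
  by apply: diff_derivable; exact: differentiable_coord3.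
rewrite /sqd; under eq_fun do rewrite !big_ord_recl big_ord0 addr0.
have -> : 2 * (coord i z - coord i c) =
  \sum_(j < 3) 2 * (coord j z - coord j c) * (i == j)%:R.
  rewrite (bigD1 i)//= eqxx mulr1 big1 ?addr0// => j /negPf ji.
  by rewrite eq_sym ji mulr0.
rewrite !big_ord_recl big_ord0 addr0.
apply: is_deriveD; last apply: is_deriveD.
all: apply: is_derive_eq; rewrite /GRing.scale/=; try ring.
Qed.

Lemma differentiable_sqd c z : differentiable (sqd c) z.
Proof.
have -> : sqd c = \sum_(i < 3) (fun z => (coord i z - coord i c) ^+ 2).
  by apply/funext => y; rewrite /sqd fct_sumE.
apply: differentiable_sum => i; under eq_fun do rewrite expr2.
have d : differentiable (fun z => coord i z - coord i c) z.
  by apply: differentiableB; [exact: differentiable_coord3|exact: differentiable_cst].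
exact: differentiableM.
Qed.

Lemma differentiable_rad k (k' : R) c z : is_derive (sqd c z) 1 k k' ->
  differentiable (rad k c) z.
Proof.
move=> [dk _]; apply: (@differentiable_comp _ _ _ _ (sqd c) k).
  exact: differentiable_sqd.
exact/derivable1_diffP.
Qed.

Lemma partial_rad k (k' : R) c z i : is_derive (sqd c z) 1 k k' ->
  partial i (rad k c) z = k' * (2 * (coord i z - coord i c)).
Proof.
move=> dk; rewrite partialE; last exact: differentiable_rad dk.
have [dk1 dk2] := dk; have dk3 := dk1; move/derivable1_diffP : dk3 => dk3.
rewrite /rad (@diff_comp _ _ _ _ (sqd c) k)//; last exact: differentiable_sqd.
have [ds1 ds2] := is_derive_sqd c z i.
rewrite /= -(deriveE _ (differentiable_sqd c z)) ds2 deriv1E//= derive1E dk2.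
by rewrite /GRing.scale/= mulrC.
Qed.

Lemma Ck3_rad n k c : Ck1 [set s | 0 <= s] n k -> Ck3 n (rad k c).
Proof.
elim: n k => [|n IH] k [k' [kk' hk']].
  split => // z; apply: differentiable_rad (kk' _ _); exact: sqd_ge0.
split; first by move=> z; apply: differentiable_rad (kk' _ _); exact: sqd_ge0.
move=> i; rewrite (_ : partial i _ = rad k' c \* (cst 2 \* (coord i \+ cst (- coord i c)))).
  apply: Ck3M; first exact: IH.
  apply: Ck3M; first exact: Ck3_cst.
  by apply: Ck3D; [exact: Ck3_coord|exact: Ck3_cst].
by apply/funext => z; rewrite (@partial_rad _ _ c z i (kk' _ (sqd_ge0 c z))).
Qed.

(** In dimension three, the Laplacian of k (|z|^2) at s = |z|^2 is
    6 k' + 4 s k''. *)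
Lemma laplacian_rad (k k' k'' : R -> R) c :
  (forall s : R, 0 <= s -> is_derive s 1 k (k' s)) ->
  (forall s : R, 0 <= s -> is_derive s 1 k' (k'' s)) ->
  laplacian (rad k c) = rad (fun s : R => 6 * k' s + 4 * s * k'' s) c.
Proof.
move=> dk dk'; apply/funext => z; rewrite /laplacian.
have P i : partial i (rad k c) = rad k' c \* (cst 2 \* (coord i \+ cst (- coord i c))).
  by apply/funext => y; rewrite (@partial_rad _ _ c y i (dk _ (sqd_ge0 c y))).
have PP i : partial i (partial i (rad k c)) z =
    2 * k' (sqd c z) + 4 * (coord i z - coord i c) ^+ 2 * k'' (sqd c z).
  have d1 : differentiable (rad k' c) z.
    by apply: differentiable_rad (dk' _ _); exact: sqd_ge0.
  have d2 : differentiable (coord i \+ cst (- coord i c)) z.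
    by apply: differentiableD; [exact: differentiable_coord3|exact: differentiable_cst].
  have d0 : differentiable (cst (2 : R) : E -> R) z by exact: differentiable_cst.
  have d3 : differentiable (cst 2 \* (coord i \+ cst (- coord i c)) : E -> R) z.
    exact: (differentiableM d0 d2).
  rewrite P partialM// partialM//.
  rewrite partialD//; last exact: differentiable_coord3.
  rewrite partial_coord eqxx !partial_cst /= (@partial_rad _ _ c z i (dk' _ (sqd_ge0 c z))).
  by rewrite /rad; ring.
under eq_bigr do rewrite PP.
rewrite big_split/= sumr_const card_ord -mulr_suml -mulr_sumr -/(sqd c z).
by rewrite /rad -[_ *+ 3]mulr_natl; ring.
Qed.

End smooth_calculus.

(** * A smooth cutoff on the line *)

Section smooth_1d.
Context {R : realType}.
Implicit Types (D : set R) (f g k : R -> R) (n m : nat).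

Lemma Ck1_cst D n (r : R) : Ck1 D n (cst r).
Proof.
by elim: n r => [|n IH] r; exists (cst 0); split => // s _; exact: is_derive_cst.
Qed.

Lemma Ck1_id D n : Ck1 D n id.
Proof.
case: n => [|n]; exists (cst 1); split => //;
  try by (move=> s _; exact: is_derive_id).
exact: Ck1_cst.
Qed.

Lemma Ck1D D n f g : Ck1 D n f -> Ck1 D n g -> Ck1 D n (f \+ g).
Proof.
elim: n f g => [|n IH] f g [f' [df f1]] [g' [dg g1]]; exists (f' \+ g'); split => //;
  try by move=> s Ds; apply: is_deriveD; [exact: df|exact: dg].
exact: IH.
Qed.

Lemma Ck1M D n f g : Ck1 D n f -> Ck1 D n g -> Ck1 D n (f \* g).
Proof.
elim: n f g => [|n IH] f g Hf Hg; have [f' [df f1]] := Hf;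
  have [g' [dg g1]] := Hg; exists ((f \* g') \+ (g \* f')); split => //;
  try by move=> s Ds; apply: is_deriveM; [exact: df|exact: dg].
by apply: Ck1D; apply: IH => //; exact: Ck1W.
Qed.

Lemma Ck1Z D n (r : R) f : Ck1 D n f -> Ck1 D n (fun x => r * f x).
Proof. by move=> hf; apply: (@Ck1M _ _ (cst r)) => //; exact: Ck1_cst. Qed.

Lemma Ck1_affine D n (r t : R) : Ck1 D n (fun x => r * x + t).
Proof.
apply: (@Ck1D _ _ (fun x => r * x) (cst t)); last exact: Ck1_cst.
by apply: Ck1Z; exact: Ck1_id.
Qed.

Lemma Ck1_comp D D' n f g : (forall s, D s -> D' (g s)) ->
  Ck1 D' n f -> Ck1 D n g -> Ck1 D n (f \o g).
Proof.
move=> gD; elim: n f => [|n IH] f [f' [df f1]] Hg; have [g' [dg g1]] := Hg;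
  exists ((f' \o g) \* g'); split => //;
  try by move=> s Ds; apply: is_derive1_comp; [apply: df; exact: gD|exact: dg].
by apply: Ck1M => //; apply: IH => //; exact: Ck1W.
Qed.

Lemma Ck1V D n f : (forall s, D s -> f s != 0) -> Ck1 D n f ->
  Ck1 D n (fun s => (f s)^-1).
Proof.
move=> f0; have H f' : (forall s, D s -> is_derive s 1 f (f' s)) ->
    forall s, D s -> is_derive s 1 (fun s => (f s)^-1)
      (-1 * (((f s)^-1 * (f s)^-1) * f' s)).
  move=> df s Ds; have H := is_deriveV (f0 _ Ds) (df _ Ds).
  apply: is_derive_eq.
  by rewrite /GRing.scale/= expr2 invfM; ring.
elim: n => [|n IH] Hf; have [f' [df f1]] := Hf;
  exists (fun s => -1 * (((f s)^-1 * (f s)^-1) * f' s)); split => //; try exact: H.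
apply: Ck1Z; apply: (@Ck1M _ _ (fun s => (f s)^-1 * (f s)^-1)) => //.
by apply: Ck1M; apply: IH; exact: Ck1W.
Qed.

Lemma Ck1_sqrt n : Ck1 [set s : R | 0 < s] n Num.sqrt.
Proof.
elim: n => [|n IH]; exists (fun s => (2 * Num.sqrt s)^-1); split => //;
  try by (move=> s /= s0; exact: is_derive1_sqrt).
apply: (@Ck1V _ _ (fun s => 2 * Num.sqrt s)); last exact: Ck1Z.
by move=> s /= s0; rewrite mulf_neq0// ?gt_eqF// sqrtr_gt0.
Qed.

Lemma is_derive_invX j (x : R) : x != 0 ->
  is_derive x 1 (fun y : R => y^-1 ^+ j) (j%:R * x^-1 ^+ j.-1 * - x ^- 2).
Proof.
move=> x0; have dV : is_derive x 1 (fun y : R => y^-1) (- x ^- 2).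
  have H := @is_deriveV R id x 1 1 x0 (is_derive_id x 1).
  by apply: is_derive_eq; rewrite /GRing.scale/= mulr1.
rewrite (_ : (fun y => _) = (fun y : R => y^-1) ^+ j); first exact: is_deriveX.
by apply/funext => y; rewrite exprfctE.
Qed.

(** The classical x^(-n) exp (-1/x), extended by 0.  The powers of 1/x are part
    of the family so that it is closed under derivation. *)
Definition flat n (x : R) : R := if 0 < x then x^-1 ^+ n * expR (- x^-1) else 0.

Lemma flat_ge0 n x : 0 <= flat n x.
Proof.
rewrite /flat; case: ifPn => // x0.
by rewrite mulr_ge0 ?expR_ge0// exprn_ge0// invr_ge0 ltW.
Qed.

(** The Taylor bound exp y >= y^(n+1) / (n+1)! at y = 1/x. *)
Lemma flat_le n x : flat n x <= (n.+1)`!%:R * `|x|.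
Proof.
rewrite /flat; case: ifPn => x0; last by rewrite mulr_ge0.
rewrite expRN gtr0_norm// ler_pdivrMr ?expR_gt0//.
have xV0 : 0 < x^-1 by rewrite invr_gt0.
have h := expR_ge1Dxn n (ltW xV0).
have f0 : 0 < (n.+1)`!%:R :> R by rewrite ltr0n fact_gt0.
have {}h : x^-1 ^+ n.+1 <= (n.+1)`!%:R * expR x^-1.
  by rewrite mulrC -ler_pdivrMr// (le_trans _ h)// lerDr.
rewrite -mulrA mulrCA -ler_pdivrMl//.
by rewrite -exprS.
Qed.

Lemma is_derive0_quad (f : R -> R) (C : R) :
  (forall h, `|f h| <= C * (`|h| * `|h|)) -> is_derive (0 : R) 1 f 0.
Proof.
move=> fC; have f0 : f 0 = 0.
  by apply/eqP; rewrite -normr_le0 (le_trans (fC _))// normr0 !mulr0.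
suff H : (fun h : R => h^-1 *: ((f \o shift (0 : R)) (h *: (1 : R)) - f 0 : R)) @ (0 : R)^' --> (0 : R).
  by apply: DeriveDef; [apply/cvg_ex; exists 0|exact: (cvg_lim _ H)].
apply: norm_cvg0; apply: (@squeeze_cvgr _ _ _ _ (cst 0) (fun h => C * `|h|)).
- near=> h; rewrite normr_ge0/= addr0 f0 subr0 /GRing.scale/= mulr1 normrM normfV.
  have h0 : 0 < `|h| by rewrite normr_gt0; near: h; exact: nbhs_dnbhs_neq.
  by rewrite ler_pdivrMl// mulrCA; exact: fC.
- exact: cvg_cst.
- rewrite -[X in _ --> X](mulr0 C) -[in X in _ --> X](@normr0 R R).
  apply: cvgMr; apply: cvg_norm; exact: nbhs_dnbhs.
Unshelve. all: by end_near. Qed.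

(** At 0 the function is O(x^2), by [flat_le] applied to the next member of the
    family. *)
Lemma is_derive_flat n (x : R) :
  is_derive x 1 (flat n) (flat n.+2 x + - n%:R * flat n.+1 x).
Proof.
have [x0|x0|->] := ltgtP x 0.
- have -> : flat n.+2 x + - n%:R * flat n.+1 x = 0.
    by rewrite /flat ltNge (ltW x0)/= mulr0 addr0.
  apply: (@near_eq_is_derive R R R (cst (0 : R)) (flat n)).
  near=> y; rewrite /flat ltNge (_ : y <= 0)// ltW//.
  near: y; exact: (lt_nbhsl x0).
- apply: (@near_eq_is_derive R R R (fun x : R => x^-1 ^+ n * expR (- x^-1)) (flat n)).
    near=> y; rewrite /flat (_ : 0 < y)//.
    near: y; exact: (lt_nbhsr x0).
  have xn0 : x != 0 by rewrite gt_eqF.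
  have dV : is_derive x 1 (fun y : R => y^-1) (- x ^- 2).
    have H := @is_deriveV R id x 1 1 xn0 (is_derive_id x 1).
    by apply: is_derive_eq; rewrite /GRing.scale/= mulr1.
  have dNV : is_derive x 1 (fun y : R => - y^-1) (x ^- 2).
    by apply: is_derive_eq; rewrite opprK.
  have dE : is_derive x 1 (fun y : R => expR (- y^-1)) (expR (- x^-1) * x ^- 2).
    exact: (@is_derive1_comp _ expR (fun y : R => - y^-1)).
  have dX := is_derive_invX n xn0.
  have H := is_deriveM dX dE.
  have -> : flat n.+2 x + - n%:R * flat n.+1 x =
      x^-1 ^+ n *: (expR (- x^-1) * x ^- 2)
      + expR (- x^-1) *: (n%:R * x^-1 ^+ n.-1 * - x ^- 2).
    rewrite /flat x0 /GRing.scale/= -!exprVn.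
    by case: n {dX H} => [|n] /=; rewrite ?exprS ?expr0; ring.
  exact: H.
- have -> : flat n.+2 0 + - n%:R * flat n.+1 0 = 0.
    by rewrite /flat ltxx mulr0 addr0.
  apply: (@is_derive0_quad _ (n.+2)`!%:R) => h.
  rewrite ger0_norm ?flat_ge0//.
  have [h0|h0] := ltP 0 h; last by rewrite /flat ltNge h0 mulr_ge0// mulr_ge0.
  rewrite [leLHS](_ : _ = `|h| * flat n.+1 h).
    by rewrite mulrCA ler_wpM2l// flat_le.
  by rewrite /flat h0 gtr0_norm// exprS !mulrA divff ?mul1r// gt_eqF.
Unshelve. all: by end_near. Qed.

Lemma Ck1_flat D m n : Ck1 D m (flat n).
Proof.
elim: m n => [|m IH] n; exists (flat n.+2 \+ (fun x => - n%:R * flat n.+1 x));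
  split => //; try by (move=> s _; exact: is_derive_flat).
by apply: Ck1D => //; apply: Ck1Z.
Qed.

(** Equal to 1 for s <= 1 and to 0 for s >= 2. *)
Definition step (s : R) : R := flat 0 (2 - s) / (flat 0 (2 - s) + flat 0 (s - 1)).

Lemma flat0_gt0 x : 0 < x -> 0 < flat 0 x.
Proof. by move=> x0; rewrite /flat x0 expr0 mul1r expR_gt0. Qed.

Lemma flat_eq0 n x : x <= 0 -> flat n x = 0.
Proof. by move=> x0; rewrite /flat ltNge x0. Qed.

Lemma step_den s : 0 < flat 0 (2 - s) + flat 0 (s - 1).
Proof.
have [s2|s2] := ltP s 2.
  by rewrite ltr_wpDr ?flat_ge0// flat0_gt0// subr_gt0.
by rewrite ltr_wpDl ?flat_ge0// flat0_gt0// subr_gt0 (lt_le_trans _ s2)// ltr1n.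
Qed.

Lemma step_ge0 s : 0 <= step s.
Proof. by rewrite divr_ge0 ?flat_ge0// ltW// step_den. Qed.

Lemma step_le1 s : step s <= 1.
Proof. by rewrite ler_pdivrMr ?step_den// mul1r lerDl flat_ge0. Qed.

Lemma step1 s : s <= 1 -> step s = 1.
Proof.
move=> s1; have := step_den s; rewrite /step (@flat_eq0 0 (s - 1)) ?addr0 ?subr_le0//.
by move=> h; rewrite divff// gt_eqF.
Qed.

Lemma step0 s : 2 <= s -> step s = 0.
Proof. by move=> s1; rewrite /step flat_eq0 ?mul0r// subr_le0. Qed.

Lemma Ck1_step D n : Ck1 D n step.
Proof.
have A (r t : R) : Ck1 D n (fun s => flat 0 (r * s + t)).
  apply: (@Ck1_comp _ setT _ (flat 0) (fun s => r * s + t)) => //.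
    exact: Ck1_flat.
  exact: Ck1_affine.
have A1 : Ck1 D n (fun s => flat 0 (2 - s)).
  by rewrite (_ : (fun s => _) = (fun s => flat 0 (-1 * s + 2))) //;
    apply/funext => s; rewrite addrC mulN1r.
have A2 : Ck1 D n (fun s => flat 0 (s - 1)).
  by rewrite (_ : (fun s => _) = (fun s => flat 0 (1 * s + -1))) //;
    apply/funext => s; rewrite mul1r.
apply: (@Ck1M _ _ _ (fun s => (flat 0 (2 - s) + flat 0 (s - 1))^-1)) => //.
apply: Ck1V; last exact: Ck1D.
by move=> s _; rewrite gt_eqF// step_den.
Qed.

End smooth_1d.

(** * Norms on the space and test functions *)

Section test_functions.
Context {R : realType}.
Local Notation E := (R * R * R)%type.
Implicit Types (f : E -> R) (c z : E).

Lemma norm3_le z (M : R) : (`|z| <= M) <-> (forall i, `|coord i z| <= M).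
Proof.
rewrite prod_normE/= prod_normE/= !ge_max; split.
  move=> /andP[/andP[h1 h2] h3] i; rewrite /coord.
  by case: (nat_of_ord i == 0%N) => //; case: (nat_of_ord i == 1%N).
move=> h; apply/andP; split; first (apply/andP; split).
- exact: (h (@Ordinal 3 0 isT)).
- exact: (h (@Ordinal 3 1 isT)).
- exact: (h (@Ordinal 3 2 isT)).
Qed.

Lemma coord_le i z : `|coord i z| <= `|z|.
Proof. by move: i; apply/norm3_le. Qed.

Lemma compact_ball3 (M : R) : compact [set z : E | `|z| <= M].
Proof.
have -> : [set z : E | `|z| <= M] = (`[-M, M] `*` `[-M, M]) `*` `[-M, M].
  apply/seteqP; split => [z /=|z /=].
    rewrite prod_normE/= prod_normE/= !ge_max !ler_norml !in_itv/=.
    by move=> /andP[/andP[? ?] ?].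
  rewrite !in_itv/= prod_normE/= prod_normE/= !ge_max !ler_norml.
  by move=> [[-> ->] ->].
apply: compact_setX; first apply: compact_setX; exact: segment_compact.
Qed.

Lemma bounded_on_cube (f : E -> R) (N : R) : continuous f ->
  exists2 C, 0 <= C & forall z, `|z| <= N -> `|f z| <= C.
Proof.
move=> cf; have := @compact_bounded R R^o (f @` [set z : E | `|z| <= N])
  (continuous_compact (continuous_subspaceT cf) (@compact_ball3 N)).
move=> [C [_ hC]]; exists (Num.max 0 (C + 1)); first by rewrite le_max lexx.
move=> z zN; rewrite le_max; apply/orP; right.
by apply: (hC (C + 1)); [rewrite ltrDl|exists z].
Qed.

Lemma test_of_Ck3 f (M : R) : (forall n, Ck3 n f) ->
  (forall z, M < `|z| -> f z = 0) -> test_function f.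
Proof.
move=> fs f0; split; first exact: smooth_Ck3.
apply: (subclosed_compact _ (@compact_ball3 M)); first exact: closed_closure.
have cM : closed [set z : E | `|z| <= M].
  apply: compact_closed (@compact_ball3 M); exact: norm_hausdorff.
rewrite [X in _ `<=` X](proj1 (closure_id _) cM).
apply: closure_subset => z /= fz; rewrite leNgt; apply/negP => /f0 fz0.
by rewrite fz0 eqxx in fz.
Qed.

Lemma normB_sqd c z : `|z - c| ^+ 2 <= sqd c z.
Proof.
rewrite -[leRHS](sqr_sqrtr (sqd_ge0 c z)) ler_pXn2r ?nnegrE ?sqrtr_ge0//.
apply/norm3_le => i; rewrite linearB/= -sqrtr_sqr ler_wsqrtr// /sqd (bigD1 i)//=.
by rewrite lerDl sumr_ge0// => j _; exact: sqr_ge0.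
Qed.

Lemma sqd_normB c z : sqd c z <= 3 * `|z - c| ^+ 2.
Proof.
rewrite mulr_natl -[3%N](card_ord 3) -sumr_const; apply: ler_sum => i _.
by rewrite -linearB -(real_normK (num_real _)) lerXn2r ?nnegrE// coord_le.
Qed.

Lemma rad_eq0 (k : R -> R) c (M : R) : 0 <= M -> (forall s, M < s -> k s = 0) ->
  forall z, `|c| + Num.sqrt M < `|z| -> rad k c z = 0.
Proof.
move=> M0 k0 z hz; apply: k0; apply: lt_le_trans (normB_sqd c z).
rewrite -(sqr_sqrtr M0) ltr_pXn2r ?nnegrE ?sqrtr_ge0//.
apply: lt_le_trans (lerB_normD _ _); rewrite ltrBrDl addrC normrN.
by rewrite addrC.
Qed.

Lemma test_rad (k : R -> R) c (M : R) : 0 <= M -> (forall s, M < s -> k s = 0) ->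
  (forall n, Ck1 [set s | 0 <= s] n k) -> test_function (rad k c).
Proof.
move=> M0 kM kC; apply: test_of_Ck3; first by move=> n; exact: Ck3_rad.
exact: rad_eq0 M0 kM.
Qed.

End test_functions.

(** * A parametrix for the bilaplacian *)

Section parametrix.
Context {R : realType}.
Local Notation E := (R * R * R)%type.
Implicit Types (s : R).
Local Notation Dpos := [set s : R | 0 < s].

(** Used to identify the successive derivatives of a cutoff function on the
    intervals where its formula is explicit. *)
Lemma is_derive_unique_on (D : set R) (f g f1 g1 : R -> R) : open D ->
  (forall s, D s -> f s = g s) ->
  (forall s, D s -> is_derive s 1 f (f1 s)) ->
  (forall s, D s -> is_derive s 1 g (g1 s)) ->
  forall s, D s -> f1 s = g1 s.
Proof.
move=> oD fg df dg s Ds; have [_ <-] := df s Ds; have [_ <-] := dg s Ds.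
apply: near_eq_derive; near=> x; apply: fg; near: x.
exact: open_nbhs_nbhs.
Unshelve. all: by end_near. Qed.

Lemma derive_cst_outside (f f' : R -> R) (r : R) :
  (forall s, s < 1 -> f s = r) -> (forall s, 2 < s -> f s = 0) ->
  (forall s : R, is_derive s 1 f (f' s)) ->
  (forall s, s < 1 -> f' s = 0) /\ (forall s, 2 < s -> f' s = 0).
Proof.
move=> f1 f2 df; split => s hs.
- have o : open (`]-oo, 1[%classic : set R) by exact: interval_open.
  have e t : (`]-oo, 1[%classic : set R) t -> f t = cst r t.
    by rewrite /= in_itv/= => /f1.
  have hs' : (`]-oo, 1[%classic : set R) s by rewrite /= in_itv.
  exact: (is_derive_unique_on o e (fun t _ => df t) (fun t _ => is_derive_cst r t 1) hs').
- have o : open (`]2, +oo[%classic : set R) by exact: interval_open.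
  have e t : (`]2, +oo[%classic : set R) t -> f t = cst 0 t.
    by rewrite /= in_itv/= andbT => /f2.
  have hs' : (`]2, +oo[%classic : set R) s by rewrite /= in_itv/= andbT.
  exact: (is_derive_unique_on o e (fun t _ => df t) (fun t _ => is_derive_cst 0 t 1) hs').
Qed.

Lemma is_derive_sqrtX j s : 0 < s ->
  is_derive s 1 (fun s => Num.sqrt s * s^-1 ^+ j)
    ((2^-1 - j%:R) * (Num.sqrt s * s^-1 ^+ j.+1)).
Proof.
move=> s0; have sn0 : s != 0 by rewrite gt_eqF.
have dX := is_derive_invX j sn0.
have H := is_deriveM (is_derive1_sqrt s0) dX.
have -> : (2^-1 - j%:R) * (Num.sqrt s * s^-1 ^+ j.+1) =
   Num.sqrt s *: (j%:R * s^-1 ^+ j.-1 * - s ^- 2)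
   + s^-1 ^+ j *: (2 * Num.sqrt s)^-1.
  have -> : (2 * Num.sqrt s)^-1 = 2^-1 * Num.sqrt s * s^-1.
    rewrite -[in s^-1](sqr_sqrtr (ltW s0)); field.
    by rewrite gt_eqF// sqrtr_gt0.
  rewrite /GRing.scale/= -exprVn.
  by case: j {dX H} => [|j] /=; rewrite ?exprS ?expr0; ring.
exact: H.
Qed.

(** As a function of s = |z|^2 this is |z| near the origin, the fundamental
    solution of the bilaplacian up to a factor. *)
Definition pker s : R := Num.sqrt s * step s.

(** Minus the bilaplacian of sqrt (|z|^2 + d), as a function of
    s = |z|^2 + d, is d^2 times 15 s^(-7/2); here it is cut off for s >= 2. *)
Definition delta_ker s : R := 15 * (Num.sqrt s * s^-1 ^+ 4) * step s.

(** One continuous derivative is all that the convolution with these kernels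
    requires. *)
Definition annular_pos (w : R -> R) : Prop := Ck1 Dpos 1 w /\
  (forall s, 0 < s -> s < 1 -> w s = 0) /\ (forall s, 2 < s -> w s = 0).

Lemma Ck1_pker n : Ck1 Dpos n pker.
Proof. by apply: Ck1M; [exact: Ck1_sqrt|exact: Ck1_step]. Qed.

(** Where s = |z|^2 + d is less than 1, the cutoff equals 1 and the bilaplacian
    is the explicit -15 d^2 s^(-7/2).  For s >= 1 all the terms coming from the
    derivatives of the cutoff are polynomials in d whose coefficients are
    bounded functions of s, because |z|^2 = s - d. *)
Lemma parametrix_pos : exists w0 w1 w2 : R -> R,
  [/\ annular_pos w0, annular_pos w1, annular_pos w2 &
  forall (d : R) (c : E), 0 < d ->
    test_function (rad (fun t => pker (t + d)) c) /\
    laplacian (laplacian (rad (fun t => pker (t + d)) c)) =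
    rad (fun t => w0 (t + d) + d * w1 (t + d) + d ^+ 2 * w2 (t + d)
       - d ^+ 2 * delta_ker (t + d)) c].
Proof.
have [g1 [d1 [g2 [d2 [g3 [d3 [g4 [d4 Cg4]]]]]]]] := Ck1_pker 5.
pose I01 : set R := `]0, 1[%classic; pose I2 : set R := `]2, +oo[%classic.
have o01 : open I01 by exact: interval_open.
have o2 : open I2 by exact: interval_open.
pose r j s : R := Num.sqrt s * s^-1 ^+ j.
have dr (b : R) j s : 0 < s -> is_derive s 1 (fun s => b * r j s)
    (b * ((2^-1 - j%:R) * r j.+1 s)).
  by move=> s0; apply: is_deriveZ; exact: is_derive_sqrtX.
have in01 s : I01 s -> 0 < s by rewrite /I01 /I2 /= in_itv/= => /andP[].
have in2 s : I2 s -> 0 < s.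
  by rewrite /I01 /I2 /= in_itv/= andbT; apply: lt_trans; rewrite ltr0n.
have e0 s : I01 s -> pker s = 1 * r 0 s.
  rewrite /I01 /I2 /= in_itv/= /pker /r => /andP[_ s1].
  by rewrite step1 ?(ltW s1)// expr0 !(mulr1, mul1r).
have e1 := is_derive_unique_on o01 e0 (fun s h => d1 s (in01 s h))
  (fun s h => dr 1 0 s (in01 s h)).
have step_ (b1 b2 : R) j (f f' : R -> R) :
    (forall s, 0 < s -> is_derive s 1 f (f' s)) ->
    (forall s, I01 s -> f s = b1 * r j s) ->
    b2 = b1 * (2^-1 - j%:R) ->
    forall s, I01 s -> f' s = b2 * r j.+1 s.
  move=> df fe -> s Ds.
  rewrite (is_derive_unique_on o01 fe (fun s h => df s (in01 s h))
    (fun s h => dr b1 j s (in01 s h)) Ds).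
  by rewrite mulrA.
have {}e1 : forall s, I01 s -> g1 s = 2^-1 * r 1 s.
  by apply: (step_ _ _ _ _ _ d1 e0); field.
have e2 : forall s, I01 s -> g2 s = - 4^-1 * r 2 s.
  by apply: (step_ _ _ _ _ _ d2 e1); field.
have e3 : forall s, I01 s -> g3 s = 3 / 8 * r 3 s.
  by apply: (step_ _ _ _ _ _ d3 e2); field.
have e4 : forall s, I01 s -> g4 s = - (15 / 16) * r 4 s.
  by apply: (step_ _ _ _ _ _ d4 e3); field.
have z_ (f f' : R -> R) :
    (forall s, 0 < s -> is_derive s 1 f (f' s)) ->
    (forall s, I2 s -> f s = 0) ->
    forall s, I2 s -> f' s = 0.
  move=> df f0; apply: (@is_derive_unique_on _ f (cst 0) f' (cst 0) o2 f0).
    by move=> s h; apply: df; exact: in2.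
have z0 s : I2 s -> pker s = 0.
  by rewrite /I01 /I2 /= in_itv/= andbT /pker => /ltW /step0 ->; rewrite mulr0.
have z1 := z_ _ _ d1 z0.
have z2 := z_ _ _ d2 z1.
have z3 := z_ _ _ d3 z2.
have z4 := z_ _ _ d4 z3.
have C4 : Ck1 Dpos 1 g4 by exact: Cg4.
have C3 : Ck1 Dpos 1 g3 by exists g4; split => //; exact: (Ck1W C4).
have C2 : Ck1 Dpos 1 g2 by exists g3; split => //; exact: (Ck1W C3).
have Cid : Ck1 Dpos 1 (fun s => s) by exact: Ck1_id.
have Cr : Ck1 Dpos 1 (fun s => 15 * r 4 s * step s).
  apply: (@Ck1M _ _ _ (fun s => 15 * r 4 s)); last exact: Ck1_step.
  have dr1 b j : Ck1 Dpos 0 (fun s => b * r j s).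
    by exists (fun s => b * ((2^-1 - j%:R) * r j.+1 s)); split => // s; exact: dr.
  exists (fun s => 15 * ((2^-1 - 4%:R) * r 5 s)).
  split; first by move=> s s0; exact: (dr 15 4 s s0).
  rewrite (_ : (fun s => _) = (fun s => (15 * (2^-1 - 4%:R)) * r 5 s)).
    exact: (dr1 _ 5).
  by apply/funext => s; rewrite mulrA.
(* The bilaplacian of g (|z|^2 + d) is 60 g'' + 80 (s - d) g^(3) +
   16 (s - d)^2 g^(4) at s = |z|^2 + d; the three kernels are its coefficients
   in d, and w2 also compensates the term delta_ker. *)
exists (fun s => 60 * g2 s + 80 * (s * g3 s) + 16 * (s * (s * g4 s))).
exists (fun s => -80 * g3 s + -32 * (s * g4 s)).
exists (fun s => 16 * g4 s + 15 * r 4 s * step s).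
split.
- split; [|split].
  + apply: (@Ck1D _ _ _ (fun s => 60 * g2 s + 80 * (s * g3 s))).
      apply: Ck1D; apply: Ck1Z => //; exact: Ck1M.
    by apply: Ck1Z; apply: Ck1M => //; exact: Ck1M.
  + move=> s s0 s1; have h : I01 s by rewrite /I01 /I2 /= in_itv/= s0.
    rewrite e2// e3// e4// /r !exprVn; field; by rewrite gt_eqF.
  + move=> s s2; have h : I2 s by rewrite /I01 /I2 /= in_itv/= andbT.
    by rewrite z2// z3// z4// !mulr0 !addr0.
- split; [|split].
  + by apply: Ck1D; apply: Ck1Z => //; exact: Ck1M.
  + move=> s s0 s1; have h : I01 s by rewrite /I01 /I2 /= in_itv/= s0.
    rewrite e3// e4// /r !exprVn; field; by rewrite gt_eqF.
  + move=> s s2; have h : I2 s by rewrite /I01 /I2 /= in_itv/= andbT.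
    by rewrite z3// z4// !mulr0 !addr0.
- split; [|split].
  + by apply: (@Ck1D _ _ _ (fun s => 16 * g4 s)) => //; exact: Ck1Z.
  + move=> s s0 s1; have h : I01 s by rewrite /I01 /I2 /= in_itv/= s0.
    rewrite e4// step1 ?ltW// /r !exprVn; field; by rewrite gt_eqF.
  + move=> s s2; have h : I2 s by rewrite /I01 /I2 /= in_itv/= andbT.
    by rewrite z4// step0 ?ltW// !mulr0 !addr0.
- move=> d c d0.
  have pos (t : R) : 0 <= t -> 0 < t + d by move=> t0; rewrite ltr_wpDl.
  have sh (f f' : R -> R) : (forall s, 0 < s -> is_derive s 1 f (f' s)) ->
      forall t : R, 0 <= t -> is_derive t 1 (fun t => f (t + d)) (f' (t + d)).
    move=> df t t0; rewrite -[f' _]mulr1.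
    apply: (@is_derive1_comp _ f (fun t => t + d)); first by apply: df; exact: pos.
    by rewrite -[X in is_derive _ _ _ X]addr0; apply: is_deriveD.
  split.
    apply: (@test_rad _ _ _ 2) => //.
      move=> s s2; apply: z0; rewrite /I01 /I2 /= in_itv/= andbT.
      by rewrite (lt_trans s2)// ltrDl.
    move=> n; apply: (@Ck1_comp _ _ Dpos _ pker (fun t => t + d)) => //.
      exact: Ck1_pker.
    by apply: Ck1D; [exact: Ck1_id|exact: Ck1_cst].
  rewrite (laplacian_rad c (sh _ _ d1) (sh _ _ d2)).
  have i1 (b t : R) : is_derive t 1 (fun t : R => b * t) b.
    have : is_derive t 1 (fun t : R => b *: t) (b *: 1) by exact: is_deriveZ.
    by rewrite /GRing.scale/= mulr1.
  have D1 (t : R) : 0 <= t -> is_derive t 1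
     (fun s => 6 * g1 (s + d) + 4 * s * g2 (s + d))
     (10 * g2 (t + d) + 4 * t * g3 (t + d)).
    move=> t0; have H1 := sh _ _ d2 t t0; have H2 := sh _ _ d3 t t0.
    have H3 := is_deriveD (is_deriveZ 6 H1) (is_deriveM (i1 4 t) H2).
    apply: is_derive_eq.
    by rewrite /GRing.scale/=; ring.
  have D2 (t : R) : 0 <= t -> is_derive t 1
     (fun s => 10 * g2 (s + d) + 4 * s * g3 (s + d))
     (14 * g3 (t + d) + 4 * t * g4 (t + d)).
    move=> t0; have H1 := sh _ _ d3 t t0; have H2 := sh _ _ d4 t t0.
    have H3 := is_deriveD (is_deriveZ 10 H1) (is_deriveM (i1 4 t) H2).
    apply: is_derive_eq.
    by rewrite /GRing.scale/=; ring.
  rewrite (laplacian_rad c D1 D2); congr (rad _ c); apply/funext => t.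
  by rewrite /delta_ker -/(r 4 (t + d)); ring.
Qed.

Definition annular (w : R -> R) : Prop := Ck1 setT 1 w /\
  (forall s, s < 1 -> w s = 0) /\ (forall s, 2 < s -> w s = 0).

Definition extend0 (w : R -> R) (s : R) : R := if 0 < s then w s else 0.

Lemma extend0E w s : 0 < s -> extend0 w s = w s.
Proof. by rewrite /extend0 => ->. Qed.

Lemma Ck1_extend0 n w : Ck1 Dpos n w -> (forall s, 0 < s -> s < 1 -> w s = 0) ->
  Ck1 setT n (extend0 w).
Proof.
have D (w1 w1' : R -> R) : (forall s, 0 < s -> is_derive s 1 w1 (w1' s)) ->
    (forall s, 0 < s -> s < 1 -> w1 s = 0) ->
    forall s, is_derive s 1 (extend0 w1) (extend0 w1' s).
  move=> dw w0 s; have [s0|s0] := ltP 0 s.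
    rewrite extend0E//; apply: near_eq_is_derive (dw _ s0); near=> y.
    rewrite extend0E//; near: y; exact: lt_nbhsr.
  rewrite /extend0 ltNge s0/=.
  apply: (@near_eq_is_derive R R R (cst (0 : R))); near=> y.
  case: ifPn => // y0; rewrite w0//; near: y; apply: lt_nbhsl.
  by rewrite (le_lt_trans s0).
have Z (w1 w1' : R -> R) : (forall s, 0 < s -> is_derive s 1 w1 (w1' s)) ->
    (forall s, 0 < s -> s < 1 -> w1 s = 0) -> forall s, 0 < s -> s < 1 -> w1' s = 0.
  move=> dw w0 s s0 s1.
  have o01 : open (`]0, 1[%classic : set R) by exact: interval_open.
  have s01 : (`]0, 1[%classic : set R) s by rewrite /= in_itv/= s0.
  have H1 t : (`]0, 1[%classic : set R) t -> cst 0 t = w1 t.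
    by rewrite /= in_itv/= => /andP[t0 t1]; rewrite w0.
  have H2 t : (`]0, 1[%classic : set R) t -> is_derive t 1 (cst (0 : R)) (cst (0 : R) t).
    by move=> _; exact: is_derive_cst.
  have H3 t : (`]0, 1[%classic : set R) t -> is_derive t 1 w1 (w1' t).
    by rewrite /= in_itv/= => /andP[t0 _]; exact: dw.
  by rewrite -(is_derive_unique_on o01 H1 H2 H3 s01).
elim: n w => [|n IH] w [w' [dw h]] w0; exists (extend0 w'); split => //;
  try by (move=> s _; exact: D).
apply: IH => //; exact: Z dw w0.
Unshelve. all: by end_near. Qed.

Lemma annular_extend0 w : annular_pos w -> annular (extend0 w).
Proof.
move=> [Cw [w1 w2]]; split; first exact: Ck1_extend0.
split => s s1; rewrite /extend0; case: ifPn => // s0; [exact: w1|exact: w2].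
Qed.

(** Extending the annular kernels by 0 to s <= 0 makes them functions on the
    whole line without changing their values at |z|^2 + d > 0. *)
Lemma parametrix : exists w0 w1 w2 : R -> R,
  [/\ annular w0, annular w1, annular w2 &
  forall (d : R) (c : E), 0 < d ->
    test_function (rad (fun t => pker (t + d)) c) /\
    laplacian (laplacian (rad (fun t => pker (t + d)) c)) =
    rad (fun t => w0 (t + d) + d * w1 (t + d) + d ^+ 2 * w2 (t + d)
       - d ^+ 2 * delta_ker (t + d)) c].
Proof.
have [w0 [w1 [w2 [a0 a1 a2 H]]]] := parametrix_pos.
exists (extend0 w0), (extend0 w1), (extend0 w2); split;
  try exact: annular_extend0.
move=> d c d0; have [H1 H2] := H d c d0; split => //.
rewrite H2; apply/funext => z; rewrite /rad !extend0E// ltr_wpDl//;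
  exact: sqd_ge0.
Qed.

End parametrix.

(** * Lebesgue measure and integrals in dimension three *)

Section box_measure.
Context {R : realType}.
Local Notation E := (R * R * R)%type.
Local Notation leb := (@lebesgue_measure R).

Lemma leb3_box (A B C : set R) : measurable A -> measurable B -> measurable C ->
  leb3 R ((A `*` B) `*` C) = (leb A * leb B * leb C)%E.
Proof.
move=> mA mB mC; rewrite /leb3 product_measure1E//; last exact: measurableX.
by rewrite /= product_measure1E.
Qed.

Definition cube (M : R) : set E := [set z : E | `|z| <= M].

Lemma cubeE M : cube M = (`[-M, M] `*` `[-M, M]) `*` `[-M, M].
Proof.
apply/seteqP; split => [z|z]; rewrite /cube /= !in_itv/=
  prod_normE/= prod_normE/= !ge_max !ler_norml; last by move=> [[-> ->] ->].
by move=> /andP[/andP[? ?] ?].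
Qed.

Lemma measurable_cube M : measurable (cube M).
Proof. by rewrite cubeE; apply: measurableX => //; exact: measurableX. Qed.

Lemma leb3_cube M : 0 <= M -> leb3 R (cube M) = (8 * M ^+ 3)%:E.
Proof.
move=> M0; rewrite cubeE leb3_box// !lebesgue_measure_itv/= !lte_fin.
case: ifPn => h; first by rewrite -!EFinM; congr EFin; ring.
by rewrite -leNgt in h; rewrite mule0 (_ : M = 0) ?expr0n/= ?mulr0//; lra.
Qed.

Lemma leb3_cube_lty M : (leb3 R (cube M) < +oo)%E.
Proof.
have [M0|M0] := leP 0 M; first by rewrite leb3_cube// ltry.
rewrite (_ : cube M = set0) ?measure0//; apply/seteqP; split => // z /=.
by move=> h; have := le_trans (normr_ge0 _) h; rewrite leNgt M0.
Qed.

End box_measure.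

Definition leb2 (R : realType) := (@lebesgue_measure R \x @lebesgue_measure R)%E.
Arguments leb2 : clear implicits.
HB.instance Definition _ (R : realType) := Measure.on (leb2 R).

Lemma leb2_sigma_finite (R : realType) : sigma_finite setT (leb2 R).
Proof.
exists (fun n => `[- n%:R, n%:R] `*` `[- n%:R, n%:R]).
  apply/esym/seteqP; split => // z _; exists (Num.truncn `|z|).+1 => //.
  have : `|z| <= (Num.truncn `|z|).+1%:R by apply/ltW; exact: truncnS_gt.
  by rewrite prod_normE/= ge_max !ler_norml /= !in_itv/= => /andP[-> ->].
move=> n; split; first exact: measurableX.
rewrite /leb2 product_measure1E//= !lebesgue_measure_itv/= !lte_fin.
by case: ifPn => _; rewrite ?mule0 ?ltry// -EFinM ltry.
Qed.

HB.instance Definition _ (R : realType) :=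
  Measure_isSigmaFinite.Build _ _ R (leb2 R) (@leb2_sigma_finite R).

Lemma leb3_sigma_finite (R : realType) : sigma_finite setT (leb3 R).
Proof.
exists (fun n => cube n%:R).
  apply/esym/seteqP; split => // z _; exists (Num.truncn `|z|).+1 => //.
  by rewrite /cube /=; apply/ltW; exact: truncnS_gt.
by move=> n; split; [exact: measurable_cube|rewrite leb3_cube// ltry].
Qed.

HB.instance Definition _ (R : realType) :=
  Measure_isSigmaFinite.Build _ _ R (leb3 R) (@leb3_sigma_finite R).

Section integrals3.
Context {R : realType}.
Local Notation E := (R * R * R)%type.
Local Notation mu := (leb3 R).
Local Notation leb := (@lebesgue_measure R).

Section real_integral.
Local Open Scope ring_scope.
Context d (T : measurableType d) (m : {measure set T -> \bar R}).
Implicit Types f g : T -> R.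

Lemma integrable_EFin_Rintegral D f : measurable D -> m.-integrable D (EFin \o f) ->
  (\int[m]_(x in D) (f x)%:E)%E = (\int[m]_(x in D) f x)%:E.
Proof. by move=> mD fi; rewrite fineK//; exact: integrable_fin_num. Qed.

Lemma integrable_dominated f (g : T -> R) :
  measurable_fun setT f -> m.-integrable setT (EFin \o g) ->
  (forall x, `|f x| <= g x) -> m.-integrable setT (EFin \o f).
Proof.
move=> mf gi fg; apply: le_integrable gi => //; first exact/measurable_EFinP.
move=> x _ /=; rewrite lee_fin (le_trans (fg x))//; exact: ler_norm.
Qed.

(** Everywhere convergence makes the measurability of the limit automatic. *)
Lemma Rintegral_dominated_cvg (f_ : nat -> T -> R) f (g : T -> R) :
  (forall n, measurable_fun setT (f_ n)) ->
  m.-integrable setT (EFin \o g) ->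
  (forall n x, `|f_ n x| <= g x) ->
  (forall x, f_ n x @[n --> \oo] --> f x) ->
  m.-integrable setT (EFin \o f) /\
  \int[m]_x f_ n x @[n --> \oo] --> \int[m]_x f x.
Proof.
move=> mf gi fg ff.
have mF : measurable_fun setT f.
  by apply: (@measurable_fun_cvg _ _ R setT f_ f) => // x _; exact: ff.
have h := @dominated_convergence _ T R m setT measurableT
  (fun n x => (f_ n x)%:E) (EFin \o f) (EFin \o g).
have [||||h1 h2 h3] := h _ _ _ gi _.
- by move=> n; exact/measurable_EFinP.
- exact/measurable_EFinP.
- by apply: aeW => x _; apply: cvg_EFin; [exact: nearW|exact: ff].
- by apply: aeW => x n _ /=; rewrite lee_fin.
split => //.
have : (\int[m]_x (f_ n x)%:E)%E @[n --> \oo] --> (\int[m]_x f x)%:E.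
  by rewrite -integrable_EFin_Rintegral.
by move/fine_cvg.
Qed.

Lemma Rintegral_ae_eq f g : measurable_fun setT f -> measurable_fun setT g ->
  {ae m, forall x, f x = g x} -> \int[m]_x f x = \int[m]_x g x.
Proof.
move=> mf mg fg; congr fine; apply: ae_eq_integral => //.
- exact/measurable_EFinP.
- exact/measurable_EFinP.
- by apply: filterS fg => x fgx _ /=; rewrite fgx.
Qed.

End real_integral.

Section affine.
Local Open Scope ereal_scope.

Lemma measurable_affine (p r : R) : measurable_fun [set: measurableTypeR R]
  ((fun t : R => p + r * t)%R : measurableTypeR R -> measurableTypeR R).
Proof. by apply: measurable_funD => //; apply: measurable_funM. Qed.

Definition leb_affine (p r : R) : {measure set (measurableTypeR R) -> \bar R} :=
  measure_function_pushforward__canonical__measure_function_Measure leb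
    (measurable_affine p r).

(** Lebesgue measure is determined by its values on intervals. *)
Lemma lebesgue_measure_affine (p r : R) (r0 : (0 < r)%R) (A : set R) :
  measurable A -> leb A = mscale (NngNum (ltW r0)) (leb_affine p r) A.
Proof.
move=> mA; apply: lebesgue_measure_unique => //.
move=> _ [[a b]] _ <- /=; rewrite /mscale/= /pushforward/=.
have -> : (fun t : R => p + r * t)%R @^-1` `]a, b]%classic =
   `](a - p) / r, (b - p) / r]%classic%R.
  apply/seteqP; split => t /=; rewrite !in_itv/= ltr_pdivrMr// ler_pdivlMr//;
   by rewrite ltrBlDl lerBrDl (mulrC t).
rewrite !lebesgue_measure_itv/= !lte_fin ltr_pM2r ?invr_gt0// ltrD2r.
case: ifPn => ab; last by rewrite mule0.
rewrite -!EFinB -EFinM; congr EFin; field; by rewrite gt_eqF.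
Qed.

Lemma ge0_integral_affine (p r : R) (f : R -> \bar R) : (0 < r)%R ->
  measurable_fun setT f -> (forall x, 0 <= f x) ->
  \int[leb]_x f x = r%:E * \int[leb]_t f (p + r * t)%R.
Proof.
move=> r0 mf f0.
transitivity (\int[mscale (NngNum (ltW r0)) (leb_affine p r)]_x f x).
  by apply: eq_measure_integral => A mA _; exact: lebesgue_measure_affine.
rewrite ge0_integral_mscale//; congr (_ * _).
by rewrite (ge0_integral_pushforward (measurable_affine p r)).
Qed.

Lemma measurable_affine3 (p : E) (r : R) : measurable_fun setT (fun t : E => (p + r *: t)%R).
Proof.
have ms (q : R) : measurable_fun [set: R] (fun t : R => q + r * t)%R.
  by apply: measurable_funD => //; apply: measurable_funM.
apply/measurable_fun_pairP; split; first apply/measurable_fun_pairP; first split.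
- apply: (measurableT_comp (ms p.1.1)) => //.
  exact: (measurableT_comp measurable_fst measurable_fst).
- apply: (measurableT_comp (ms p.1.2)) => //.
  exact: (measurableT_comp measurable_snd measurable_fst).
- exact: (measurableT_comp (ms p.2) measurable_snd).
Qed.

Lemma ge0_integral3E (f : E -> \bar R) :
  measurable_fun setT f -> (forall x, 0 <= f x) ->
  \int[mu]_x f x = \int[leb]_x \int[leb]_y \int[leb]_z f (x, y, z).
Proof.
move=> mf f0.
have h := @fubini_tonelli1 _ _ _ _ R (leb2 R) leb f mf f0.
apply: etrans; first by apply: (etrans _ h); apply: eq_measure_integral.
rewrite (@fubini_tonelli1 _ _ _ _ R leb leb (fubini_F leb f))//.
  exact: measurable_fun_fubini_tonelli_F.
by move=> x; exact: integral_ge0.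
Qed.

Lemma measurable_integral_z (f : E -> \bar R) (x : R) :
  measurable_fun setT f -> (forall x, 0 <= f x) ->
  measurable_fun setT (fun y : R => \int[leb]_z f (x, y, z)).
Proof.
move=> mf f0; have F1 := @measurable_fun_fubini_tonelli_F _ _ _ _ R leb f mf f0.
exact: (measurableT_comp F1 (pair1_measurable x)).
Qed.

Lemma measurable_integral_yz (f : E -> \bar R) :
  measurable_fun setT f -> (forall x, 0 <= f x) ->
  measurable_fun setT (fun x : R => \int[leb]_y \int[leb]_z f (x, y, z)).
Proof.
move=> mf f0.
apply: (@measurable_fun_fubini_tonelli_F _ _ _ _ R leb
  (fun xy : R * R => \int[leb]_z f (xy, z))) => //.
  exact: measurable_fun_fubini_tonelli_F.
by move=> xy; exact: integral_ge0.
Qed.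

(** One-dimensional affine changes of variables, one coordinate at a time,
    through Tonelli's theorem. *)
Lemma ge0_integral3_affine (p : E) (r : R) (f : E -> \bar R) : (0 < r)%R ->
  measurable_fun setT f -> (forall x, 0 <= f x) ->
  \int[mu]_x f x = (r ^+ 3)%:E * \int[mu]_t f (p + r *: t)%R.
Proof.
move=> r0 mf f0.
have mphi := measurable_affine3 p r.
rewrite !ge0_integral3E//; last exact: measurableT_comp.
have m1 x y : measurable_fun setT (fun z : R => f (x, y, z)).
  by apply: measurableT_comp => //; exact: pair1_measurable.
have m2 x := measurable_integral_z x mf f0.
have m3 := measurable_integral_yz mf f0.
have mg : measurable_fun setT (fun t : E => f (p + r *: t)%R) by exact: measurableT_comp.
have p3 x y : 0 <= \int[leb]_z f (x, y, z) by exact: integral_ge0.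
have p2 x : 0 <= \int[leb]_y \int[leb]_z f (x, y, z) by exact: integral_ge0.
apply: (etrans (ge0_integral_affine p.1.1 r0 m3 p2)).
rewrite exprS EFinM -muleA; congr (_ * _).
transitivity (\int[leb]_x ((r ^+ 2)%:E * \int[leb]_y \int[leb]_z f (p + r *: (x, y, z))%R)); last first.
  apply: ge0_integralZl => //.
  - exact: (measurable_integral_yz mg (fun t => f0 _)).
  - by move=> x _; apply: integral_ge0 => y _; exact: integral_ge0.
  - by rewrite lee_fin exprn_ge0 ?ltW.
apply: eq_integral => x _.
apply: (etrans (ge0_integral_affine p.1.2 r0 (m2 _) (p3 _))).
rewrite exprS EFinM -muleA; congr (_ * _).
transitivity (\int[leb]_y (r%:E * \int[leb]_z f (p + r *: (x, y, z))%R)); last first.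
  apply: ge0_integralZl => //.
  - exact: (measurable_integral_z x mg (fun t => f0 _)).
  - by move=> y _; exact: integral_ge0.
  - by rewrite lee_fin ltW.
apply: eq_integral => y _.
exact: (ge0_integral_affine p.2 r0 (m1 _ _)).
Qed.

End affine.
End integrals3.

(** * Convolution with bounded radial kernels of bounded support *)

Section kernels.
Context {R : realType}.
Local Notation E := (R * R * R)%type.
Local Notation mu := (leb3 R).
Implicit Types (f : E -> R) (k : R -> R) (c x y z : E).

(** Local integrability in the form in which it is used: cubes are compact and
    every bounded set is contained in one of them. *)
Definition lint f : Prop := measurable_fun setT f /\
  forall M : R, mu.-integrable (cube M) (EFin \o f).

Lemma lint_loc f : measurable_fun setT f -> loc_integrable f -> lint f.
Proof. by move=> mf lf; split => // M; apply: lf; exact: compact_ball3. Qed.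

Definition trunc f (M : R) : E -> R := f \_ (cube M).

Lemma truncE f M z : trunc f M z = if `|z| <= M then f z else 0.
Proof.
rewrite /trunc /patch; case: ifPn => h; case: ifPn => h' //.
- by exfalso; move/negP : h'; apply; move/set_mem : h.
- by exfalso; move/negP : h; apply; apply/mem_set.
Qed.

Lemma integrable_trunc f M : lint f -> mu.-integrable setT (EFin \o trunc f M).
Proof.
move=> [mf fi].
rewrite (_ : EFin \o trunc f M = (EFin \o f) \_ (cube M)).
  have h := @integrable_mkcond _ _ R mu (cube M) (EFin \o f) (@measurable_cube R M).
  exact: h.1 (fi M).
by apply/funext => x; rewrite /trunc /= /patch; case: ifP.
Qed.

Lemma integrable_trunc_abs f M (C : R) : lint f ->
  mu.-integrable setT (EFin \o (fun z => C * `|trunc f M z|)).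
Proof.
move=> fl; have h := integrable_norm (integrable_trunc M fl).
have := @integrableZl _ _ R mu setT measurableT C _ h.
by apply: (@eq_integrable _ _ R mu).
Qed.

Lemma le_trunc f (b : E -> R) (C M : R) :
  (forall z, `|b z| <= C) -> (forall z, M < `|z| -> b z = 0) ->
  forall z, `|f z * b z| <= C * `|trunc f M z|.
Proof.
move=> bC b0 z; have C0 : 0 <= C := le_trans (normr_ge0 _) (bC 0).
rewrite truncE; case: ifPn => h; last by rewrite b0 ?mulr0 ?normr0 ?mulr0// ltNge.
by rewrite normrM mulrC ler_wpM2r.
Qed.

Lemma lint_bounded f (b : E -> R) (C M : R) : lint f -> measurable_fun setT b ->
  (forall z, `|b z| <= C) -> (forall z, M < `|z| -> b z = 0) ->
  mu.-integrable setT (EFin \o (fun z => f z * b z)).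
Proof.
move=> fl mb bC b0.
apply: (@integrable_dominated R _ _ mu _ (fun z => C * `|trunc f M z|)).
- by apply: measurable_funM => //; have [] := fl.
- exact: integrable_trunc_abs.
- exact: le_trunc.
Qed.

Lemma lintM f (b : E -> R) (C : R) : lint f -> measurable_fun setT b ->
  (forall z, `|b z| <= C) -> lint (fun z => f z * b z).
Proof.
move=> [mf fi] mb bC; split; first exact: measurable_funM.
move=> M; have H := integrable_norm (fi M).
apply: (@le_integrable _ _ R mu (cube M) (measurable_cube M) _ (fun z => (C * `|f z|)%:E)).
- by apply/measurable_EFinP; apply: measurable_funTS; exact: measurable_funM.
- move=> z _ /=; rewrite lee_fin normrM mulrC.
  by apply: le_trans (ler_norm _); rewrite ler_wpM2r.
- have := @integrableZl _ _ R mu (cube M) (measurable_cube M) C _ H.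
  by apply: (@eq_integrable _ _ R mu) => //; exact: measurable_cube.
Qed.

Lemma lintD f g : lint f -> lint g -> lint (fun z => f z + g z).
Proof.
move=> [mf fi] [mg gi]; split; first exact: measurable_funD.
move=> M; have := @integrableD _ _ R mu _ (@measurable_cube R M) _ _ (fi M) (gi M).
by apply: (@eq_integrable _ _ R mu) => //; exact: measurable_cube.
Qed.

Lemma lint_cst (r : R) : lint (cst r).
Proof.
split; first exact: measurable_cst.
move=> M; apply/integrableP; split.
  by apply/measurable_EFinP; exact: measurable_cst.
rewrite (@integral_cst _ _ R mu _ (@measurable_cube R M) `|r%:E|%E).
apply: lte_mul_pinfty => //.
exact: leb3_cube_lty.
Qed.

Lemma lint_bounded_on_cubes f : measurable_fun setT f ->
  (forall N : R, exists2 C, 0 <= C & forall z, `|z| <= N -> `|f z| <= C) -> lint f.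
Proof.
move=> mf bf; split => // M; have [C C0 hC] := bf M.
have := (lint_cst C).2 M; apply: (@le_integrable _ _ R mu).
- exact: measurable_cube.
- by apply/measurable_EFinP; exact: measurable_funTS.
- by move=> x xM /=; rewrite lee_fin (ger0_norm C0); exact: hC.
Qed.

Lemma integral_cube (M : R) : 0 <= M ->
  mu.-integrable setT (EFin \o (\1_(cube M) : E -> R)) /\
  \int[mu]_z \1_(cube M) z = 8 * M ^+ 3.
Proof.
move=> M0; have mc := @measurable_cube R M.
have i1 : mu.-integrable setT (EFin \o (\1_(cube M) : E -> R)).
  have := integrable_trunc M (lint_cst 1); apply: (@eq_integrable _ _ R mu) => // z _.
  by rewrite /= /trunc /patch indicE; case: ifP.
split => //; apply: EFin_inj; rewrite -(integrable_EFin_Rintegral measurableT i1).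
rewrite (@integral_indic _ _ R mu setT measurableT _ mc) setIT.
exact: leb3_cube.
Qed.

Lemma measurable_coord i : measurable_fun setT (coord i : E -> R).
Proof.
rewrite /coord; case: (nat_of_ord i == 0%N); last case: (nat_of_ord i == 1%N).
- exact: (measurableT_comp measurable_fst measurable_fst).
- exact: (measurableT_comp measurable_snd measurable_fst).
- exact: measurable_snd.
Qed.

Lemma measurable_sqd2 : measurable_fun setT (fun p : E * E => sqd p.1 p.2).
Proof.
apply: measurable_sum => i; apply: measurable_funX; apply: measurable_funB.
- exact: (measurableT_comp (measurable_coord i) measurable_snd).
- exact: (measurableT_comp (measurable_coord i) measurable_fst).
Qed.

Lemma measurable_rad2 k : measurable_fun setT k ->
  measurable_fun setT (fun p : E * E => rad k p.1 p.2).
Proof. by move=> mk; apply: (measurableT_comp mk); exact: measurable_sqd2. Qed.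

Lemma measurable_rad k c : measurable_fun setT k -> measurable_fun setT (rad k c).
Proof.
by move=> mk; exact: (measurableT_comp (measurable_rad2 mk) (pair1_measurable c)).
Qed.

Lemma radC k x y : rad k x y = rad k y x.
Proof. by rewrite /rad sqdC. Qed.

(** Conditions on a profile [k] under which [rad k c] is bounded by [C] and
    supported in the ball |z - c|^2 <= M. *)
Record kernel k (C M : R) : Prop := Kernel {
  ker_meas : measurable_fun setT k ;
  ker_M0 : 0 <= M ;
  ker_bd : forall s, 0 <= s -> `|k s| <= C ;
  ker_supp : forall s, M < s -> k s = 0 }.

Lemma rad_bd k C M c z : kernel k C M -> `|rad k c z| <= C.
Proof. by move=> K; apply: (ker_bd K); exact: sqd_ge0. Qed.

Lemma rad_supp k C M c z : kernel k C M -> `|c| + Num.sqrt M < `|z| -> rad k c z = 0.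
Proof. by move=> K; apply: rad_eq0; [exact: ker_M0 K|exact: ker_supp K]. Qed.

Lemma continuous_kernel k (M : R) : continuous k -> 0 <= M ->
  (forall s, M < s -> k s = 0) -> exists C, kernel k C M.
Proof.
move=> ck M0 kM.
have cn : {within `[0, M], continuous (fun s => `|k s|)}.
  apply: continuous_subspaceT => s; apply: continuous_comp; first exact: ck.
  exact: norm_continuous.
have [s0 _ hs0] := EVT_max M0 cn.
exists `|k s0|; split => //; first exact: continuous_measurable_fun.
move=> s s_ge0; have [sM|sM] := leP s M; last by rewrite kM// normr0.
by apply: hs0; rewrite in_itv/= s_ge0.
Qed.

Definition conv f k c : R := \int[mu]_y (f y * rad k c y).

Lemma integrable_conv f k C M c : lint f -> kernel k C M ->
  mu.-integrable setT (EFin \o (fun y => f y * rad k c y)).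
Proof.
move=> fl K; apply: (lint_bounded fl (C := C) (M := `|c| + Num.sqrt M)).
- exact: measurable_rad (ker_meas K).
- by move=> z; exact: rad_bd K.
- by move=> z; exact: rad_supp K.
Qed.

Lemma conv_cvg f (k_ : nat -> R -> R) k (C M : R) c : lint f ->
  (forall n, kernel (k_ n) C M) ->
  (forall s, 0 <= s -> k_ n s @[n --> \oo] --> k s) ->
  conv f (k_ n) c @[n --> \oo] --> conv f k c.
Proof.
move=> fl K kk.
have [] // := @Rintegral_dominated_cvg R _ _ mu (fun n y => f y * rad (k_ n) c y)
  (fun y => f y * rad k c y)
  (fun z => C * `|trunc f (`|c| + Num.sqrt M) z|).
- by move=> n; apply: measurable_funM; [have [] := fl|exact: measurable_rad (ker_meas (K n))].
- exact: integrable_trunc_abs.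
- move=> n; apply: le_trunc => z; first exact: rad_bd (K n).
  exact: rad_supp (K n).
- by move=> y; apply: cvgMr; apply: kk; exact: sqd_ge0.
Qed.

Lemma conv_bd f k (C M N : R) c : lint f -> kernel k C M -> `|c| <= N ->
  `|conv f k c| <= C * \int[mu]_y `|trunc f (N + Num.sqrt M) y|.
Proof.
move=> fl K cN; have fi := integrable_conv c fl K.
apply: le_trans (le_normr_Rintegral _ fi) _ => //.
rewrite -RintegralZl//; last first.
  exact: integrable_norm (integrable_trunc _ fl).
apply: le_Rintegral => //.
- exact: integrable_norm fi.
- exact: integrable_trunc_abs.
- move=> z _; apply: le_trunc => y; first exact: rad_bd K.
  move=> h; apply: (rad_supp K); apply: le_lt_trans h.
  by rewrite lerD2r.
Qed.

(** The integrand is dominated by C |f1(x)| |f2(y)| on the product of two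
    cubes, and the integral of this bound is a product. *)
Lemma fubini_kernel f1 f2 (K : E * E -> R) (C M : R) :
  lint f1 -> lint f2 -> measurable_fun setT K -> (forall p, `|K p| <= C) ->
  (forall p : E * E, M < `|p.1 : E| -> K p = 0) -> (forall p : E * E, M < `|p.2 : E| -> K p = 0) ->
  (mu \x mu)%E.-integrable setT (fun p => (f1 p.1 * f2 p.2 * K p)%:E).
Proof.
move=> l1 l2 mK KC K1 K2; have C0 : 0 <= C := le_trans (normr_ge0 _) (KC (0, 0)).
have [mf1 _] := l1; have [mf2 _] := l2.
have mF : measurable_fun setT (fun p : E * E => f1 p.1 * f2 p.2 * K p).
  apply: measurable_funM => //; apply: measurable_funM.
    exact: (measurableT_comp mf1 measurable_fst).
  exact: (measurableT_comp mf2 measurable_snd).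
apply/integrable12ltyP; first exact/measurable_EFinP.
have i1 := integrable_trunc_abs M C l1; have i2 := integrable_trunc_abs M 1 l2.
set I2 := \int[mu]_y (1 * `|trunc f2 M y|).
have I20 : 0 <= I2 by apply: Rintegral_ge0 => y _; rewrite mul1r.
apply: (@le_lt_trans _ _ (\int[mu]_x (I2%:E * (C * `|trunc f1 M x|)%:E))%E).
  apply: ge0_le_integral => //.
  - by move=> x _; exact: integral_ge0.
  - apply: (@measurable_fun_fubini_tonelli_F _ _ _ _ R mu (fun p : E * E => `|(f1 p.1 * f2 p.2 * K p)%:E|%E)) => //.
    by apply/measurableT_comp => //; exact/measurable_EFinP.
  - apply: measurable_funeM; exact: (measurable_int mu i1).
  move=> x _; rewrite -[I2%:E](integrable_EFin_Rintegral measurableT i2).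
  rewrite -ge0_integralZr//; last 2 first.
    exact: (measurable_int mu i2).
    by rewrite lee_fin mulr_ge0.
  apply: ge0_le_integral => //.
  - apply: measurableT_comp => //; apply/measurable_EFinP.
    exact: (measurableT_comp mF (pair1_measurable x)).
  - apply: emeasurable_funM; [exact: (measurable_int mu i2)|exact: measurable_cst].
  - move=> y _ /=; rewrite -EFinM lee_fin !truncE.
    have N2 : ~~ (`|y : E| <= M) -> K (x, y) = 0 by rewrite -ltNge => h; exact: K2.
    have N1 : ~~ (`|x : E| <= M) -> K (x, y) = 0 by rewrite -ltNge => h; exact: K1.
    case: ifPn => [_|/N2 ->]; last by rewrite !(mulr0, normr0, mul0r).
    case: ifPn => [_|/N1 ->]; last by rewrite !(mulr0, normr0, mul0r).
    rewrite !normrM mul1r [leRHS]mulrA [leRHS]mulrC mulrA ler_wpM2l//.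
rewrite integralZl//.
by rewrite (integrable_EFin_Rintegral measurableT i1) -EFinM ltry.
Qed.

Lemma fubini_Rintegral f1 f2 (K : E * E -> R) (C M : R) :
  lint f1 -> lint f2 -> measurable_fun setT K -> (forall p, `|K p| <= C) ->
  (forall p : E * E, M < `|p.1 : E| -> K p = 0) -> (forall p : E * E, M < `|p.2 : E| -> K p = 0) ->
  \int[mu]_x (f1 x * \int[mu]_y (f2 y * K (x, y))) =
  \int[mu]_y (f2 y * \int[mu]_x (f1 x * K (x, y))) /\
  measurable_fun setT (fun x => f1 x * \int[mu]_y (f2 y * K (x, y))).
Proof.
move=> l1 l2 mK KC K1 K2.
have FI := fubini_kernel l1 l2 mK KC K1 K2.
have I2 x : mu.-integrable setT (EFin \o (fun y => f2 y * K (x, y))).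
  apply: (lint_bounded l2 (C := C) (M := M)) => //.
  - exact: (measurableT_comp mK (pair1_measurable x)).
  - by move=> z h; exact: (K2 (x, z)).
have I1 y : mu.-integrable setT (EFin \o (fun x => f1 x * K (x, y))).
  apply: (lint_bounded l1 (C := C) (M := M)) => //.
  - exact: (measurableT_comp mK (pair2_measurable y)).
  - by move=> z h; exact: (K1 (z, y)).
have E1 x : (\int[mu]_y (f1 x * f2 y * K (x, y))%:E)%E =
    (f1 x * \int[mu]_y (f2 y * K (x, y)))%:E.
  rewrite EFinM -(integrable_EFin_Rintegral measurableT (I2 x)) -integralZl//.
    by apply: eq_integral => y _; rewrite -EFinM mulrA.
  exact: I2.
have E2 y : (\int[mu]_x (f1 x * f2 y * K (x, y))%:E)%E =
    (f2 y * \int[mu]_x (f1 x * K (x, y)))%:E.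
  rewrite EFinM -(integrable_EFin_Rintegral measurableT (I1 y)) -integralZl//.
    by apply: eq_integral => w _; rewrite -EFinM mulrCA mulrA.
  exact: I1.
split.
  congr fine.
  under eq_integral do rewrite -E1.
  under [RHS]eq_integral do rewrite -E2.
  exact: (Fubini FI).
apply/measurable_EFinP; apply: eq_measurable_fun (measurable_fubini_F FI).
by move=> x _; rewrite /fubini_F /= E1.
Qed.

(** Fubini's theorem gives measurability after truncation in the first
    variable; the truncation is then removed by a pointwise limit. *)
Lemma measurable_conv f k (C M : R) : lint f -> kernel k C M ->
  measurable_fun setT (conv f k).
Proof.
move=> fl K.
apply: (@measurable_fun_cvg _ _ R setT
  (fun n x => \1_(cube n%:R) x * conv f k x)) => //.
- move=> n.
  pose KK (p : E * E) := \1_(cube n%:R) p.1 * rad k p.1 p.2.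
  have bd1 (x : E) : `|\1_(cube n%:R) x : R| <= 1.
    by rewrite indicE; case: (_ \in _); rewrite ?normr1 ?normr0.
  have [||||_] := @fubini_Rintegral (cst 1) f KK (1 * C) (n%:R + Num.sqrt M)
      (lint_cst 1) fl.
  + apply: measurable_funM; last exact: measurable_rad2 (ker_meas K).
    apply: (measurableT_comp _ measurable_fst).
    by apply: measurable_indic; exact: measurable_cube.
  + by move=> p; rewrite normrM ler_pM// (rad_bd _ _ K).
  + move=> p h; rewrite /KK indicE memNset ?mul0r//= /cube/=; apply/negP.
    by rewrite -ltNge (le_lt_trans _ h)// lerDl sqrtr_ge0.
  + move=> p h; rewrite /KK indicE; case: (boolP (_ \in _)); last by rewrite mul0r.
    rewrite inE /cube/= => h1; rewrite (rad_supp K) ?mulr0//.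
    by rewrite (le_lt_trans _ h)// lerD2r.
  apply: eq_measurable_fun => x _; rewrite mul1r /conv.
  rewrite -(@RintegralZl _ _ R mu setT _ (\1_(cube n%:R) x) measurableT (integrable_conv x fl K)).
  by apply: eq_Rintegral => y _; rewrite /KK/= mulrCA.
- move=> x _; apply: cvg_near_cst; near=> n.
  rewrite indicE mem_set ?mul1r// /cube/=.
  near: n; exact: nbhs_infty_ger.
Unshelve. all: by end_near. Qed.

End kernels.

(** * Differentiability of convolutions with Lipschitz kernels *)

Section differentiable_convolution.
Context {R : realType}.
Local Notation E := (R * R * R)%type.
Local Notation mu := (leb3 R).
Implicit Types (f : E -> R) (x y z v : E).

Lemma differentiable_criterion (V : E -> R) x (A : {linear E -> R}) :
  continuous A ->
  (forall e : R, 0 < e -> \forall v \near (0 : E), `|V (v + x) - V x - A v| <= e * `|v|) ->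
  differentiable V x.
Proof.
move=> cA H.
have S : V \o shift x = cst (V x) + A +o_ (0 : E) id.
  apply/eqaddoP => e e0; near=> v.
  rewrite (_ : (_ - _) v = V (v + x) - V x - A v); last first.
    by rewrite /= !fctE /= opprD addrA.
  by near: v; exact: H.
by apply/diff_locallyP; rewrite (diff_unique cA S).
Unshelve. all: by end_near. Qed.

Lemma leb3_set1 x : mu [set x] = 0%E.
Proof.
rewrite (_ : [set x] = ([set x.1.1] `*` [set x.1.2]) `*` [set x.2]).
  by rewrite leb3_box// !lebesgue_measure_set1 mule0.
apply/seteqP; split => [_ ->//|[[a b] c]/= [[-> ->] ->]].
by case: x => -[].
Qed.

Lemma measurable_set1_E x : measurable [set x].
Proof.
rewrite (_ : [set x] = ([set x.1.1] `*` [set x.1.2]) `*` [set x.2]).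
  by apply: measurableX => //; exact: measurableX.
apply/seteqP; split => [_ ->//|[[a b] c]/= [[-> ->] ->]].
by case: x => -[].
Qed.

Section fixed_point.
Variables (f N : E -> R) (L M : R).
Hypothesis fl : lint f.
Hypothesis mN : measurable_fun setT N.
Hypothesis L0 : 0 <= L.
Hypothesis NL : forall z z', `|N z - N z'| <= L * `|z - z'|.
Hypothesis NM : forall z, M < `|z| -> N z = 0.
Hypothesis Nd : forall z, z != 0 -> differentiable N z.
Variable C : R.
Hypothesis N_le : forall z, `|N z| <= C.
Variable x : E.

(** The kernel [N] may fail to be differentiable at the origin, that is for y = x; deleting this null point makes the pointwise limits below true
    everywhere. *)
Definition punct (y : E) : R := f y * \1_(~` [set x]) y.

Lemma punct_lint : lint punct.
Proof.
apply: (@lintM R f _ 1) => //.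
  by apply: measurable_indic; apply: measurableC; exact: measurable_set1_E.
by move=> z; rewrite indicE; case: (_ \in _); rewrite ?normr1 ?normr0.
Qed.

Lemma punct_x : punct x = 0.
Proof. by rewrite /punct indicE memNset ?mulr0//= => /(_ erefl). Qed.

Lemma measurable_shift (v : E) : measurable_fun setT (fun y : E => N (x - y + v)).
Proof.
have h := measurableT_comp mN (measurable_affine3 (x + v) (-1)).
by apply: eq_measurable_fun h => y _; rewrite /= scaleN1r addrAC.
Qed.

Definition quot (n : nat) (v y : E) : R :=
  n.+1%:R * (N (x - y + n.+1%:R^-1 *: v) - N (x - y)).

Lemma measurable_quot n v : measurable_fun setT (quot n v).
Proof.
apply: measurable_funM => //; apply: measurable_funB.
  exact: measurable_shift.
by have := measurable_shift 0; under eq_fun do rewrite addr0.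
Qed.

Lemma quot_le n v y : `|quot n v y| <= L * `|v|.
Proof.
rewrite normrM ger0_norm// -ler_pdivlMl//.
rewrite (le_trans (NL _ _))// addrC addKr normrZ ger0_norm ?invr_ge0//.
by rewrite mulrCA.
Qed.

Lemma far v w y : `|w| <= `|v| -> `|x| + M + `|v| < `|y| -> M < `|x - y + w|.
Proof.
move=> wv h; rewrite ltNge; apply/negP => hz; move: h; rewrite ltNge => /negP; apply.
rewrite (_ : y = x + w - (x - y + w)); last first.
  by rewrite opprD opprB addrACA subrr addr0 addrC subrK.
apply: le_trans (ler_normB _ _) _.
by rewrite [leRHS]addrAC lerD// (le_trans (ler_normD _ _))// lerD2l.
Qed.

Lemma quot_supp n v y : `|x| + M + `|v| < `|y| -> quot n v y = 0.
Proof.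
move=> h.
have h1 : M < `|x - y| by rewrite -[x - y]addr0; apply: far h; rewrite normr0.
have h2 : M < `|x - y + n.+1%:R^-1 *: v|.
  by apply: far h; rewrite normrZ ger0_norm ?invr_ge0// ler_piMl// invf_le1// ler1n.
by rewrite /quot !NM// subrr mulr0.
Qed.

Lemma quot_cvg v y : y != x -> quot n v y @[n --> \oo] --> 'd N (x - y) v.
Proof.
move=> yx; have z0 : x - y != 0 by rewrite subr_eq0 eq_sym.
have dN := Nd z0.
have H : (fun h : R => h^-1 *: ((N \o shift (x - y)) (h *: v) - N (x - y))) @ 0^'
    --> 'd N (x - y) v.
  have /cvg_ex[l hl] : derivable N (x - y) v by exact: diff_derivable.
  by rewrite -(deriveE v dN) /derive (cvg_lim _ hl).
have S : n.+1%:R^-1 @[n --> \oo] --> (0 : R)^'.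
  move=> A hA; have := @cvg_harmonic R _ hA; rewrite !near_simpl.
  by apply: filterS => n; apply; rewrite invr_neq0.
have := cvg_comp _ _ S H.
apply: cvg_trans; apply: near_eq_cvg; near=> n.
by rewrite /quot /= invrK [x - y + _]addrC.
Unshelve. all: by end_near. Qed.

Lemma punct_quot_cvg v y :
  punct y * quot n v y @[n --> \oo] --> punct y * 'd N (x - y) v.
Proof.
have [->|yx] := eqVneq y x; last by apply: cvgMr; exact: quot_cvg.
by rewrite punct_x; under eq_fun do rewrite mul0r; rewrite mul0r; exact: cvg_cst.
Qed.

Lemma punct_quot_le n v y :
  `|punct y * quot n v y| <= L * `|v| * `|trunc punct (`|x| + M + `|v|) y|.
Proof.
by apply: le_trunc => z; [exact: quot_le|exact: quot_supp].
Qed.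

Lemma integrable_punct_diff v :
  mu.-integrable setT (EFin \o (fun y => punct y * 'd N (x - y) v)).
Proof.
have [] // := @Rintegral_dominated_cvg R _ _ mu
  (fun n y => punct y * quot n v y) (fun y => punct y * 'd N (x - y) v)
  (fun y => L * `|v| * `|trunc punct (`|x| + M + `|v|) y|).
- move=> n; apply: measurable_funM; last exact: measurable_quot.
  by have [] := punct_lint.
- by apply: integrable_trunc_abs; exact: punct_lint.
- by move=> n y; exact: punct_quot_le.
- exact: punct_quot_cvg.
Qed.

(** The candidate for the differential of the convolution at [x]. *)
Definition convd v : R := \int[mu]_y (punct y * 'd N (x - y) v).

(** Linearity needs integrability, which follows from the dominated
    convergence of the difference quotients. *)
Lemma convd_linear : linear convd.
Proof.
move=> a v w; rewrite -[a *: convd v]/(a * convd v) /convd.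
rewrite -(@RintegralZl _ _ R mu _ _ a measurableT (integrable_punct_diff v)).
rewrite -(@RintegralD _ _ R mu)//; last 2 first.
- have := @integrableZl _ _ R mu setT measurableT a _ (integrable_punct_diff v).
  by apply: (@eq_integrable _ _ R mu).
- exact: integrable_punct_diff.
by apply: eq_Rintegral => y _; rewrite linearP/= mulrDr mulrCA.
Qed.

HB.instance Definition _ :=
  GRing.isLinear.Build R E R *:%R convd convd_linear.

Lemma punct_diff_le v y :
  `|punct y * 'd N (x - y) v| <= L * `|v| * `|trunc punct (`|x| + M + `|v|) y|.
Proof.
have h : `|punct y * quot n v y| @[n --> \oo] --> `|punct y * 'd N (x - y) v|.
  by apply: cvg_norm; exact: punct_quot_cvg.
rewrite -(cvg_lim _ h)//; apply: limr_le; first by apply/cvg_ex; eexists; exact: h.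
by apply: nearW => n; exact: punct_quot_le.
Qed.

Lemma trunc_mono (g : E -> R) (a b : R) y : a <= b -> `|trunc g a y| <= `|trunc g b y|.
Proof.
move=> ab; rewrite !truncE; case: ifPn => [h|_]; last by rewrite normr0.
by rewrite (le_trans h ab).
Qed.

Lemma convd_continuous : continuous convd.
Proof.
set C1 := L * \int[mu]_y `|trunc punct (`|x| + M + 1) y|.
have iT : mu.-integrable setT (EFin \o (fun y => `|trunc punct (`|x| + M + 1) y|)).
  exact: integrable_norm (integrable_trunc _ punct_lint).
have H v : `|v| <= 1 -> `|convd v| <= C1 * `|v|.
  move=> v1; apply: le_trans (le_normr_Rintegral _ (integrable_punct_diff v)) _ => //.
  rewrite /C1 mulrAC -RintegralZl//.
  apply: le_Rintegral => //.
  - exact: integrable_norm (integrable_punct_diff v).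
  - by apply: integrable_trunc_abs; exact: punct_lint.
  - move=> y _; apply: le_trans (punct_diff_le v y) _.
    by rewrite ler_wpM2l ?mulr_ge0// trunc_mono// lerD2l.
apply: bounded_linear_continuous; rewrite /bounded_near; near=> K.
near=> v; have v1 : `|v| <= 1 by near: v; exact: (@nbhs0_le _ E 1).
apply: le_trans (H _ v1) _; apply: (@le_trans _ _ C1).
  rewrite ler_piMr// mulr_ge0//.
  by apply: Rintegral_ge0 => y _; exact: normr_ge0.
near: K; apply: nbhs_pinfty_ge; exact: num_real.
Unshelve. all: by end_near. Qed.

Definition convN (x' : E) : R := \int[mu]_y (f y * N (x' - y)).

Lemma convN_punct v : convN (v + x) = \int[mu]_y (punct y * N (x - y + v)).
Proof.
apply: Rintegral_ae_eq.
- apply: measurable_funM; first by have [] := fl.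
  by have := measurable_shift v; under eq_fun do rewrite addrAC (addrC x).
- apply: measurable_funM; last exact: measurable_shift.
  by have [] := punct_lint.
- exists [set x]; split => //; [exact: measurable_set1_E|exact: leb3_set1|].
  move=> y /= h; apply: contrapT => yx; apply: h.
  by rewrite /punct indicE mem_set// mulr1 (addrC v x) addrAC.
Qed.

Lemma integrable_shift v :
  mu.-integrable setT (EFin \o (fun y => punct y * N (x - y + v))).
Proof.
apply: (@lint_bounded R punct _ C (`|x| + M + `|v|)).
- exact: punct_lint.
- exact: measurable_shift.
- by move=> z; exact: N_le.
- by move=> z h; apply: NM; exact: far h.
Qed.

(** If the first-order expansion failed, it would fail along a sequence [v n]
    tending to 0.  Along it the normalized remainders of the kernel converge to
    0 at every y <> x and are bounded by 2 L, so dominated convergence gives a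
    contradiction. *)
Lemma differentiable_convN : differentiable convN x.
Proof.
apply: (@differentiable_criterion _ _ convd); first exact: convd_continuous.
move=> e e0; apply: contrapT => nH.
have seqv n : exists v : E, `|v| < n.+1%:R^-1 /\
   e * `|v| < `|convN (v + x) - convN x - convd v|.
  apply: contrapT => nv; apply: nH.
  have n0 : 0 < n.+1%:R^-1 :> R by rewrite invr_gt0.
  apply: filterS (@nbhs0_lt _ E _ n0) => v vn.
  by rewrite leNgt; apply/negP => h; apply: nv; exists v.
have [v hv] := choice seqv.
have v_neq0 n : 0 < `|v n|.
  rewrite normr_gt0; apply/eqP => v0; have [_] := hv n.
  by rewrite v0 normr0 mulr0 linear0 add0r subrr subr0 normr0 ltxx.
have v_le1 n : `|v n| <= 1.
  have [/ltW h _] := hv n; apply: (le_trans h).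
  by rewrite invf_le1// ler1n.
pose F n y := punct y * (`|v n|^-1 * (N (x - y + v n) - N (x - y) - 'd N (x - y) (v n))).
pose G n y := punct y * (N (x - y + v n) - N (x - y) - 'd N (x - y) (v n)).
have i0 : mu.-integrable setT (EFin \o (fun y => punct y * N (x - y))).
  by have := integrable_shift 0; under eq_fun do rewrite addr0.
have iG n : mu.-integrable setT (EFin \o G n).
  have := integrableB measurableT (@integrableB _ _ R mu _ measurableT _ _
    (integrable_shift (v n)) i0) (integrable_punct_diff (v n)).
  apply: (@eq_integrable _ _ R mu) => // y _ /=.
  by rewrite -!EFinB /G !mulrBr.
have GE n : \int[mu]_y G n y = convN (v n + x) - convN x - convd (v n).
  rewrite convN_punct -[x in convN x]add0r convN_punct.
  under [X in _ - X - _]eq_Rintegral do rewrite addr0.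
  rewrite /convd -(@RintegralB _ _ R mu)//; last exact: integrable_shift.
  rewrite -(@RintegralB _ _ R mu)//; last 2 first.
  - have := @integrableB _ _ R mu _ measurableT _ _ (integrable_shift (v n)) i0.
    by apply: (@eq_integrable _ _ R mu).
  - exact: integrable_punct_diff.
  by apply: eq_Rintegral => y _; rewrite /G !mulrBr.
have FG n y : F n y = `|v n|^-1 * G n y by rewrite /F /G mulrCA.
have FE n : \int[mu]_y F n y = `|v n|^-1 * (convN (v n + x) - convN x - convd (v n)).
  rewrite -GE -(@RintegralZl _ _ R mu _ _ _ measurableT (iG n)).
  by apply: eq_Rintegral => y _; exact: FG.
have vc : v n @[n --> \oo] --> (0 : E).
  apply: norm_cvg0; apply: (@squeeze_cvgr _ _ _ _ (cst 0) (fun n => n.+1%:R^-1)).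
  - by apply: nearW => n; rewrite normr_ge0/=; have [/ltW] := hv n.
  - exact: cvg_cst.
  - exact: cvg_harmonic.
have Fc y : F n y @[n --> \oo] --> (0 : R).
  have [->|yx] := eqVneq y x.
    by rewrite /F punct_x; under eq_fun do rewrite mul0r; exact: cvg_cst.
  have z0 : x - y != 0 by rewrite subr_eq0 eq_sym.
  rewrite -(mulr0 (punct y)); apply: cvgMr.
  have /diff_locally/eqaddoP dN := Nd z0.
  apply/cvgr0Pnorm_le => d d0.
  have := dN d d0; move=> /vc; rewrite !near_simpl; apply: filterS => n.
  rewrite /= !fctE /= => hn.
  rewrite normrM ger0_norm ?invr_ge0// ler_pdivrMl// mulrC.
  apply: le_trans hn; rewrite [v n + _]addrC opprD addrA.
  by [].
have [||||_ Fi] := @Rintegral_dominated_cvg R _ _ mu F (cst 0)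
   (fun y => 2 * L * `|trunc punct (`|x| + M + 1) y|).
- move=> n; rewrite (_ : F n = fun y => `|v n|^-1 * G n y); last exact/funext.
  apply: measurable_funM => //; apply/measurable_EFinP.
  exact: (measurable_int mu (iG n)).
- by apply: integrable_trunc_abs; exact: punct_lint.
- move=> n y; rewrite FG normrM ger0_norm ?invr_ge0// ler_pdivrMl//.
  rewrite /G mulrBr; apply: le_trans (ler_normB _ _) _.
  have -> : `|v n| * (2 * L * `|trunc punct (`|x| + M + 1) y|) =
      L * `|v n| * `|trunc punct (`|x| + M + 1) y| +
      L * `|v n| * `|trunc punct (`|x| + M + 1) y| by ring.
  have T : L * `|v n| * `|trunc punct (`|x| + M + `|v n|) y| <=
      L * `|v n| * `|trunc punct (`|x| + M + 1) y|.
    by rewrite ler_wpM2l ?mulr_ge0// trunc_mono// lerD2l.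
  apply: lerD; last exact: le_trans (punct_diff_le _ _) T.
  apply: le_trans T; apply: (le_trunc punct
    (b := fun y => N (x - y + v n) - N (x - y))) => z.
    by apply: le_trans (NL _ _) _; rewrite addrC addKr.
  move=> h; rewrite !NM ?subrr//; last exact: far h.
  by rewrite -[x - z]addr0; apply: far h; rewrite normr0.
- exact: Fc.
have : \forall n \near \oo, `|\int[mu]_y F n y| < e.
  have : \int[mu]_y F n y @[n --> \oo] --> (0 : R).
    by move: Fi; rewrite Rintegral_cst// mul0r.
  by move=> /cvgr0_norm_lt; apply.
move=> [n _ /(_ n (leqnn n)) /=].
rewrite FE normrM ger0_norm ?invr_ge0// ltr_pdivrMl// mulrC.
by have [_ /ltW] := hv n; rewrite leNgt => /negbTE ->.
Qed.

End fixed_point.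
End differentiable_convolution.

(** * Convolutions with the parametrix and its limits *)

Section radial_kernels.
Context {R : realType}.
Local Notation E := (R * R * R)%type.
Local Notation mu := (leb3 R).
Implicit Types (f : E -> R) (k w : R -> R) (x y z c : E).

Lemma compact_support_bounded (f : R -> R) (A : R) : 0 <= A -> continuous f ->
  (forall r, A < `|r| -> f r = 0) -> exists2 L, 0 <= L & forall r, `|f r| <= L.
Proof.
move=> A0 cf f0.
have cn : {within `[- A, A], continuous (fun s => `|f s|)}.
  apply: continuous_subspaceT => s; apply: continuous_comp; first exact: cf.
  exact: norm_continuous.
have [s0 _ hs0] := EVT_max (ge0_cp A0).2 cn.
exists `|f s0| => // r; have [rA|rA] := leP `|r| A.
  by apply: hs0; rewrite in_itv/= -ler_norml.
by rewrite f0// normr0.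
Qed.

Lemma derive_lipschitz (nu nu' : R -> R) (L : R) :
  (forall r : R, is_derive r 1 nu (nu' r)) -> (forall r, `|nu' r| <= L) ->
  forall a b, `|nu a - nu b| <= L * `|a - b|.
Proof.
move=> dnu nuL.
have H a b : a <= b -> `|nu b - nu a| <= L * `|b - a|.
  move=> ab; have [|c _ ->] := @MVT_segment R nu nu' a b ab (fun r _ => dnu r).
    apply: continuous_subspaceT => r.
    by apply: differentiable_continuous; apply/derivable1_diffP; have [] := dnu r.
  by rewrite normrM ler_wpM2r.
move=> a b; have [ab|/ltW ab] := leP a b; last exact: H.
by rewrite distrC (distrC a); exact: H.
Qed.

Lemma is_derive_continuous (f f' : R -> R) :
  (forall r : R, is_derive r 1 f (f' r)) -> continuous f.
Proof.
move=> df r; apply: differentiable_continuous; apply/derivable1_diffP.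
by have [] := df r.
Qed.

(** |s - s'| (s + s') = |s^2 - s'^2| and each difference of squared coordinates
    is at most |z - z'| (s + s'). *)
Lemma sqrt_sqd_lipschitz z z' :
  `|Num.sqrt (sqd 0 z) - Num.sqrt (sqd 0 z')| <= 3 * `|z - z'|.
Proof.
set s := Num.sqrt _; set s' := Num.sqrt (sqd 0 z').
have ss0 : 0 <= s + s' by rewrite addr_ge0// sqrtr_ge0.
have cs (y : E) i : `|coord i y| <= Num.sqrt (sqd 0 y).
  rewrite -sqrtr_sqr ler_wsqrtr// /sqd (bigD1 i)//= linear0 subr0 lerDl.
  by apply: sumr_ge0 => j _; exact: sqr_ge0.
have [ss|ss] := eqVneq (s + s') 0.
  move/eqP : ss; rewrite paddr_eq0 ?sqrtr_ge0// => /andP[/eqP -> /eqP ->].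
  by rewrite subrr normr0 mulr_ge0.
have sp : 0 < s + s' by rewrite lt_neqAle eq_sym ss.
rewrite -(ler_pM2r sp) -{1}[s + s']ger0_norm// -normrM -subr_sqr.
rewrite !sqr_sqrtr ?sqd_ge0// /sqd -sumrB.
apply: le_trans (ler_norm_sum _ _ _) _.
have -> : 3 * `|z - z'| * (s + s') = \sum_(i < 3) `|z - z'| * (s + s').
  by rewrite sumr_const card_ord; ring.
apply: ler_sum => i _; rewrite linear0 !subr0 subr_sqr normrM.
apply: ler_pM => //; first by rewrite -linearB; exact: coord_le.
by apply: le_trans (ler_normD _ _) _; apply: lerD; exact: cs.
Qed.

Lemma sqd_shift x y : sqd 0 (x - y) = sqd y x.
Proof. by apply: eq_bigr => i _; rewrite linear0 subr0 linearB. Qed.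

Lemma sqd_gt0 z : z != 0 -> 0 < sqd 0 z.
Proof.
move=> z0; apply: lt_le_trans (normB_sqd 0 z).
by rewrite subr0 exprn_gt0// normr_gt0.
Qed.

(** A radial kernel nu (|z|) with nu of class C^1 and bounded support is
    Lipschitz; off the origin |z|^2 is positive, where its profile [k] is
    derivable. *)
Lemma differentiable_conv f k (nu nu' : R -> R) (M : R) :
  lint f -> continuous k -> 0 <= M -> (forall s, M < s -> k s = 0) ->
  (forall s, 0 <= s -> k s = nu (Num.sqrt s)) ->
  (forall r : R, is_derive r 1 nu (nu' r)) -> continuous nu' ->
  (forall r, M < r ^+ 2 -> nu' r = 0) ->
  (forall s : R, 0 < s -> derivable k s 1) ->
  forall x, differentiable (conv f k) x.
Proof.
move=> fl ck M0 kM knu dnu cnu' nu'M dk x.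
have [C K] := continuous_kernel ck M0 kM.
have [|L L0 nuL] := @compact_support_bounded nu' (Num.sqrt M) (sqrtr_ge0 _) cnu'.
  move=> r h; apply: nu'M; rewrite -(sqr_sqrtr M0) -(real_normK (num_real r)).
  by rewrite ltr_pXn2r// nnegrE sqrtr_ge0.
have lip z z' : `|rad k 0 z - rad k 0 z'| <= L * 3 * `|z - z'|.
  rewrite /rad !knu ?sqd_ge0//; apply: le_trans (derive_lipschitz dnu nuL _ _) _.
  by rewrite -mulrA ler_wpM2l// sqrt_sqd_lipschitz.
have -> : conv f k = convN f (rad k 0).
  apply/funext => x'; apply: eq_Rintegral => y _.
  by rewrite /rad sqd_shift sqdC.
apply: (@differentiable_convN R f (rad k 0) (L * 3) (Num.sqrt M)) => //.
- exact: measurable_rad (ker_meas K).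
- by rewrite mulr_ge0.
- by move=> z h; apply: (rad_supp K); rewrite normr0 add0r.
- move=> z z0; apply: (@differentiable_rad _ k ('D_1 k (sqd 0 z))).
  by apply: derivableP; apply: dk; exact: sqd_gt0.
- by move=> z; exact: rad_bd K.
Qed.

Lemma annular_derive w : annular w -> exists w' : R -> R,
  [/\ forall s : R, is_derive s 1 w (w' s), continuous w' &
      forall s, 2 < s -> w' s = 0].
Proof.
move=> [[w' [dw [w'' [dw' _]]]] [w1 w2]]; exists w'; split.
- by move=> s; exact: dw.
- by apply: (@is_derive_continuous _ w'') => s; exact: dw'.
- have dw0 (s : R) : is_derive s 1 w (w' s) by exact: dw.
  by have [_] := derive_cst_outside w1 w2 dw0.
Qed.

Lemma annular_continuous w : annular w -> continuous w.
Proof. by move=> /annular_derive[w' [dw _ _]]; exact: is_derive_continuous dw. Qed.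

Lemma is_derive_sqr (r : R) : is_derive r 1 (fun r : R => r ^+ 2) (2 * r).
Proof.
have H := is_deriveM (is_derive_id r (1 : R)) (is_derive_id r (1 : R)).
rewrite (_ : (fun r => _) = (id : R -> R) * id); last first.
  by apply/funext => s; rewrite fctE expr2.
by apply: is_derive_eq; rewrite /GRing.scale/= !mulr1 mulr_natl mulr2n.
Qed.

Lemma sqr_continuous : continuous (fun r : R => r ^+ 2).
Proof. exact: is_derive_continuous is_derive_sqr. Qed.

Lemma continuous_sqr_comp k : continuous k -> continuous (fun r : R => k (r ^+ 2)).
Proof.
move=> ck r.
exact: (@continuous_comp R R R (fun r => r ^+ 2) k r (@sqr_continuous r) (ck _)).
Qed.

Lemma differentiable_conv_annular f w : lint f -> annular w ->
  forall x, differentiable (conv f w) x.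
Proof.
move=> fl aw; have cw := annular_continuous aw; have [_ [_ w2]] := aw.
have [w' [dw cw' w'2]] := annular_derive aw.
apply: (@differentiable_conv f w (fun r => w (r ^+ 2))
  (fun r => w' (r ^+ 2) * (2 * r)) 2) => //.
- by move=> s s0; rewrite sqr_sqrtr.
- move=> r; apply: (@is_derive1_comp _ w (fun r : R => r ^+ 2)).
  exact: is_derive_sqr.
- move=> r; apply: cvgM.
    exact: continuous_sqr_comp.
  by apply: cvgMr; exact: cvg_id.
- by move=> r r2; rewrite w'2// mul0r.
Qed.

Lemma step_derive : exists w' : R -> R,
  [/\ forall s : R, is_derive s 1 step (w' s), continuous w' &
      forall s, 2 < s -> w' s = 0].
Proof.
have [w' [dw [w'' [dw' _]]]] := Ck1_step (setT : set R) 1.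
exists w'; split.
- by move=> s; exact: dw.
- by apply: (@is_derive_continuous _ w'') => s; exact: dw'.
- have dw0 (s : R) : is_derive s 1 step (w' s) by exact: dw.
  by have [_] := derive_cst_outside (fun s hs => step1 (ltW hs))
    (fun s hs => step0 (ltW hs)) dw0.
Qed.

Lemma step_continuous : continuous (@step R).
Proof. by have [w' [dw _ _]] := step_derive; exact: is_derive_continuous dw. Qed.

Lemma pker_continuous : continuous (@pker R).
Proof. by move=> s; apply: cvgM; [exact: sqrt_continuous|exact: step_continuous]. Qed.

Lemma pker0 (s : R) : 2 < s -> pker s = 0.
Proof. by move=> /ltW s2; rewrite /pker step0// mulr0. Qed.

(** Here nu r = r * step (r ^ 2), whence a kernel that behaves like |z| at 0. *)
Lemma differentiable_conv_pker f : lint f ->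
  forall x, differentiable (conv f pker) x.
Proof.
move=> fl; have [w' [dw cw' w'2]] := step_derive.
apply: (@differentiable_conv f pker (fun r => r * step (r ^+ 2))
  (fun r => r * (w' (r ^+ 2) * (2 * r)) + step (r ^+ 2)) 2) => //.
- exact: pker_continuous.
- exact: pker0.
- by move=> s s0; rewrite sqr_sqrtr.
- move=> r; have H : is_derive r 1 (fun r : R => step (r ^+ 2)) (w' (r ^+ 2) * (2 * r)).
    apply: (@is_derive1_comp _ step (fun r : R => r ^+ 2)); exact: is_derive_sqr.
  have H1 := is_deriveM (is_derive_id r (1 : R)) H.
  apply: is_derive_eq.
  by rewrite /GRing.scale/= mulr1.
- have cs : continuous (fun r : R => step (r ^+ 2)).
    exact: continuous_sqr_comp step_continuous.
  move=> r; apply: cvgD; last exact: cs.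
  apply: cvgM; first exact: cvg_id.
  apply: cvgM.
    exact: continuous_sqr_comp.
  by apply: cvgMr; exact: cvg_id.
- by move=> r r2; rewrite w'2// mul0r mulr0 add0r step0// ltW.
- move=> s s0; have [k' [dk _]] := @Ck1_pker R 0.
  by have [] := dk s s0.
Qed.

Lemma kernel_shift k (C M d : R) : kernel k C M -> 0 <= d ->
  kernel (fun t => k (t + d)) C M.
Proof.
move=> K d0; split.
- by apply: (measurableT_comp (ker_meas K)); exact: measurable_funD.
- exact: ker_M0 K.
- by move=> s s0; apply: (ker_bd K); rewrite addr_ge0.
- by move=> s s0; apply: (ker_supp K); rewrite (lt_le_trans s0)// lerDl.
Qed.

Lemma kernel_annular w : annular w -> exists C, kernel w C 2.
Proof.
move=> aw; apply: continuous_kernel => //; first exact: annular_continuous.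
by have [_ []] := aw.
Qed.

Lemma kernel_pker : exists C, kernel (@pker R) C 2.
Proof. by apply: continuous_kernel => //; [exact: pker_continuous|exact: pker0]. Qed.

Lemma conv_shift_cvg f k (C M : R) (d : nat -> R) x : lint f -> kernel k C M ->
  continuous k -> (forall n, 0 <= d n) -> d n @[n --> \oo] --> 0 ->
  conv f (fun t => k (t + d n)) x @[n --> \oo] --> conv f k x.
Proof.
move=> fl K ck d0 dc; apply: (conv_cvg (C := C) (M := M)) => //.
  by move=> n; exact: kernel_shift.
move=> s s0; have h : s + d n @[n --> \oo] --> s + 0.
  by apply: cvgD => //; exact: cvg_cst.
rewrite addr0 in h; exact: (cvg_comp _ _ h (ck s)).
Qed.

(** The absolute value makes the function continuous on the whole line without
    changing its values at t = |z|^2. *)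
Definition dker (d t : R) : R := d ^+ 2 * delta_ker (`|t| + d).

Lemma dker_continuous d : 0 < d -> continuous (dker d).
Proof.
move=> d0 t; apply: cvgMr.
have c0 : continuous (fun t : R => `|t| + d).
  by move=> s; apply: cvgD; [exact: norm_continuous|exact: cvg_cst].
have n0 : `|t| + d != 0 by rewrite gt_eqF// ltr_wpDl.
apply: (@continuous_comp R R R (fun t : R => `|t| + d) delta_ker); first exact: c0.
rewrite /delta_ker; apply: cvgM; last exact: step_continuous.
apply: cvgMr; apply: cvgM; first exact: sqrt_continuous.
rewrite /continuous_at; apply: (@continuous_comp R R R (fun s : R => s^-1) (fun s => s ^+ 4)).
  exact: inv_continuous.
exact: exprn_continuous.
Qed.

Lemma kernel_dker d : 0 < d -> exists C, kernel (dker d) C 2.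
Proof.
move=> d0; apply: continuous_kernel => //; first exact: dker_continuous.
move=> s s2; rewrite /dker /delta_ker step0 ?mulr0//.
by rewrite (le_trans (ltW s2))// (le_trans (ler_norm s))// lerDl ltW.
Qed.

Lemma dker_ge0 d t : 0 < d -> 0 <= dker d t.
Proof.
move=> d0; rewrite /dker /delta_ker mulr_ge0 ?sqr_ge0// mulr_ge0 ?step_ge0//.
by rewrite mulr_ge0// mulr_ge0 ?sqrtr_ge0// exprn_ge0// invr_ge0 addr_ge0// ltW.
Qed.

End radial_kernels.

(** * The regularized equation and its limit *)

Section regularization.
Context {R : realType}.
Local Notation E := (R * R * R)%type.
Local Notation mu := (leb3 R).
Implicit Types (k w : R -> R) (x y z c : E).

Lemma convD f k1 k2 (C1 C2 M1 M2 : R) x : lint f ->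
  kernel k1 C1 M1 -> kernel k2 C2 M2 ->
  conv f (fun t => k1 t + k2 t) x = conv f k1 x + conv f k2 x.
Proof.
move=> fl K1 K2; rewrite /conv -(@RintegralD _ _ R mu)//.
- by apply: eq_Rintegral => y _; rewrite /rad mulrDr.
- exact: integrable_conv K1.
- exact: integrable_conv K2.
Qed.

Lemma convZ f k (C M r : R) x : lint f -> kernel k C M ->
  conv f (fun t => r * k t) x = r * conv f k x.
Proof.
move=> fl K.
rewrite /conv -(@RintegralZl _ _ R mu setT _ r measurableT (integrable_conv x fl K)).
by apply: eq_Rintegral => y _; rewrite /rad mulrCA.
Qed.

Lemma kernelD k1 k2 (C1 C2 M : R) : kernel k1 C1 M -> kernel k2 C2 M ->
  kernel (fun t => k1 t + k2 t) (C1 + C2) M.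
Proof.
move=> K1 K2; split.
- by apply: measurable_funD; [exact: ker_meas K1|exact: ker_meas K2].
- exact: ker_M0 K1.
- move=> s s0; apply: le_trans (ler_normD _ _) _.
  by apply: lerD; [exact: (ker_bd K1 s0)|exact: (ker_bd K2 s0)].
- by move=> s s0; rewrite (ker_supp K1)// (ker_supp K2)// addr0.
Qed.

Lemma kernelZ k (C M r : R) : kernel k C M -> kernel (fun t => r * k t) (`|r| * C) M.
Proof.
move=> K; split.
- by apply: measurable_funM => //; exact: ker_meas K.
- exact: ker_M0 K.
- by move=> s s0; rewrite normrM ler_wpM2l//; exact: (ker_bd K s0).
- by move=> s s0; rewrite (ker_supp K)// mulr0.
Qed.

Definition eps (n : nat) : R := n.+1%:R^-1.

Lemma eps_gt0 n : 0 < eps n. Proof. by rewrite invr_gt0. Qed.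

Lemma eps_le1 n : eps n <= 1. Proof. by rewrite invf_le1// ler1n. Qed.

Lemma eps_cvg : eps n @[n --> \oo] --> (0 : R).
Proof. exact: cvg_harmonic. Qed.

Lemma eps2_cvg : eps n ^+ 2 @[n --> \oo] --> (0 : R).
Proof.
have : eps n * eps n @[n --> \oo] --> (0 * 0 : R) by apply: cvgM; exact: eps_cvg.
by rewrite mul0r; under eq_fun do rewrite -expr2.
Qed.

(** Testing with the parametrix centred at x expresses the average of [u]
    against the approximate Dirac mass at x by convolutions with kernels that
    stay bounded and converge as the scale tends to 0. *)
Lemma regularization (a : R) (u f : E -> R) : 0 < a -> lint u -> lint f ->
  (forall k C M c, kernel k C M -> test_function (rad k c) ->
     a ^+ 2 * (\int[mu]_x (u x * laplacian (laplacian (rad k c)) x)) =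
     \int[mu]_x (f x * rad k c x)) ->
  exists T : E -> R,
  [/\ forall x, differentiable T x,
      forall x, conv u (dker (eps n ^+ 2)) x @[n --> \oo] --> T x &
      forall N : R, exists C : R, forall n x, `|x| <= N ->
        `|conv u (dker (eps n ^+ 2)) x| <= C].
Proof.
move=> a0 ul fl sol.
have [w0 [w1 [w2 [a_0 a_1 a_2 H]]]] := @parametrix R.
have [C0 K0] := kernel_annular a_0; have [C1 K1] := kernel_annular a_1.
have [C2 K2] := kernel_annular a_2; have [Cp Kp] := @kernel_pker R.
pose d n := eps n ^+ 2.
have d0 n : 0 < d n by rewrite exprn_gt0// eps_gt0.
have d0' n : 0 <= d n by rewrite ltW.
have d1 n : d n <= 1 by rewrite exprn_ile1// ?eps_le1// ltW// eps_gt0.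
have dc : d n @[n --> \oo] --> (0 : R) by exact: eps2_cvg.
have Id n x : conv u (dker (d n)) x =
    conv u (fun t => w0 (t + d n)) x + d n * conv u (fun t => w1 (t + d n)) x
    + d n ^+ 2 * conv u (fun t => w2 (t + d n)) x
    - a ^- 2 * conv f (fun t => pker (t + d n)) x.
  have [tf lap] := H (d n) x (d0 n).
  have [Cd Kd] := kernel_dker (d0 n).
  have S0 := kernel_shift K0 (d0' n).
  have S1 := kernelZ (d n) (kernel_shift K1 (d0' n)).
  have S2 := kernelZ (d n ^+ 2) (kernel_shift K2 (d0' n)).
  have := sol _ _ _ _ (kernel_shift Kp (d0' n)) tf; rewrite lap.
  have -> : \int[mu]_y (f y * rad (fun t => pker (t + d n)) x y) =
    conv f (fun t => pker (t + d n)) x by [].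
  move=> <-; rewrite mulrA mulVf ?mul1r ?expf_neq0 ?gt_eqF//.
  have -> : \int[mu]_y (u y * rad (fun t => w0 (t + d n) + d n * w1 (t + d n) +
       d n ^+ 2 * w2 (t + d n) - d n ^+ 2 * delta_ker (t + d n)) x y) =
      conv u (fun t => (w0 (t + d n) + d n * w1 (t + d n) +
         d n ^+ 2 * w2 (t + d n)) + -1 * dker (d n) t) x.
    apply: eq_Rintegral => y _; congr (_ * _).
    by rewrite /rad /dker ger0_norm ?sqd_ge0// mulN1r.
  rewrite (convD _ ul (kernelD (kernelD S0 S1) S2) (kernelZ (-1) Kd)).
  rewrite (convD _ ul (kernelD S0 S1) S2) (convD _ ul S0 S1).
  rewrite (convZ _ _ ul Kd) (convZ _ _ ul (kernel_shift K1 (d0' n))).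
  by rewrite (convZ _ _ ul (kernel_shift K2 (d0' n))); ring.
exists (fun x => conv u w0 x - a ^- 2 * conv f pker x); split.
- move=> x; apply: differentiableB; first exact: differentiable_conv_annular.
  apply: differentiableZ; exact: differentiable_conv_pker.
- move=> x; under eq_fun do rewrite -/(d _) Id.
  have c0 := conv_shift_cvg (x := x) ul K0 (annular_continuous a_0) d0' dc.
  have c1 := conv_shift_cvg (x := x) ul K1 (annular_continuous a_1) d0' dc.
  have c2 := conv_shift_cvg (x := x) ul K2 (annular_continuous a_2) d0' dc.
  have cp := conv_shift_cvg (x := x) fl Kp (@pker_continuous R) d0' dc.
  have dc2 : d n ^+ 2 @[n --> \oo] --> (0 : R).
    have : d n * d n @[n --> \oo] --> (0 * 0 : R) by apply: cvgM.
    by rewrite mul0r; under eq_fun do rewrite -expr2.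
  have -> : conv u w0 x - a ^- 2 * conv f pker x =
     conv u w0 x + 0 * conv u w1 x + 0 * conv u w2 x - a ^- 2 * conv f pker x.
    by rewrite !mul0r !addr0.
  apply: cvgB; last by apply: cvgMr.
  apply: cvgD; last by apply: cvgM.
  by apply: cvgD => //; apply: cvgM.
- move=> N.
  pose I (g : E -> R) := \int[mu]_y `|trunc g (N + Num.sqrt 2) y|.
  exists (C0 * I u + C1 * I u + C2 * I u + a ^- 2 * (Cp * I f)) => n x xN.
  rewrite -/(d n) Id.
  have b0 := conv_bd ul (kernel_shift K0 (d0' n)) xN.
  have b1 := conv_bd ul (kernel_shift K1 (d0' n)) xN.
  have b2 := conv_bd ul (kernel_shift K2 (d0' n)) xN.
  have bp := conv_bd fl (kernel_shift Kp (d0' n)) xN.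
  apply: le_trans (ler_normB _ _) _; apply: lerD; last first.
    rewrite normrM (ger0_norm (_ : 0 <= a ^- 2)) ?invr_ge0 ?sqr_ge0//.
    by rewrite ler_wpM2l ?invr_ge0 ?sqr_ge0.
  apply: le_trans (ler_normD _ _) _; apply: lerD.
    apply: le_trans (ler_normD _ _) _; apply: lerD => //.
    rewrite normrM; apply: le_trans b1; rewrite ler_piMl//.
    by rewrite ger0_norm.
  rewrite normrM; apply: le_trans b2; rewrite ler_piMl//.
  by rewrite ger0_norm ?sqr_ge0// exprn_ile1.
Qed.

End regularization.

(** * A function with vanishing integrals over boxes *)

Section generated_product.
Context d1 d2 (T1 : measurableType d1) (T2 : measurableType d2).
Variables (G1 : set (set T1)) (G2 : set (set T2)).
Variables (g1 : (set T1)^nat) (g2 : (set T2)^nat).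
Hypotheses (mG1 : measurable = <<s G1 >>) (mG2 : measurable = <<s G2 >>).
Hypotheses (Gg1 : forall n, G1 (g1 n)) (Gg2 : forall n, G2 (g2 n)).
Hypotheses (U1 : \bigcup_n g1 n = setT) (U2 : \bigcup_n g2 n = setT).

Definition rects : set (set (T1 * T2)) := [set A `*` B | A in G1 & B in G2].

(** A preimage by a projection of a generating set is the union of its
    rectangles with the members of a countable cover. *)
Lemma measurable_rects : @measurable _ (T1 * T2)%type = <<s rects >>.
Proof.
apply/seteqP; split.
  apply: smallest_sub; first exact: smallest_sigma_algebra.
  rewrite subUset; split.
  - rewrite mG1 -g_sigma_preimageE; apply: smallest_sub.
      exact: smallest_sigma_algebra.
    move=> _ [A GA <-]; rewrite setTI.
    rewrite (_ : fst @^-1` A = \bigcup_n (A `*` g2 n)).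
      apply: sigma_algebra_bigcup => n; apply: sub_sigma_algebra.
      by exists A => //; exists (g2 n).
    rewrite -setX_bigcupr U2; apply/seteqP; split => [x /= Ax|x [] //].
    by split.
  - rewrite mG2 -g_sigma_preimageE; apply: smallest_sub.
      exact: smallest_sigma_algebra.
    move=> _ [A GA <-]; rewrite setTI.
    rewrite (_ : snd @^-1` A = \bigcup_n (g1 n `*` A)).
      apply: sigma_algebra_bigcup => n; apply: sub_sigma_algebra.
      by exists (g1 n) => //; exists A.
    rewrite -setX_bigcupl U1; apply/seteqP; split => [x /= Ax|x [] //].
    by split.
apply: smallest_sub; first exact: sigma_algebra_measurable.
move=> _ [A GA [B GB <-]]; apply: measurableX.
  by rewrite mG1; exact: sub_sigma_algebra.
by rewrite mG2; exact: sub_sigma_algebra.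
Qed.

Lemma rects_setI : setI_closed G1 -> setI_closed G2 -> setI_closed rects.
Proof.
move=> I1 I2 _ _ [A GA [B GB <-]] [A' GA' [B' GB' <-]].
rewrite -setXI; exists (A `&` A'); first exact: I1.
by exists (B `&` B') => //; exact: I2.
Qed.

End generated_product.

Section density.
Context d (T : measurableType d) (R : realType).
Variable m : {measure set T -> \bar R}.
Variable f : T -> \bar R.
Hypotheses (mf : measurable_fun setT f) (f0 : forall x, (0 <= f x)%E).

Definition density (A : set T) : \bar R := (\int[m]_(x in A) f x)%E.

Let density0 : density set0 = 0%E.
Proof. by rewrite /density integral_set0. Qed.

Let density_ge0 A : (0 <= density A)%E.
Proof. by apply: integral_ge0. Qed.

Let density_sigma : semi_sigma_additive density.
Proof. exact: semi_sigma_additive_nng_induced. Qed.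

HB.instance Definition _ := isMeasure.Build _ _ _ density
  density0 density_ge0 density_sigma.

Definition density_measure : {measure set T -> \bar R} := density.

End density.

Section boxes.
Context {R : realType}.
Local Notation E := (R * R * R)%type.
Local Notation mR := (measurableTypeR R).
Local Notation mu := (leb3 R).

Definition ocn (n : nat) : set mR := `]- n%:R, n%:R]%classic.

Lemma ocn_cover : \bigcup_n ocn n = setT.
Proof.
apply/seteqP; split => // x _; exists (Num.truncn `|x|).+1 => //.
have : `|x| < (Num.truncn `|x|).+1%:R by exact: truncnS_gt.
by rewrite ltr_norml /ocn/= in_itv/= => /andP[-> /ltW ->].
Qed.

Definition boxes : set (set (mR * mR * mR)%type) :=
  rects (rects (@ocitv R) (@ocitv R)) (@ocitv R).

Definition boxn (n : nat) : set (mR * mR * mR)%type := (ocn n `*` ocn n) `*` ocn n.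

Lemma boxn_boxes n : boxes (boxn n).
Proof.
exists (ocn n `*` ocn n); last by exists (ocn n) => //; exact: is_ocitv.
exists (ocn n); first exact: is_ocitv.
by exists (ocn n) => //; exact: is_ocitv.
Qed.

Lemma squares_cover : \bigcup_n (ocn n `*` ocn n) = setT.
Proof.
apply/seteqP; split => // z _; exists (Num.truncn `|z|).+1 => //.
have : `|z| < (Num.truncn `|z|).+1%:R by exact: truncnS_gt.
rewrite prod_normE/= gt_max !ltr_norml => /andP[/andP[h1 /ltW h2] /andP[h3 /ltW h4]].
by rewrite /ocn/= !in_itv/= h1 h2 h3 h4.
Qed.

Lemma measurable_boxes : @measurable _ (mR * mR * mR)%type = <<s boxes >>.
Proof.
have M1 : @measurable _ mR = <<s @ocitv R >> by [].
have O n : @ocitv R (ocn n) by exact: is_ocitv.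
have H := @measurable_rects _ _ mR mR _ _ ocn ocn M1 M1 O O ocn_cover ocn_cover.
apply: (@measurable_rects _ _ (mR * mR)%type mR _ _ _ ocn H M1 _ O squares_cover ocn_cover).
by move=> n; exists (ocn n) => //; exists (ocn n).
Qed.

Lemma boxes_setI : setI_closed boxes.
Proof.
apply: rects_setI; last exact: ocitvI.
by apply: rects_setI; exact: ocitvI.
Qed.

Lemma boxes_measurable B : boxes B -> @measurable _ (mR * mR * mR)%type B.
Proof. by move=> bB; rewrite measurable_boxes; exact: sub_sigma_algebra. Qed.

Lemma boxn_cover : \bigcup_n boxn n = setT.
Proof.
apply/seteqP; split => // z _; exists (Num.truncn `|z : E|).+1 => //.
have : `|z : E| < (Num.truncn `|z : E|).+1%:R by exact: truncnS_gt.
rewrite prod_normE/= prod_normE/= !gt_max !ltr_norml.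
move=> /andP[/andP[/andP[h1 /ltW h2] /andP[h3 /ltW h4]] /andP[h5 /ltW h6]].
by rewrite /boxn /ocn/= !in_itv/= h1 h2 h3 h4 h5 h6.
Qed.

Lemma boxn_cube n (z : E) : boxn n z -> `|z| <= n%:R.
Proof.
rewrite /boxn /ocn/= !in_itv/= => -[[/andP[/ltW h1 h2] /andP[/ltW h3 h4]] /andP[/ltW h5 h6]].
by rewrite prod_normE/= prod_normE/= !ge_max !ler_norml h1 h2 h3 h4 h5 h6.
Qed.

Lemma boxes_bounded (B : set E) : boxes B -> exists n : nat, B `<=` boxn n.
Proof.
move=> [_ [_ [[a1 b1] _ <-] [_ [[a2 b2] _ <-] <-]] [_ [[a3 b3] _ <-] <-]] /=.
pose m := \big[Num.max/0]_(r <- [:: `|a1|; `|b1|; `|a2|; `|b2|; `|a3|; `|b3|]) r.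
exists (Num.truncn m).+1 => -[[x y] z] /=; rewrite !in_itv/=.
have mlt : m < (Num.truncn m).+1%:R by exact: truncnS_gt.
have mr r : r \in [:: `|a1|; `|b1|; `|a2|; `|b2|; `|a3|; `|b3|] -> r < (Num.truncn m).+1%:R.
  by move=> h; apply: le_lt_trans mlt; exact: le_bigmax_seq.
move=> [[/andP[x1 x2] /andP[y1 y2]] /andP[z1 z2]].
rewrite /boxn /ocn /= !in_itv/=.
have L (a t : R) : `|a| < (Num.truncn m).+1%:R -> a < t -> - (Num.truncn m).+1%:R < t.
  by rewrite ltr_norml => /andP[h _]; exact: lt_trans.
have U (b t : R) : `|b| < (Num.truncn m).+1%:R -> t <= b -> t <= (Num.truncn m).+1%:R.
  by rewrite ltr_norml => /andP[_ /ltW h] h2; exact: le_trans h2 h.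
have M r : r \in [:: a1; b1; a2; b2; a3; b3] -> `|r| < (Num.truncn m).+1%:R.
  by move=> h; apply: mr; exact: (map_f (fun r : R => `|r|) h).
rewrite (L a1 x) ?(L a2 y) ?(L a3 z) ?(U b1 x) ?(U b2 y) ?(U b3 z)//;
  by apply: M; rewrite !inE eqxx ?orbT.
Qed.

(** On a fixed large box the positive and the negative part of [g] are densities
    of two finite measures which agree on boxes, a class stable under
    intersection that generates the Borel sets; hence these measures, and then
    their densities, agree. *)
Lemma ae0_of_boxes (g : E -> R) : lint g ->
  (forall B, boxes B -> \int[mu]_x (g x * \1_B x) = 0) ->
  {ae mu, forall x, g x = 0}.
Proof.
move=> gl gB.
(* Countably many boxes cover the space, and on each of them the two densities
   are integrable. *)
suff H n : {ae mu, forall x, boxn n x -> g x = 0}.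
  have := ae_foralln H; apply: filterS => x hx.
  have : (\bigcup_n boxn n) x by rewrite boxn_cover.
  by move=> [n _ bx]; exact: hx bx.
have [mg _] := gl.
pose gn (x : E) : R := g x * \1_(boxn n) x.
have mbn : measurable (boxn n) by apply: boxes_measurable; exact: boxn_boxes.
have gni : mu.-integrable setT (EFin \o gn).
  apply: (@lint_bounded R g (\1_(boxn n)) 1 n%:R) => //.
  - by move=> z; rewrite indicE; case: (_ \in _); rewrite ?normr1 ?normr0.
  - move=> z zn; rewrite indicE memNset// => /boxn_cube.
    by rewrite leNgt zn.
have ip := @integrable_funepos _ _ R mu _ measurableT _ gni.
have im := @integrable_funeneg _ _ R mu _ measurableT _ gni.
pose nu1 := density_measure mu (measurable_int mu ip) (fun x => funepos_ge0 _ x).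
pose nu2 := density_measure mu (measurable_int mu im) (fun x => funeneg_ge0 _ x).
have nu12 A : measurable A -> nu1 A = nu2 A.
  apply: (measure_unique boxes boxn) => //.
  - exact: measurable_boxes.
  - exact: boxes_setI.
  - exact: boxn_boxes.
  - exact: boxn_cover.
  - move=> B bB; have mB := boxes_measurable bB.
    have iB := @integrableS _ _ R mu _ _ _ measurableT mB (@subsetT _ B) gni.
    have mBn : @measurable _ (mR * mR * mR)%type (B `&` boxn n) by exact: measurableI.
    have i2 : mu.-integrable setT (EFin \o (fun x => g x * \1_(B `&` boxn n) x)).
      apply: (@lint_bounded R g (\1_(B `&` boxn n)) 1 n%:R) => //.
      - by move=> z; rewrite indicE; case: (_ \in _); rewrite ?normr1 ?normr0.
      - move=> z zn; rewrite indicE memNset// => -[_ /boxn_cube].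
        by rewrite leNgt zn.
    have : (\int[mu]_(x in B) (EFin \o gn) x = 0)%E.
      rewrite integral_mkcond -[RHS]/(0%:E) -(gB (B `&` boxn n) (boxes_setI bB (boxn_boxes n))).
      rewrite -(integrable_EFin_Rintegral measurableT i2); apply: eq_integral => x _.
      rewrite /patch /gn !indicE in_setI; case: (x \in B) => //=.
      by rewrite mulr0.
    rewrite integralE.
    have pB := @integrableS _ _ R mu _ _ _ measurableT mB (@subsetT _ B) ip.
    have nB := @integrableS _ _ R mu _ _ _ measurableT mB (@subsetT _ B) im.
    rewrite -[X in (X - _)%E](fineK (integrable_fin_num mB pB)).
    rewrite -[X in (_ - X)%E](fineK (integrable_fin_num mB nB)) -EFinB => -[/eqP].
    rewrite subr_eq0 => /eqP h.
    rewrite /nu1 /nu2 /= /density -(fineK (integrable_fin_num mB pB)) h.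
    exact: (fineK (integrable_fin_num mB nB)).
  - move=> k; have mk := boxes_measurable (boxn_boxes k).
    have pB := @integrableS _ _ R mu _ _ _ measurableT mk (@subsetT _ _) ip.
    by rewrite ltey_eq (integrable_fin_num mk pB).
have H := @integral_ae_eq _ _ R mu setT measurableT _ _ ip (measurable_int mu im)
  (fun A _ mA => nu12 A mA).
apply: filterS H => x hx bx; have := hx Logic.I.
rewrite funeposE funenegE /= -!EFin_max => -[].
have -> : gn x = g x by rewrite /gn indicE mem_set// mulr1.
by rewrite /Num.max; case: ltP => ?; case: ltP => ? ?; lra.
Qed.

End boxes.

(** * Approximation of the identity *)

Section approximate_identity.
Context {R : realType}.
Local Notation E := (R * R * R)%type.
Local Notation mR := (measurableTypeR R).
Local Notation mu := (leb3 R).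
Local Notation leb := (@lebesgue_measure R).
Implicit Types (x y z t : E).

Lemma Rintegral_affine (p : E) (r : R) (F : E -> R) : 0 < r ->
  measurable_fun setT F -> (forall x, 0 <= F x) ->
  \int[mu]_x F x = \int[mu]_t (r ^+ 3 * F (p + r *: t)).
Proof.
move=> r0 mF F0; congr fine.
have mE : measurable_fun setT (EFin \o F) by exact/measurable_EFinP.
rewrite (@ge0_integral3_affine R p r (EFin \o F) r0 mE); last first.
  by move=> x; rewrite lee_fin.
rewrite -(@ge0_integralZl_EFin _ _ R mu setT measurableT).
- by [].
- by move=> x _; rewrite lee_fin.
- apply/measurable_EFinP; apply: (measurableT_comp mF); exact: measurable_affine3.
- by rewrite exprn_ge0// ltW.
Qed.

(** The profile 15 (1 + |t|^2)^(-7/2) of the approximate Dirac masses: at scale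
    e they are e^(-3) times the profile at t = (z - y) / e, up to the cutoff. *)
Definition prof t : R := 15 * (Num.sqrt (1 + sqd 0 t) * (1 + sqd 0 t)^-1 ^+ 4).

Lemma sD_gt0 t : 0 < 1 + sqd 0 t.
Proof. by rewrite ltr_pwDl// sqd_ge0. Qed.

Lemma prof_gt0 t : 0 < prof t.
Proof.
by rewrite /prof mulr_gt0// mulr_gt0 ?sqrtr_gt0 ?sD_gt0// exprn_gt0// invr_gt0 sD_gt0.
Qed.

Lemma prof_ge0 t : 0 <= prof t. Proof. exact/ltW/prof_gt0. Qed.

Lemma sqd_affine y (e : R) t : sqd y (y + e *: t) = e ^+ 2 * sqd 0 t.
Proof.
rewrite /sqd mulr_sumr; apply: eq_bigr => i _.
by rewrite linearD linearZ/= linear0 subr0 addrC addKr exprMn.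
Qed.

Lemma dker_scale (e : R) y t : 0 < e ->
  e ^+ 3 * dker (e ^+ 2) (sqd y (y + e *: t)) =
  prof t * step (e ^+ 2 * (1 + sqd 0 t)).
Proof.
move=> e0; have en0 : e != 0 by rewrite gt_eqF.
have sn0 : 1 + sqd 0 t != 0 by rewrite gt_eqF ?sD_gt0.
rewrite /dker ger0_norm ?sqd_ge0// sqd_affine.
rewrite (_ : e ^+ 2 * sqd 0 t + e ^+ 2 = e ^+ 2 * (1 + sqd 0 t)); last by ring.
rewrite /delta_ker /prof sqrtrM ?sqr_ge0// sqrtr_sqr gtr0_norm// !exprVn.
field; by rewrite en0 sn0.
Qed.

Definition prof1 (s : R) : R := 15 * (Num.sqrt (1 + `|s|) * (1 + `|s|)^-1 ^+ 4).

Lemma prof1_continuous : continuous prof1.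
Proof.
move=> s; have c0 : continuous (fun s : R => 1 + `|s|).
  by move=> r; apply: cvgD; [exact: cvg_cst|exact: norm_continuous].
have n0 : 1 + `|s| != 0 by rewrite gt_eqF// ltr_pwDl.
apply: cvgMr; apply: cvgM.
  exact: (@continuous_comp R R R (fun s => 1 + `|s|) Num.sqrt s (c0 s) (@sqrt_continuous _ _)).
apply: (@continuous_comp R R R (fun s : R => (1 + `|s|)^-1) (fun s => s ^+ 4)).
  apply: (@continuous_comp R R R (fun s => 1 + `|s|) (fun s => s^-1) s (c0 s)).
  exact: inv_continuous.
exact: exprn_continuous.
Qed.

Lemma measurable_sqd (c : E) : measurable_fun setT (sqd c).
Proof. exact: (measurableT_comp measurable_sqd2 (pair1_measurable c)). Qed.

Lemma measurable_prof : measurable_fun setT prof.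
Proof.
have -> : prof = prof1 \o sqd 0.
  by apply/funext => t; rewrite /prof /prof1 /= ger0_norm// sqd_ge0.
apply: measurableT_comp; last exact: measurable_sqd.
by apply: continuous_measurable_fun; exact: prof1_continuous.
Qed.

Definition cauchy (x : R) : R := (oneDsqr x)^-1.

Lemma cauchy_ge0 (x : R) : 0 <= cauchy x.
Proof. by rewrite invr_ge0 (le_trans ler01)// oneDsqr_ge1. Qed.

Lemma measurable_cauchy : measurable_fun [set: R] cauchy.
Proof. by apply: continuous_measurable_fun; exact: continuous_oneDsqrV. Qed.

Lemma integral_cauchy_lty : (\int[leb]_x (cauchy x)%:E < +oo)%E.
Proof.
have mE D : measurable_fun D (fun x : R => (cauchy x)%:E).
  by apply/measurable_EFinP; apply: measurable_funTS; exact: measurable_cauchy.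
have E0 (x : R) : (0 <= (cauchy x)%:E)%E by rewrite lee_fin cauchy_ge0.
have U : [set: R] = `]-oo, 0%R] `|` `]0, +oo[.
  apply/seteqP; split => // x _.
  by have [h|h] := leP x 0; [left|right]; rewrite /= in_itv/= h.
have H1 : (\int[leb]_(x in `]0%R, +oo[) (cauchy x)%:E < +oo)%E.
  apply: (@le_lt_trans _ _ (\int[leb]_(x in `[0%R, +oo[) (cauchy x)%:E)%E).
    apply: ge0_subset_integral => //; first exact: mE.
    by move=> x /=; rewrite !in_itv/= !andbT => /ltW.
  by rewrite integral0y_oneDsqr ltry.
have H2 : (\int[leb]_(x in `]-oo, 0%R]) (cauchy x)%:E < +oo)%E.
  have := ge0_integration_by_substitution0 (mE setT) E0.
  under [X in _ = X]eq_integral do rewrite /cauchy /oneDsqr sqrrN.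
  by move=> <-; rewrite integral0y_oneDsqr ltry.
rewrite U ge0_integral_setU//; [exact: lte_add_pinfty|exact: mE|].
apply/disj_setPS => x [] /=; rewrite !in_itv/= andbT => h1 h2.
by move: (le_lt_trans h1 h2); rewrite ltxx.
Qed.

(** (1 + |t|^2)^(-3) is at most the product of the three one-dimensional
    functions 1 / (1 + t_i^2), which are integrable. *)
Lemma prof_le t : prof t <= 15 * (cauchy t.1.1 * (cauchy t.1.2 * cauchy t.2)).
Proof.
rewrite /prof ler_pM2l//.
set s := 1 + sqd 0 t.
have s1 : 1 <= s by rewrite lerDl sqd_ge0.
have s0 : 0 < s by exact: lt_le_trans s1.
have sE : s = 1 + (t.1.1 ^+ 2 + (t.1.2 ^+ 2 + t.2 ^+ 2)).
  by rewrite /s /sqd !big_ord_recl big_ord0 /coord /= !subr0 addr0.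
have h1 : Num.sqrt s <= s.
  by rewrite -{2}(sqr_sqrtr (ltW s0)) expr2 ler_peMl ?sqrtr_ge0// -{1}sqrtr1 ler_wsqrtr.
apply: (@le_trans _ _ (s^-1 ^+ 3)).
  rewrite exprS mulrA ler_piMl//; first by rewrite exprn_ge0// invr_ge0 ltW.
  by rewrite ler_pdivrMr// mul1r.
have q (x : R) : x ^+ 2 <= sqd 0 t -> s^-1 <= cauchy x.
  by move=> h; rewrite /cauchy lef_pV2 ?posrE// lerD2l.
have sq0 (x : R) : 0 <= x ^+ 2 by exact: sqr_ge0.
have sE' : sqd 0 t = t.1.1 ^+ 2 + (t.1.2 ^+ 2 + t.2 ^+ 2).
  by apply: (@addrI _ 1); rewrite -/s sE.
rewrite !exprS expr0 mulr1; have sV0 : 0 <= s^-1 by rewrite invr_ge0 ltW.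
apply: ler_pM; rewrite ?mulr_ge0//; first by apply: q; rewrite sE' lerDl addr_ge0.
apply: ler_pM => //; apply: q; rewrite sE'.
  by rewrite addrCA lerDl addr_ge0.
by rewrite addrA lerDr addr_ge0.
Qed.

Lemma integrable_prof : mu.-integrable setT (EFin \o prof).
Proof.
apply/integrableP; split; first by apply/measurable_EFinP; exact: measurable_prof.
set I := (\int[leb]_x (cauchy x)%:E)%E.
have I0 : (0 <= I)%E by apply: integral_ge0 => x _; rewrite lee_fin cauchy_ge0.
have If : I \is a fin_num by rewrite ge0_fin_numE// integral_cauchy_lty.
pose g (t : E) : \bar R := (15 * (cauchy t.1.1 * (cauchy t.1.2 * cauchy t.2)))%:E.
have mc1 : measurable_fun setT (fun t : E => cauchy t.1.1).
  apply: (measurableT_comp measurable_cauchy).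
  exact: (measurableT_comp measurable_fst measurable_fst).
have mc2 : measurable_fun setT (fun t : E => cauchy t.1.2).
  apply: (measurableT_comp measurable_cauchy).
  exact: (measurableT_comp measurable_snd measurable_fst).
have mc3 : measurable_fun setT (fun t : E => cauchy t.2).
  exact: (measurableT_comp measurable_cauchy measurable_snd).
have mg : measurable_fun setT g.
  apply/measurable_EFinP; apply: measurable_funM => //.
  by apply: measurable_funM => //; exact: measurable_funM.
have g0 t : (0 <= g t)%E by rewrite lee_fin !mulr_ge0// cauchy_ge0.
apply: (@le_lt_trans _ _ (\int[mu]_t g t)%E).
  apply: ge0_le_integral => //.
  - apply: measurableT_comp => //; apply/measurable_EFinP; exact: measurable_prof.
  - by move=> t _; rewrite /= lee_fin ger0_norm ?prof_ge0// prof_le.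
have mcE : measurable_fun setT (fun x : R => (cauchy x)%:E).
  by apply/measurable_EFinP; exact: measurable_cauchy.
have cE0 (x : R) : (0 <= (cauchy x)%:E)%E by rewrite lee_fin cauchy_ge0.
rewrite ge0_integral3E//.
have S1 (x y : R) : (\int[leb]_z g (x, y, z) = (15 * (cauchy x * cauchy y))%:E * I)%E.
  rewrite -ge0_integralZl ?lee_fin ?mulr_ge0 ?cauchy_ge0//.
  by apply: eq_integral => z _; rewrite /g/= -EFinM; congr EFin; ring.
have S2 (x : R) : (\int[leb]_y \int[leb]_z g (x, y, z) = (15 * cauchy x)%:E * (I * I))%E.
  under eq_integral do rewrite S1.
  transitivity (\int[leb]_y (((15 * cauchy x) * fine I)%:E * (cauchy y)%:E))%E.
    apply: eq_integral => y _; rewrite -(fineK If) -!EFinM; congr EFin => /=; ring.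
  rewrite ge0_integralZl ?lee_fin ?mulr_ge0 ?cauchy_ge0 ?fine_ge0//.
  by rewrite EFinM (fineK If) muleA.
under eq_integral do rewrite S2.
apply: (@le_lt_trans _ _ (\int[leb]_x ((15 * (fine I * fine I))%:E * (cauchy x)%:E))%E).
  rewrite le_eqVlt; apply/orP; left; apply/eqP.
  by apply: eq_integral => x _; rewrite -{1 2}(fineK If) -!EFinM; congr EFin; ring.
rewrite ge0_integralZl ?lee_fin ?mulr_ge0 ?fine_ge0//.
by rewrite -/I -(fineK If) -EFinM ltry.
Qed.

Lemma prof_lower t : `|t| <= 1 -> 15 * 4^-1 ^+ 4 <= prof t.
Proof.
move=> t1; rewrite /prof ler_pM2l//.
set s := 1 + sqd 0 t.
have s1 : 1 <= s by rewrite lerDl sqd_ge0.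
have s4 : s <= 4.
  have := sqd_normB 0 t; rewrite subr0 => h.
  have : `|t| ^+ 2 <= 1 by rewrite exprn_ile1.
  by rewrite /s; lra.
have s0 : 0 < s by exact: lt_le_trans s1.
rewrite -[leLHS]mul1r; apply: ler_pM => //.
  by rewrite -{1}sqrtr1 ler_wsqrtr.
by rewrite lerXn2r// ?nnegrE ?invr_ge0 ?(ltW s0)// lef_pV2// posrE.
Qed.

Definition mass : R := \int[mu]_t prof t.

Lemma mass_gt0 : 0 < mass.
Proof.
pose p0 : R := 15 * 4^-1 ^+ 4.
have p0_gt0 : 0 < p0 by rewrite mulr_gt0// exprn_gt0// invr_gt0.
have H : ((p0 * 8)%:E <= mass%:E)%E.
  rewrite /mass -(integrable_EFin_Rintegral measurableT integrable_prof).
  apply: (@le_trans _ _ (\int[mu]_(t in cube 1) p0%:E)%E).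
    rewrite integral_cst; last exact: measurable_cube.
    by rewrite [X in (_ * X)%E](leb3_cube (@ler01 R)) expr1n mulr1 EFinM.
  apply: (@le_trans _ _ (\int[mu]_(t in cube 1) (prof t)%:E)%E).
    apply: ge0_le_integral => //.
    - exact: measurable_cube.
    - by move=> t _; rewrite lee_fin ltW.
    - by apply/measurable_EFinP; apply: measurable_funTS; exact: measurable_prof.
    - by move=> t t1; rewrite lee_fin prof_lower.
  apply: ge0_subset_integral => //.
  - exact: measurable_cube.
  - by apply/measurable_EFinP; exact: measurable_prof.
  - by move=> t _; rewrite lee_fin prof_ge0.
by rewrite lee_fin in H; apply: lt_le_trans H; rewrite mulr_gt0.
Qed.

(** The average of the indicator function of [B] against the approximate Dirac
    mass at [y]; the factor 1 gives it the form of an inner integral in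
    Fubini's theorem. *)
Definition boxker (B : set E) (e : R) (y : E) : R :=
  \int[mu]_x (cst 1 x * (\1_B x * rad (dker (e ^+ 2)) y x)).

Lemma boxkerE B e y : 0 < e -> measurable B ->
  boxker B e y = \int[mu]_t (prof t * step (e ^+ 2 * (1 + sqd 0 t)) * \1_B (y + e *: t)).
Proof.
move=> e0 mB; have e2 : 0 < e ^+ 2 by rewrite exprn_gt0.
have [C K] := kernel_dker e2.
rewrite /boxker (@Rintegral_affine y e)//.
- apply: eq_Rintegral => t _.
  by rewrite /rad mul1r mulrCA mulrC dker_scale// mulrAC.
- apply: measurable_funM => //; apply: measurable_funM.
    exact: (@measurable_indic _ _ R setT B mB).
  exact: measurable_rad (ker_meas K).
- by move=> x; rewrite mul1r mulr_ge0// /rad dker_ge0.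
Qed.

Lemma boxker_int_le B (e : R) y t :
  `|prof t * step (e ^+ 2 * (1 + sqd 0 t)) * \1_B (y + e *: t)| <= prof t.
Proof.
rewrite -mulrA normrM (ger0_norm (prof_ge0 t)) ler_piMr ?prof_ge0//.
rewrite normrM mulr_ile1//; first by rewrite ger0_norm ?step_ge0 ?step_le1.
by rewrite indicE; case: (_ \in _); rewrite ?normr1 ?normr0.
Qed.

Lemma measurable_boxker_int B (e : R) y : measurable B -> measurable_fun setT
  (fun t => prof t * step (e ^+ 2 * (1 + sqd 0 t)) * \1_B (y + e *: t)).
Proof.
move=> mB; apply: measurable_funM; first apply: measurable_funM.
- exact: measurable_prof.
- apply: (measurableT_comp (f := step)).
    by apply: continuous_measurable_fun; exact: step_continuous.
  apply: measurable_funM => //; apply: measurable_funD => //; exact: measurable_sqd.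
- apply: (measurableT_comp (@measurable_indic _ _ R setT B mB)).
  exact: measurable_affine3.
Qed.

Lemma boxker_bd B e y : 0 < e -> measurable B -> `|boxker B e y| <= mass.
Proof.
move=> e0 mB; rewrite boxkerE//.
have iF := @integrable_dominated R _ _ mu _ _ (measurable_boxker_int e y mB)
  integrable_prof (boxker_int_le B e y).
apply: le_trans (le_normr_Rintegral _ iF) _ => //.
apply: le_Rintegral => //; first exact: integrable_norm iF.
  exact: integrable_prof.
by move=> t _; exact: boxker_int_le.
Qed.

(** After rescaling the integrand is dominated by the integrable profile. *)
Lemma boxker_cvg B y : boxes B ->
  (forall t, \1_B (y + eps n *: t) @[n --> \oo] --> (\1_B y : R)) ->
  boxker B (eps n) y @[n --> \oo] --> mass * \1_B y.
Proof.
move=> bB Bc; have mB := boxes_measurable bB.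
have eE n : boxker B (eps n) y = \int[mu]_t (prof t *
    step (eps n ^+ 2 * (1 + sqd 0 t)) * \1_B (y + eps n *: t)).
  by apply: boxkerE => //; exact: eps_gt0.
under eq_fun do rewrite eE.
have [||||_ L] := @Rintegral_dominated_cvg R _ _ mu (fun n t => prof t *
    step (eps n ^+ 2 * (1 + sqd 0 t)) * \1_B (y + eps n *: t))
    (fun t => prof t * 1 * \1_B y) prof.
- by move=> n; exact: measurable_boxker_int.
- exact: integrable_prof.
- by move=> n t; exact: boxker_int_le.
- move=> t; apply: cvgM; last exact: Bc.
  apply: cvgMr.
  have h : eps n ^+ 2 * (1 + sqd 0 t) @[n --> \oo] --> 0 * (1 + sqd 0 t).
    by apply: cvgMl; exact: eps2_cvg.
  rewrite mul0r in h; have := cvg_comp _ _ h (@step_continuous R 0).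
  by rewrite step1.
suff -> : mass * \1_B y = \int[mu]_t (prof t * 1 * \1_B y) by [].
rewrite /mass -(@RintegralZr _ _ R mu setT _ (\1_B y) measurableT integrable_prof).
by apply: eq_Rintegral => t _; rewrite mulr1.
Qed.

Lemma near_itv (a b y t : R) : y != a -> y != b ->
  \forall n \near \oo, (y + eps n * t \in `]a, b]%R) = (y \in `]a, b]%R).
Proof.
move=> ya yb.
have yc : y + eps n * t @[n --> \oo] --> y.
  have : y + eps n * t @[n --> \oo] --> y + 0 * t.
    by apply: cvgD; [exact: cvg_cst|apply: cvgMl; exact: eps_cvg].
  by rewrite mul0r addr0.
have Ha : \forall n \near \oo, (a < y + eps n * t) = (a < y).
  have [ay|ay|ay] := ltgtP a y; last by rewrite ay eqxx in ya.
  - exact: (cvgr_gt y yc).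
  - apply: filterS (cvgr_lt y yc _ ay) => n h.
    by apply/negbTE; rewrite -leNgt ltW.
have Hb : \forall n \near \oo, (y + eps n * t <= b) = (y <= b).
  have [ay|ay|ay] := ltgtP y b; last by rewrite ay eqxx in yb.
  - by apply: filterS (cvgr_lt y yc _ ay) => n h; rewrite ltW.
  - apply: filterS (cvgr_gt y yc _ ay) => n h.
    by apply/negbTE; rewrite -ltNge.
by apply: filterS2 Ha Hb => n ha hb; rewrite !in_itv/= ha hb.
Qed.

Lemma ae3S (P Q : E -> Prop) : (forall x, P x -> Q x) ->
  {ae mu, forall x, P x} -> {ae mu, forall x, Q x}.
Proof. exact: (@filterS _ _ (@ae_filter_ringOfSetsType _ _ R mu)). Qed.

Lemma ae3I (P Q : E -> Prop) : {ae mu, forall x, P x} -> {ae mu, forall x, Q x} ->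
  {ae mu, forall x, P x /\ Q x}.
Proof. exact: (@filterI _ _ (@ae_filter_ringOfSetsType _ _ R mu)). Qed.

Lemma ae_coord (a : R) :
  [/\ {ae mu, forall y : E, y.1.1 != a}, {ae mu, forall y : E, y.1.2 != a} &
     {ae mu, forall y : E, y.2 != a}].
Proof.
split.
- exists (([set a] `*` setT) `*` setT); split.
  + by apply: measurableX => //; apply: measurableX.
  + by rewrite leb3_box// lebesgue_measure_set1 !mul0e.
  + by move=> y /= /negP; rewrite negbK => /eqP.
- exists ((setT `*` [set a]) `*` setT); split.
  + by apply: measurableX => //; apply: measurableX.
  + by rewrite leb3_box// lebesgue_measure_set1 mule0 !mul0e.
  + by move=> y /= /negP; rewrite negbK => /eqP.
- exists ((setT `*` setT) `*` [set a]); split.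
  + by apply: measurableX => //; apply: measurableX.
  + by rewrite leb3_box// lebesgue_measure_set1 mule0.
  + by move=> y /= /negP; rewrite negbK => /eqP.
Qed.

(** The convergence can only fail on the planes that carry the faces of the
    box. *)
Lemma boxes_cont (B : set E) : boxes B ->
  {ae mu, forall y, forall t, \1_B (y + eps n *: t) @[n --> \oo] --> (\1_B y : R)}.
Proof.
move=> [_ [_ [[a1 b1] _ <-] [_ [[a2 b2] _ <-] <-]] [_ [[a3 b3] _ <-] <-]] /=.
have [A1 _ _] := ae_coord a1; have [B1 _ _] := ae_coord b1.
have [_ A2 _] := ae_coord a2; have [_ B2 _] := ae_coord b2.
have [_ _ A3] := ae_coord a3; have [_ _ B3] := ae_coord b3.
apply: ae3S (ae3I (ae3I A1 B1) (ae3I (ae3I A2 B2) (ae3I A3 B3))).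
move=> y [[ya1 yb1] [[ya2 yb2] [ya3 yb3]]] t.
apply: cvg_near_cst.
have h1 := near_itv t.1.1 ya1 yb1; have h2 := near_itv t.1.2 ya2 yb2.
have h3 := near_itv t.2 ya3 yb3.
apply: filterS3 h1 h2 h3 => n h1 h2 h3.
rewrite !indicE; congr ((nat_of_bool _)%:R).
have memE (z : E) : (z \in (`]a1, b1] `*` `]a2, b2]) `*` `]a3, b3]) =
   [&& z.1.1 \in `]a1, b1]%R, z.1.2 \in `]a2, b2]%R & z.2 \in `]a3, b3]%R].
  by apply/idP/idP => [/set_mem[[-> ->] ->]//|/and3P[? ? ?]]; apply/mem_set.
by rewrite !memE /= h1 h2 h3.
Qed.

Lemma Rintegral_dominated_cvg_ae (f_ : nat -> E -> R) (f g : E -> R) :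
  (forall n, measurable_fun setT (f_ n)) -> measurable_fun setT f ->
  mu.-integrable setT (EFin \o g) ->
  (forall n x, `|f_ n x| <= g x) ->
  {ae mu, forall x, f_ n x @[n --> \oo] --> f x} ->
  \int[mu]_x f_ n x @[n --> \oo] --> \int[mu]_x f x.
Proof.
move=> mf mF gi fg ff.
have h := @dominated_convergence _ _ R mu setT measurableT
  (fun n x => (f_ n x)%:E) (EFin \o f) (EFin \o g).
have [||||h1 h2 h3] := h _ _ _ gi _.
- by move=> n; apply/measurable_EFinP; exact: mf.
- by apply/measurable_EFinP; exact: mF.
- by apply: ae3S ff => x ffx _; apply: cvg_EFin; [exact: nearW|exact: ffx].
- by apply: aeW => x n _ /=; rewrite lee_fin.
have : (\int[mu]_x (f_ n x)%:E)%E @[n --> \oo] --> (\int[mu]_x f x)%:E.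
  by rewrite -integrable_EFin_Rintegral.
by move/fine_cvg.
Qed.

(** On a box [B], the integral of the averages of [u] converges to that of T by
    the uniform bound.  By Fubini's theorem it is also the integral of [u]
    against the averages of the indicator function of [B], which converge
    almost everywhere to a multiple of that function.  This works for [u]
    merely locally integrable, with no appeal to Lebesgue points. *)
Theorem approximate_identity (u T : E -> R) : lint u ->
  (forall x, conv u (dker (eps n ^+ 2)) x @[n --> \oo] --> T x) ->
  (forall N : R, exists C : R, forall n x, `|x| <= N ->
        `|conv u (dker (eps n ^+ 2)) x| <= C) ->
  {ae mu, forall x, T x = mass * u x}.
Proof.
move=> ul XT Xb; have [mu_ _] := ul.
have e2 n : 0 < eps n ^+ 2 :> R by rewrite exprn_gt0// eps_gt0.
pose X n := conv u (dker (eps n ^+ 2)).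
have mX n : measurable_fun setT (X n).
  by have [C K] := kernel_dker (e2 n); exact: measurable_conv K.
have mT : measurable_fun setT T.
  by apply: (@measurable_fun_cvg _ _ R setT X T) => // x _; exact: XT.
have TC (N : R) : exists2 C, 0 <= C & forall x, `|x| <= N -> `|T x| <= C.
  have [C hC] := Xb N; exists `|C| => // x xN.
  have h : `|X n x| @[n --> \oo] --> `|T x| by apply: cvg_norm; exact: XT.
  rewrite -(cvg_lim _ h)//; apply: limr_le; first by apply/cvg_ex; eexists; exact: h.
  by apply: nearW => n; apply: le_trans (hC n x xN) _; exact: ler_norm.
have lT : lint T by exact: lint_bounded_on_cubes.
have lg : lint (fun x => T x + u x * cst (- mass) x).
  apply: lintD => //; apply: (@lintM R u (cst (- mass)) `|mass|) => //.
  by move=> z /=; rewrite normrN.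
suff : {ae mu, forall x, T x + u x * cst (- mass) x = 0}.
  apply: ae3S => x /= /eqP; rewrite mulrN subr_eq0 => /eqP ->.
  by rewrite mulrC.
apply: ae0_of_boxes => // B bB.
have mB := boxes_measurable bB.
have [N BN] := boxes_bounded bB.
have Bcube z : N%:R < `|z| -> \1_B z = 0 :> R.
  move=> zN; rewrite indicE memNset// => /BN/boxn_cube; by rewrite leNgt zN.
have B1 z : `|\1_B z : R| <= 1.
  by rewrite indicE; case: (_ \in _); rewrite ?normr1 ?normr0.
have mIB : measurable_fun setT (\1_B : E -> R) by exact: (@measurable_indic _ _ R setT B mB).
(* The integral over the box of the averages converges to that of T. *)
have [C hC] := Xb N%:R.
have [||||iT L1] := @Rintegral_dominated_cvg R _ _ mu (fun n x => X n x * \1_B x)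
    (fun x => T x * \1_B x) (fun z => `|C| * `|trunc (cst 1) N%:R z|).
- by move=> n; exact: (measurable_funM (mX n) mIB).
- by apply: integrable_trunc_abs; exact: lint_cst.
- move=> n x; rewrite truncE; case: ifPn => h; last first.
    by rewrite Bcube ?mulr0 ?normr0 ?mulr0// ltNge.
  rewrite /= normr1 mulr1 normrM -[leRHS]mulr1; apply: ler_pM => //.
  exact: le_trans (hC n x h) (ler_norm _).
- by move=> x; apply: cvgMl; exact: XT.
(* The kernel is symmetric, so the averaging moves onto the indicator. *)
have Fub n : \int[mu]_x (X n x * \1_B x) = \int[mu]_y (u y * boxker B (eps n) y) /\
    measurable_fun setT (fun y => u y * boxker B (eps n) y).
  have [Ck K] := kernel_dker (e2 n).
  pose KK (p : E * E) := \1_B p.2 * rad (dker (eps n ^+ 2)) p.1 p.2.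
  have [||||h1 h2] := @fubini_Rintegral R u (cst 1) KK (1 * Ck) (N%:R + Num.sqrt 2)
      ul (lint_cst 1).
  + apply: measurable_funM; last exact: measurable_rad2 (ker_meas K).
    exact: (measurableT_comp mIB measurable_snd).
  + by move=> p; rewrite normrM ler_pM// (rad_bd _ _ K).
  + move=> p h; rewrite /KK; have [hp|hp] := leP `|p.2| N%:R; last by rewrite Bcube// mul0r.
    rewrite radC (rad_supp K) ?mulr0//.
    by rewrite (le_lt_trans _ h)// lerD2r.
  + by move=> p h; rewrite /KK Bcube ?mul0r// (le_lt_trans _ h)// lerDl sqrtr_ge0.
  split; last exact: h2.
  rewrite [RHS]h1; apply: eq_Rintegral => x _; rewrite mul1r /X /conv.
  rewrite mulrC -(@RintegralZl _ _ R mu setT _ (\1_B x) measurableT (integrable_conv x ul K)).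
  by apply: eq_Rintegral => y _; rewrite /KK/= mulrCA (radC _ x).
have L2 : \int[mu]_y (u y * boxker B (eps n) y) @[n --> \oo] -->
    \int[mu]_y (u y * (mass * \1_B y)).
  apply: (@Rintegral_dominated_cvg_ae _ _
    (fun y => mass * `|trunc u (N%:R + Num.sqrt 2) y|)).
  - by move=> n; exact: (Fub n).2.
  - exact: (measurable_funM mu_ (measurable_funM (@measurable_cst _ _ _ _ setT mass) mIB)).
  - exact: integrable_trunc_abs.
  - move=> n; apply: le_trunc => y; first by apply: boxker_bd => //; exact: eps_gt0.
    move=> yN; rewrite /boxker (_ : (fun x => _) = cst 0) ?Rintegral_cst ?mul0r//.
    have [Ck K] := kernel_dker (e2 n).
    apply/funext => x /=; have [hp|hp] := leP `|x| N%:R; last by rewrite Bcube// mul0r mulr0.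
    rewrite radC (rad_supp K) ?mulr0//.
    by rewrite (le_lt_trans _ yN)// lerD2r.
  - apply: ae3S (boxes_cont bB) => y hy; apply: cvgMr; exact: boxker_cvg.
have LL : \int[mu]_x (T x * \1_B x) = \int[mu]_y (u y * (mass * \1_B y)).
  have FE : (fun n => \int[mu]_x (X n x * \1_B x)) =
      (fun n => \int[mu]_y (u y * boxker B (eps n) y)).
    by apply/funext => n; exact: (Fub n).1.
  rewrite FE in L1; apply: (cvg_unique _ L1 L2); exact: norm_hausdorff.
have i2 : mu.-integrable setT (EFin \o (fun y => u y * (mass * \1_B y))).
  apply: (@lint_bounded R u (fun y => mass * \1_B y) `|mass| N%:R) => //.
  - exact: (measurable_funM (@measurable_cst _ _ _ _ setT mass) mIB).
  - by move=> z; rewrite normrM ler_piMr.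
  - by move=> z /Bcube ->; rewrite mulr0.
have := @RintegralB _ _ R mu setT _ _ measurableT iT i2.
rewrite LL subrr => <-; apply: eq_Rintegral => x _ /=; ring.
Qed.

End approximate_identity.

(** * Smooth functions of compact support *)

Section test_functions.
Context {R : realType}.
Local Notation E := (R * R * R)%type.
Local Notation mu := (leb3 R).
Implicit Types (f g u X P psi : E -> R) (c x y z : E).

(** A partial derivative is a pointwise limit of difference quotients. *)
Lemma measurable_partial i f : measurable_fun setT f ->
  (forall z, differentiable f z) -> measurable_fun setT (partial i f).
Proof.
move=> mf df.
apply: (@measurable_fun_cvg _ _ R setT
  (fun n z => (eps n)^-1 * (f (z + eps n *: basis3 R i) - f z))) => //.
- move=> n; apply: measurable_funM => //; apply: measurable_funB => //.
  apply: (measurableT_comp mf).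
  have h := @measurable_affine3 R (eps n *: basis3 R i) 1.
  by apply: eq_measurable_fun h => z _; rewrite scale1r addrC.
- move=> z _; have /cvg_ex[l Hl] : derivable f z (basis3 R i) by exact: diff_derivable.
  have -> : partial i f z = l by rewrite /partial /derive; exact: (cvg_lim _ Hl).
  have H : (forall n, @eps R n != 0) /\ @eps R n @[n --> \oo] --> (0 : R).
    by split; [move=> n; rewrite gt_eqF// eps_gt0|exact: eps_cvg].
  have := (cvgr_dnbhsP _ _ _).1 Hl _ H; apply: cvg_trans; apply: near_eq_cvg.
  by apply: nearW => n /=; rewrite (addrC z).
Qed.

(** Measurability with respect to the product sigma-algebra is carried along: it
    holds for radial functions and passes to partial derivatives by
    [measurable_partial]. *)
Record bump f : Prop := Bump {
  bump_Ck : forall n, Ck3 n f ;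
  bump_meas : measurable_fun setT f ;
  bump_supp : exists M : R, forall z, M < `|z| -> f z = 0 }.

Lemma bump_diff f z : bump f -> differentiable f z.
Proof. by move=> bf; exact: Ck3_diff (bump_Ck bf 0). Qed.

Lemma bump_test f : bump f -> test_function f.
Proof. by move=> [fC _ [M fM]]; exact: test_of_Ck3 fM. Qed.

Lemma bump_partial i f : bump f -> bump (partial i f).
Proof.
move=> bf; split.
- by move=> n; have [_] := bump_Ck bf n.+1; exact.
- by apply: measurable_partial; [exact: bump_meas bf|move=> z; exact: bump_diff].
- have [M fM] := bump_supp bf; exists M => z Mz.
  transitivity ('D_(basis3 R i) (cst 0 : E -> R) z); last by rewrite derive_cst.
  apply: near_eq_derive.
  have nz : `|y| @[y --> z] --> `|z| by exact: norm_continuous.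
  by apply: filterS (cvgr_gt _ nz _ Mz) => y /fM.
Qed.

Lemma bumpM X P : bump X -> bump P -> bump (X \* P).
Proof.
move=> bX bP; split.
- by move=> n; apply: Ck3M; [exact: bump_Ck bX _|exact: bump_Ck bP _].
- by apply: measurable_funM; [exact: bump_meas bX|exact: bump_meas bP].
- by have [M XM] := bump_supp bX; exists M => z /XM h; rewrite /= h mul0r.
Qed.

Lemma bumpD X P : bump X -> bump P -> bump (X \+ P).
Proof.
move=> bX bP; split.
- by move=> n; apply: Ck3D; [exact: bump_Ck bX _|exact: bump_Ck bP _].
- by apply: measurable_funD; [exact: bump_meas bX|exact: bump_meas bP].
- have [M XM] := bump_supp bX; have [N PN] := bump_supp bP.
  exists (Num.max M N) => z; rewrite gt_max => /andP[h1 h2].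
  by rewrite /= XM// PN// addr0.
Qed.

Lemma bump_sum3 (F : 'I_3 -> E -> R) : (forall i, bump (F i)) ->
  bump (fun z => \sum_(i < 3) F i z).
Proof.
move=> bF; under eq_fun do rewrite !big_ord_recl big_ord0 addr0.
exact: bumpD (bF _) (bumpD (bF _) (bF _)).
Qed.

Lemma bump_laplacian f : bump f -> bump (laplacian f).
Proof.
by move=> bf; apply: bump_sum3 => i; apply: bump_partial; apply: bump_partial.
Qed.

Lemma bump_bounded f : bump f ->
  exists C M : R, (forall z, `|f z| <= C) /\ (forall z, M < `|z| -> f z = 0).
Proof.
move=> bf; have [M fM] := bump_supp bf.
have cf : continuous f.
  by move=> z; apply: differentiable_continuous; exact: bump_diff.
have [C C0 hC] := bounded_on_cube M cf; exists C, M; split => // z.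
by have [zM|zM] := leP `|z| M; [exact: hC|rewrite fM// normr0].
Qed.

Lemma bump_int f psi : lint f -> bump psi ->
  mu.-integrable setT (EFin \o (fun z => f z * psi z)).
Proof.
move=> fl bp; have [C [M [h1 h2]]] := bump_bounded bp.
exact: lint_bounded fl (bump_meas bp) h1 h2.
Qed.

Lemma lint_bump f psi : lint f -> bump psi -> lint (fun z => f z * psi z).
Proof.
move=> fl bp; have [C [M [h1 h2]]] := bump_bounded bp.
exact: lintM fl (bump_meas bp) h1.
Qed.

Lemma pair_addr f psi1 psi2 : lint f -> bump psi1 -> bump psi2 ->
  \int[mu]_z (f z * (psi1 z + psi2 z)) =
  \int[mu]_z (f z * psi1 z) + \int[mu]_z (f z * psi2 z).
Proof.
move=> fl b1 b2.
rewrite -(@RintegralD _ _ R mu setT _ _ measurableT (bump_int fl b1) (bump_int fl b2)).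
by apply: eq_Rintegral => z _; rewrite mulrDr.
Qed.

Lemma pair_addl f g psi : lint f -> lint g -> bump psi ->
  \int[mu]_z ((f z + g z) * psi z) =
  \int[mu]_z (f z * psi z) + \int[mu]_z (g z * psi z).
Proof.
move=> fl gl b.
rewrite -(@RintegralD _ _ R mu setT _ _ measurableT (bump_int fl b) (bump_int gl b)).
by apply: eq_Rintegral => z _; rewrite mulrDl.
Qed.

Lemma pair_scale f psi (r : R) : lint f -> bump psi ->
  \int[mu]_z (r * f z * psi z) = r * \int[mu]_z (f z * psi z).
Proof.
move=> fl b.
rewrite -(@RintegralZl _ _ R mu setT _ r measurableT (bump_int fl b)).
by apply: eq_Rintegral => z _; rewrite mulrA.
Qed.

Lemma lintZ f (r : R) : lint f -> lint (fun z => r * f z).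
Proof.
move=> fl; have h := @lintM R f (cst r) `|r| fl (@measurable_cst _ _ _ _ setT r).
have := h (fun=> lexx _); congr lint.
by apply/funext => z /=; rewrite mulrC.
Qed.

Lemma pair_sumr f (F : 'I_3 -> E -> R) : lint f -> (forall i, bump (F i)) ->
  \int[mu]_z (f z * (\sum_(i < 3) F i z)) = \sum_(i < 3) \int[mu]_z (f z * F i z).
Proof.
move=> fl bF; rewrite !big_ord_recl big_ord0 addr0.
rewrite -(pair_addr fl (bF _) (bF _)) -(pair_addr fl (bF _) (bumpD (bF _) (bF _))).
by apply: eq_Rintegral => z _; rewrite !big_ord_recl big_ord0 addr0.
Qed.

Lemma lint_sum3 (F : 'I_3 -> E -> R) : (forall i, lint (F i)) ->
  lint (fun z => \sum_(i < 3) F i z).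
Proof.
move=> lF; under eq_fun do rewrite !big_ord_recl big_ord0 addr0.
exact: lintD (lF _) (lintD (lF _) (lF _)).
Qed.

Lemma pair_suml (F : 'I_3 -> E -> R) psi : (forall i, lint (F i)) -> bump psi ->
  \int[mu]_z ((\sum_(i < 3) F i z) * psi z) = \sum_(i < 3) \int[mu]_z (F i z * psi z).
Proof.
move=> lF bp; rewrite !big_ord_recl big_ord0 addr0.
rewrite -(pair_addl (lF _) (lF _) bp) -(pair_addl (lF _) (lintD (lF _) (lF _)) bp).
by apply: eq_Rintegral => z _; rewrite !big_ord_recl big_ord0 addr0.
Qed.

End test_functions.

(** * Weak product rules *)

Section product_rules.
Context {R : realType}.
Local Notation E := (R * R * R)%type.
Local Notation mu := (leb3 R).
Variables (u : E -> R) (g : 'I_3 -> E -> R) (h : E -> R).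
Hypothesis (ul : lint u) (gl : forall i, lint (g i)) (hl : lint h).
Hypothesis gu : forall i phi, test_function phi ->
  \int[mu]_x (u x * partial i phi x) = - \int[mu]_x (g i x * phi x).
Hypothesis hu : forall phi, test_function phi ->
  \int[mu]_x (u x * laplacian phi x) = \int[mu]_x (h x * phi x).

(** The weak [i]-th partial derivative of [u * X]. *)
Definition gradM (X : E -> R) i z : R := g i z * X z + u z * partial i X z.

(** The weak Laplacian of [u * X], which is
    h X + 2 (grad u . grad X) + u lap X: each summand [gradM (partial i X) i]
    already contains one copy of u times the second derivative of X, so that
    their sum, counted twice, has one copy of u lap X in excess. *)
Definition lapM (X : E -> R) z : R :=
  h z * X z + 2 * (\sum_(i < 3) gradM (partial i X) i z) + -1 * (u z * laplacian X z).

Lemma lint_gradM X i : bump X -> lint (gradM X i).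
Proof.
by move=> bX; apply: lintD; apply: lint_bump => //; exact: bump_partial.
Qed.

Lemma lint_sum_gradM X : bump X -> lint (fun z => \sum_(i < 3) gradM (partial i X) i z).
Proof.
by move=> bX; apply: lint_sum3 => i; apply: lint_gradM; exact: bump_partial.
Qed.

Lemma lint_lapM X : bump X -> lint (lapM X).
Proof.
move=> bX; apply: lintD; first apply: lintD.
- exact: lint_bump.
- by apply: lintZ; exact: lint_sum_gradM.
- by apply: lintZ; apply: lint_bump => //; exact: bump_laplacian.
Qed.

(** Leibniz' rule for X P, then the weak derivative of [u] tested with X P. *)
Lemma pair_partialM X P i : bump X -> bump P ->
  \int[mu]_x (u x * X x * partial i P x) = - \int[mu]_x (gradM X i x * P x).
Proof.
move=> bX bP; have bXi := bump_partial i bX; have bPi := bump_partial i bP.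
have XP := gu i (bump_test (bumpM bX bP)).
have E1 : \int[mu]_x (u x * partial i (X \* P) x) =
    \int[mu]_x (u x * X x * partial i P x) + \int[mu]_x (u x * partial i X x * P x).
  transitivity (\int[mu]_x (u x * ((X \* partial i P) x + (partial i X \* P) x))).
    apply: eq_Rintegral => x _.
    rewrite (partialM i (bump_diff x bX) (bump_diff x bP)) /=.
    by rewrite (mulrC (P x)).
  rewrite (pair_addr ul (bumpM bX bPi) (bumpM bXi bP)).
  by congr (_ + _); apply: eq_Rintegral => x _ /=; rewrite mulrA.
have E2 : \int[mu]_x (gradM X i x * P x) =
    \int[mu]_x (g i x * (X \* P) x) + \int[mu]_x (u x * partial i X x * P x).
  rewrite (pair_addl (lint_bump (gl i) bX) (lint_bump ul bXi) bP).
  by congr (_ + _); apply: eq_Rintegral => x _ /=; rewrite mulrA.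
by rewrite E2 -[X in - (X + _)]opprK -XP E1; ring.
Qed.

(** Leibniz' rule for the Laplacian of X P; the mixed terms are handled by
    [pair_partialM] with the derivatives of X in the place of X. *)
Lemma pair_laplacianM X P : bump X -> bump P ->
  \int[mu]_x (u x * X x * laplacian P x) = \int[mu]_x (lapM X x * P x).
Proof.
move=> bX bP.
have bXP := bumpM bX bP.
have XP := hu (bump_test bXP).
have bXi i := bump_partial i bX; have bPi i := bump_partial i bP.
have LE x : laplacian (X \* P) x =
    (X \* laplacian P) x + ((laplacian X \* P) x +
    (\sum_(i < 3) 2 * (partial i X x * partial i P x))).
  have D i : partial i (X \* P) = (X \* partial i P) \+ (P \* partial i X).
    by apply/funext => y; rewrite (partialM i (bump_diff y bX) (bump_diff y bP)).
  rewrite /laplacian /= mulr_sumr mulr_suml -!big_split/=; apply: eq_bigr => i _.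
  have d1 : differentiable (X \* partial i P) x by exact: bump_diff (bumpM bX (bPi i)).
  have d2 : differentiable (P \* partial i X) x by exact: bump_diff (bumpM bP (bXi i)).
  rewrite D partialD// (partialM i (bump_diff x bX) (bump_diff x (bPi i))).
  rewrite (partialM i (bump_diff x bP) (bump_diff x (bXi i))).
  have R4 (p q r s t w : R) : (p * q + r * s) + (t * w + s * r) =
    p * q + (w * t + 2 * (s * r)) by ring.
  exact: R4.
have bc i : bump (fun x => 2 * (partial i X x * partial i P x)).
  have b := bumpM (bXi i) (bPi i).
  have := bumpD b b; congr bump; apply/funext => x /=; ring.
have bs := bump_sum3 bc.
have E1 : \int[mu]_x (u x * laplacian (X \* P) x) =
   \int[mu]_x (u x * X x * laplacian P x) + (\int[mu]_x (u x * laplacian X x * P x) +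
   \sum_(i < 3) 2 * \int[mu]_x (u x * partial i X x * partial i P x)).
  transitivity (\int[mu]_x (u x * ((X \* laplacian P) x +
     ((laplacian X \* P) \+ (fun x => \sum_(i < 3) 2 * (partial i X x * partial i P x))) x))).
    by apply: eq_Rintegral => x _; rewrite LE.
  have b1 := bumpM bX (bump_laplacian bP); have b2 := bumpM (bump_laplacian bX) bP.
  rewrite (pair_addr ul b1 (bumpD b2 bs)) (pair_addr ul b2 bs) (pair_sumr ul bc).
  congr (_ + (_ + _)); try by apply: eq_Rintegral => x _ /=; rewrite mulrA.
  apply: eq_bigr => i _.
  have <- := @pair_scale R (fun x => u x * partial i X x) _ 2 (lint_bump ul (bXi i)) (bPi i).
  by apply: eq_Rintegral => x _ /=; ring.
have E2 : \int[mu]_x (lapM X x * P x) =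
   \int[mu]_x (h x * (X \* P) x) +
   2 * (\sum_(i < 3) \int[mu]_x (gradM (partial i X) i x * P x)) -
   \int[mu]_x (u x * laplacian X x * P x).
  have l1 := lint_bump hl bX; have l2 := lint_sum_gradM bX.
  have l3 := lint_bump ul (bump_laplacian bX).
  rewrite (pair_addl (lintD l1 (lintZ 2 l2)) (lintZ (-1) l3) bP).
  rewrite (pair_addl l1 (lintZ 2 l2) bP) !pair_scale// mulN1r.
  rewrite (pair_suml (fun i => lint_gradM i (bXi i)) bP).
  by congr (_ + _ - _); apply: eq_Rintegral => x _ /=; rewrite mulrA.
have S : \sum_(i < 3) 2 * \int[mu]_x (u x * partial i X x * partial i P x) =
    - (2 * \sum_(i < 3) \int[mu]_x (gradM (partial i X) i x * P x)).
  rewrite mulr_sumr -sumrN; apply: eq_bigr => i _.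
  by rewrite (pair_partialM i (bXi i) bP) mulrN.
have solve (p L H B T V U : R) : L = H + 2 * T - B -> V = H -> V = p + (B + U) ->
    U = - (2 * T) -> p = L by move=> -> <- -> ->; ring.
exact: solve E2 XP E1 S.
Qed.

End product_rules.

(** * The localized energy identity *)

Section energy_identity.
Context {R : realType}.
Local Notation E := (R * R * R)%type.
Local Notation mu := (leb3 R).
Implicit Types (f X P : E -> R) (x y z : E) (k : R -> R).

Lemma radE k x y : rad k x y = rad k 0 (y - x).
Proof. by rewrite /rad sqd_shift. Qed.

Lemma partial_shift i f x y : partial i (fun z => f (z - x)) y = partial i f (y - x).
Proof.
rewrite /partial /derive.
set F := (X in lim (X @ _) = _); set G := (X in _ = lim (X @ _)).
by have -> // : F = G; apply/funext => t; rewrite /F /G /= addrA.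
Qed.

Lemma partial_rad_shift i k x y :
  partial i (rad k x) y = partial i (rad k 0) (y - x).
Proof.
have -> : rad k x = (fun z => rad k 0 (z - x)) by apply/funext => z; exact: radE.
exact: partial_shift.
Qed.

Lemma laplacian_rad_shift k x y :
  laplacian (rad k x) y = laplacian (rad k 0) (y - x).
Proof.
apply: eq_bigr => i _.
have -> : partial i (rad k x) = (fun z => partial i (rad k 0) (z - x)).
  by apply/funext => z; exact: partial_rad_shift.
exact: partial_shift.
Qed.

Lemma measurable_sub : measurable_fun setT (fun p : E * E => p.2 - p.1).
Proof.
have m1 := @measurable_fst _ _ E E; have m2 := @measurable_snd _ _ E E.
apply/measurable_fun_pairP; split; first apply/measurable_fun_pairP; first split.
- apply: (@measurable_funB _ _ R setT (fun p : E * E => p.2.1.1) (fun p => p.1.1.1)).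
    by apply: (measurableT_comp measurable_fst); exact: (measurableT_comp measurable_fst).
  by apply: (measurableT_comp measurable_fst); exact: (measurableT_comp measurable_fst).
- apply: (@measurable_funB _ _ R setT (fun p : E * E => p.2.1.2) (fun p => p.1.1.2)).
    by apply: (measurableT_comp measurable_snd); exact: (measurableT_comp measurable_fst).
  by apply: (measurableT_comp measurable_snd); exact: (measurableT_comp measurable_fst).
- apply: (@measurable_funB _ _ R setT (fun p : E * E => p.2.2) (fun p => p.1.2)).
    exact: (measurableT_comp measurable_snd).
  exact: (measurableT_comp measurable_snd).
Qed.

(** Without the cutoff X the integrals in x need not converge; with it the kernel
    X(x) rho(y - x) has bounded support in both variables. *)
Lemma fubini_shift f1 f2 X (rho : E -> R) :
  lint f1 -> lint f2 -> bump X -> bump rho ->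
  \int[mu]_x (f1 x * X x * \int[mu]_y (f2 y * rho (y - x))) =
  \int[mu]_y (f2 y * \int[mu]_x (f1 x * X x * rho (y - x))) /\
  mu.-integrable setT (EFin \o (fun x => f1 x * X x * \int[mu]_y (f2 y * rho (y - x)))).
Proof.
move=> l1 l2 bX br; have lX := lint_bump l1 bX.
have [C1 [M1 [XC XM]]] := bump_bounded bX.
have [C2 [M2 [rC rM]]] := bump_bounded br.
pose K (p : E * E) := X p.1 * rho (p.2 - p.1).
have mr : measurable_fun setT (fun p : E * E => rho (p.2 - p.1)).
  by apply: measurableT_comp; [exact: bump_meas br|exact: measurable_sub].
have mK : measurable_fun setT K.
  apply: measurable_funM => //.
  by apply: (measurableT_comp _ measurable_fst); exact: bump_meas bX.
have KC p : `|K p| <= C1 * C2 by rewrite normrM ler_pM.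
have K1 (p : E * E) : `|M1| + `|M2| < `|p.1| -> K p = 0.
  move=> h; rewrite /K XM ?mul0r//; apply: le_lt_trans h.
  by rewrite (le_trans (ler_norm _))// lerDl.
have K2 (p : E * E) : `|M1| + `|M2| < `|p.2| -> K p = 0.
  move=> h; rewrite /K; have [hX|hX] := leP `|p.1| `|M1|; last first.
    by rewrite XM ?mul0r// (le_lt_trans (ler_norm _)).
  rewrite rM ?mulr0//; apply: (le_lt_trans (ler_norm _)).
  have := ler_normD (p.2 - p.1) p.1; rewrite subrK => h2; lra.
have i2 x : mu.-integrable setT (EFin \o (fun y => f2 y * rho (y - x))).
  apply: (lint_bounded l2 (C := C2) (M := M2 + `|x|)) => //.
  - exact: (measurableT_comp mr (pair1_measurable x)).
  - move=> z hz; apply: rM.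
    have := ler_normD (z - x) x; rewrite subrK => h2; lra.
have E1 x : f1 x * \int[mu]_y (f2 y * K (x, y)) =
    f1 x * X x * \int[mu]_y (f2 y * rho (y - x)).
  rewrite -mulrA -(@RintegralZl _ _ R mu setT _ (X x) measurableT (i2 x)).
  by congr (_ * _); apply: eq_Rintegral => y _; rewrite /K/= mulrCA.
have [F _] := fubini_Rintegral l1 l2 mK KC K1 K2.
split.
  under eq_Rintegral do rewrite -E1.
  rewrite F; apply: eq_Rintegral => y _; congr (_ * _).
  by apply: eq_Rintegral => x _; rewrite /K mulrA.
have FI := fubini_kernel l1 l2 mK KC K1 K2.
have I2 x : mu.-integrable setT (EFin \o (fun y => f1 x * f2 y * K (x, y))).
  have := @integrableZl _ _ R mu setT measurableT (f1 x * X x) _ (i2 x).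
  apply: (@eq_integrable _ _ R mu) => // y _; rewrite /K /= -EFinM; congr EFin; ring.
have := integrable_fubini_F FI; apply: (@eq_integrable _ _ R mu) => // x _.
rewrite /fubini_F /= (integrable_EFin_Rintegral measurableT (I2 x)); congr EFin.
rewrite -E1 -(@RintegralZl _ _ R mu setT _ (f1 x) measurableT); last first.
  have := @integrableZl _ _ R mu setT measurableT (X x) _ (i2 x).
  apply: (@eq_integrable _ _ R mu) => // y _; rewrite /K /= -EFinM; congr EFin; ring.
by apply: eq_Rintegral => y _; rewrite mulrA.
Qed.

Lemma Rintegral_sum3D (F : 'I_3 -> E -> R) (G : E -> R) (r : R) :
  (forall i, mu.-integrable setT (EFin \o F i)) -> mu.-integrable setT (EFin \o G) ->
  \int[mu]_x (\sum_(i < 3) F i x + r * G x) =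
  \sum_(i < 3) \int[mu]_x F i x + r * \int[mu]_x G x.
Proof.
move=> Fi Gi; have iL := @integrableZl _ _ R mu setT measurableT r _ Gi.
have iD := fun i j => @integrableD _ _ R mu setT measurableT _ _ (Fi i) (Fi j).
have i3 := @integrableD _ _ R mu setT measurableT _ _ (Fi ord0)
  (iD (lift ord0 ord0) (lift ord0 (lift ord0 ord0))).
rewrite -(@RintegralZl _ _ R mu setT _ r measurableT Gi).
rewrite !big_ord_recl big_ord0 addr0.
rewrite -(@RintegralD _ _ R mu setT _ _ measurableT (Fi _) (Fi _)).
rewrite -(@RintegralD _ _ R mu setT _ _ measurableT (Fi _) (iD _ _)).
rewrite -(@RintegralD _ _ R mu setT _ _ measurableT i3 iL).
by apply: eq_Rintegral => x _; rewrite !big_ord_recl big_ord0 addr0.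
Qed.

Section identity.
Variables (a : R) (u v h : E -> R) (g : 'I_3 -> E -> R).
Hypothesis (ul : lint u) (vl : lint v) (gl : forall i, lint (g i)) (hl : lint h).
Hypothesis gu : forall i phi, test_function phi ->
  \int[mu]_x (u x * partial i phi x) = - \int[mu]_x (g i x * phi x).
Hypothesis hu : forall phi, test_function phi ->
  \int[mu]_x (u x * laplacian phi x) = \int[mu]_x (h x * phi x).
Hypothesis uv : forall phi, test_function phi ->
  - (\int[mu]_x (u x * laplacian phi x))
    + a ^+ 2 * (\int[mu]_x (u x * laplacian (laplacian phi) x))
  = (\int[mu]_x (v x * phi x)).

Lemma weak_form P : bump P -> \int[mu]_x (v x * P x) =
  \sum_(i < 3) \int[mu]_x (g i x * partial i P x) +
  a ^+ 2 * \int[mu]_x (h x * laplacian P x).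
Proof.
move=> bP; have bPi i := bump_partial i bP.
have S : \int[mu]_x (u x * laplacian P x) = \sum_(i < 3) \int[mu]_x (u x * partial i (partial i P) x).
  by apply: (pair_sumr ul) => i; exact: bump_partial.
have SN : - (\int[mu]_x (u x * laplacian P x)) = \sum_(i < 3) \int[mu]_x (g i x * partial i P x).
  rewrite S -sumrN; apply: eq_bigr => i _.
  by have := gu i (bump_test (bPi i)) => ->; rewrite opprK.
have SH := hu (bump_test (bump_laplacian bP)).
exact: (etrans (esym (uv (bump_test bP))) (f_equal2 +%R SN (f_equal ( *%R (a ^+ 2)) SH))).
Qed.

(** For each x, the equation is tested with [rad k x], multiplied by u(x) X(x),
    and integrated.  Exchanging the integrals, the kernel derivatives in y turn
    into derivatives in x, up to the parity of the derivative of a radial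
    function, and the weak product rules move them onto u X. *)
Lemma energy_identity k (k' k'' : R -> R) X : bump X -> (forall c, bump (rad k c)) ->
  (forall s : R, is_derive s 1 k (k' s)) -> (forall s : R, is_derive s 1 k' (k'' s)) ->
  \int[mu]_y (v y * conv (fun x => u x * X x) k y) =
  \sum_(i < 3) \int[mu]_y (g i y * conv (gradM u g X i) k y) +
  a ^+ 2 * \int[mu]_y (h y * conv (lapM u g h X) k y).
Proof.
move=> bX bk dk dk'.
have bki i : bump (partial i (rad k 0)) by exact: bump_partial.
have bkL : bump (laplacian (rad k 0)) by exact: bump_laplacian.
have [F0 _] := fubini_shift ul vl bX (bk 0).
have Fi i := fubini_shift ul (gl i) bX (bki i).
have [FL1 FL2] := fubini_shift ul hl bX bkL.
have odd i x y : partial i (rad k 0) (y - x) = - partial i (rad k y) x.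
  rewrite (partial_rad i (dk _)) (partial_rad i (dk _)) linear0 linearB/=.
  by rewrite !sqd_shift sqdC; ring.
have even x y : laplacian (rad k 0) (y - x) = laplacian (rad k y) x.
  rewrite -laplacian_rad_shift !(laplacian_rad _ (fun s _ => dk s) (fun s _ => dk' s)).
  by rewrite radC.
have Wx x : \int[mu]_y (v y * rad k 0 (y - x)) =
    \sum_(i < 3) \int[mu]_y (g i y * partial i (rad k 0) (y - x)) +
    a ^+ 2 * \int[mu]_y (h y * laplacian (rad k 0) (y - x)).
  have S0 : \int[mu]_y (v y * rad k 0 (y - x)) = \int[mu]_y (v y * rad k x y).
    by apply: eq_Rintegral => y _; exact: (f_equal ( *%R (v y)) (esym (radE k x y))).
  have Si i : \int[mu]_y (g i y * partial i (rad k x) y) =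
      \int[mu]_y (g i y * partial i (rad k 0) (y - x)).
    apply: eq_Rintegral => y _.
    exact: (f_equal ( *%R (g i y)) (partial_rad_shift i k x y)).
  have SL : \int[mu]_y (h y * laplacian (rad k x) y) =
      \int[mu]_y (h y * laplacian (rad k 0) (y - x)).
    apply: eq_Rintegral => y _.
    exact: (f_equal ( *%R (h y)) (laplacian_rad_shift k x y)).
  exact: (etrans (etrans S0 (weak_form (bk x)))
    (f_equal2 +%R (eq_bigr _ (fun i _ => Si i)) (f_equal ( *%R (a ^+ 2)) SL))).
have conv0 y : conv (fun x => u x * X x) k y = \int[mu]_x (u x * X x * rad k 0 (y - x)).
  by apply: eq_Rintegral => x _; rewrite -radE radC.
have convi i y : conv (gradM u g X i) k y =
    \int[mu]_x (u x * X x * partial i (rad k 0) (y - x)).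
  rewrite /conv -[LHS]opprK -(pair_partialM ul gl gu i bX (bk y)).
  have b := bump_int (lint_bump ul bX) (bump_partial i (bk y)).
  rewrite -mulN1r -(@RintegralZl _ _ R mu setT _ (-1) measurableT b).
  by apply: eq_Rintegral => x _; rewrite odd mulN1r mulrN.
have convL y : conv (lapM u g h X) k y =
    \int[mu]_x (u x * X x * laplacian (rad k 0) (y - x)).
  rewrite /conv -(pair_laplacianM ul gl hl gu hu bX (bk y)).
  by apply: eq_Rintegral => x _; rewrite even.
under eq_Rintegral do rewrite conv0.
rewrite -F0.
under [in RHS]eq_Rintegral do rewrite convL.
under [in RHS]eq_bigr do under eq_Rintegral do rewrite convi.
under [in RHS]eq_bigr do rewrite -(Fi _).1.
rewrite -FL1.
transitivity (\int[mu]_x (\sum_(i < 3)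
     (u x * X x * \int[mu]_y (g i y * partial i (rad k 0) (y - x))) +
   a ^+ 2 * (u x * X x * \int[mu]_y (h y * laplacian (rad k 0) (y - x))))).
  apply: eq_Rintegral => x _.
  by rewrite Wx [LHS]mulrDr mulr_sumr; congr (_ + _); rewrite mulrCA.
exact: (Rintegral_sum3D (a ^+ 2) (fun i => (Fi i).2) FL2).
Qed.

End identity.
End energy_identity.

(** * Bounds for pairings with a mollification *)

Section young.
Context {R : realType}.
Local Notation E := (R * R * R)%type.
Local Notation mu := (leb3 R).
Implicit Types (x y z : E).

Lemma integrable_lint (f : E -> R) : mu.-integrable setT (EFin \o f) -> lint f.
Proof.
move=> fi; split; first by apply/measurable_EFinP; exact: (measurable_int mu fi).
move=> M; apply: (@integrableS _ _ R mu setT) => //; exact: measurable_cube.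
Qed.

Variables (k : R -> R) (C M c : R).
Hypothesis (K : kernel k C M) (k0 : forall s, 0 <= k s).
Hypothesis kc : forall x, \int[mu]_y rad k x y = c.

Lemma integrable_rad x : mu.-integrable setT (EFin \o rad k x).
Proof.
have := integrable_conv x (lint_cst 1) K; apply: (@eq_integrable _ _ R mu) => //.
by move=> y _; rewrite /= mul1r.
Qed.

(** Tonelli's theorem and the symmetry of the kernel. *)
Lemma conv_mass (G : E -> R) : mu.-integrable setT (EFin \o G) -> (forall x, 0 <= G x) ->
  mu.-integrable setT (EFin \o conv G k) /\
  \int[mu]_y conv G k y = c * \int[mu]_x G x.
Proof.
move=> Gi G0; have lG := integrable_lint Gi; have [mG _] := lG.
have mc := measurable_conv lG K.
have c0 y : 0 <= conv G k y.
  by apply: Rintegral_ge0 => x _; rewrite mulr_ge0 ?k0//; exact: k0.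
pose F (p : E * E) := (G p.2 * rad k p.1 p.2)%:E.
have mF : measurable_fun setT F.
  apply/measurable_EFinP; apply: measurable_funM.
    exact: (measurableT_comp mG measurable_snd).
  exact: measurable_rad2 (ker_meas K).
have F0 p : (0 <= F p)%E by rewrite lee_fin mulr_ge0//; exact: k0.
have T := @fubini_tonelli _ _ _ _ R mu mu F mF F0.
have T1 : (\int[mu]_y (conv G k y)%:E = (c * \int[mu]_x G x)%:E)%E.
  transitivity (\int[mu]_y \int[mu]_x F (y, x))%E.
    apply: eq_integral => y _.
    by rewrite /F /= (integrable_EFin_Rintegral measurableT (integrable_conv y lG K)).
  rewrite T.
  rewrite EFinM -(integrable_EFin_Rintegral measurableT Gi).
  rewrite -(@integralZl _ _ R mu setT measurableT _ Gi c).
  apply: eq_integral => x _; rewrite /F /=.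
  have ix := integrable_conv x (lint_cst (G x)) K.
  transitivity (\int[mu]_y (cst (G x) y * rad k x y)%:E)%E.
    by apply: eq_integral => y _; rewrite radC.
  rewrite (integrable_EFin_Rintegral measurableT ix) -EFinM; congr EFin.
  by rewrite (@RintegralZl _ _ R mu setT _ (G x) measurableT (integrable_rad x)) kc mulrC.
have ci : mu.-integrable setT (EFin \o conv G k).
  apply/integrableP; split; first exact/measurable_EFinP.
  under eq_integral do rewrite /= (ger0_norm (c0 _)).
  by rewrite T1 ltry.
split; first exact: ci.
apply: EFin_inj.
exact: (etrans (esym (integrable_EFin_Rintegral measurableT ci)) T1).
Qed.

(** |A(y) B(x)| <= A(y)^2 + B(x)^2, integrated against a kernel whose partial
    integrals are all equal to [c]. *)
Lemma young_pairing (A B GA GB : E -> R) : lint A -> lint B ->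
  mu.-integrable setT (EFin \o GA) -> mu.-integrable setT (EFin \o GB) ->
  (forall x, A x ^+ 2 <= GA x) -> (forall x, B x ^+ 2 <= GB x) ->
  `|\int[mu]_y (A y * conv B k y)| <= c * (\int[mu]_x GA x + \int[mu]_x GB x).
Proof.
move=> lA lB iA iB AG BG.
have GA0 x : 0 <= GA x := le_trans (sqr_ge0 _) (AG x).
have GB0 x : 0 <= GB x := le_trans (sqr_ge0 _) (BG x).
have [iC cC] := conv_mass iB GB0.
have lGB := integrable_lint iB.
have icA := @integrableZl _ _ R mu setT measurableT c _ iA.
have P y : `|A y * conv B k y| <= c * GA y + conv GB k y.
  have iB' := integrable_conv y lB K.
  have iG := integrable_conv y lGB K.
  have iR := @integrableZl _ _ R mu setT measurableT (GA y) _ (integrable_rad y).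
  pose N x := `|B x * rad k y x|.
  have iN0 : mu.-integrable setT (EFin \o N) := integrable_norm iB'.
  have iN := @integrableZl _ _ R mu setT measurableT `|A y| _ iN0.
  rewrite normrM; apply: (@le_trans _ _ (`|A y| * \int[mu]_x N x)).
    by rewrite ler_wpM2l//; exact: (le_normr_Rintegral measurableT iB').
  rewrite (mulrC c) -(kc y) -(@RintegralZl _ _ R mu setT _ `|A y| measurableT iN0).
  rewrite -(@RintegralZl _ _ R mu setT _ (GA y) measurableT (integrable_rad y)).
  rewrite -(@RintegralD _ _ R mu setT _ _ measurableT iR iG).
  have iS := @integrableD _ _ R mu setT measurableT _ _ iR iG.
  apply: (@le_Rintegral _ _ R mu setT _ _ measurableT iN iS) => x _.
  rewrite /N /= -mulrDl normrM (ger0_norm (k0 _)) mulrA ler_wpM2r//.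
  have := AG y; have := BG x; rewrite -(real_normK (num_real (A y))).
  rewrite -(real_normK (num_real (B x))); have := sqr_ge0 (`|A y| - `|B x|).
  have := normr_ge0 (A y); have := normr_ge0 (B x); nra.
have iAB : mu.-integrable setT (EFin \o (fun y => A y * conv B k y)).
  have iS := @integrableD _ _ R mu setT measurableT _ _ icA iC.
  apply: (@integrable_dominated R _ _ mu _ (fun y => c * GA y + conv GB k y)) => //.
  by apply: measurable_funM; [have [] := lA|exact: measurable_conv lB K].
apply: (le_trans (le_normr_Rintegral measurableT iAB)).
rewrite mulrDr -cC -(@RintegralZl _ _ R mu setT _ c measurableT iA).
rewrite -(@RintegralD _ _ R mu setT _ _ measurableT icA iC).
have iS := @integrableD _ _ R mu setT measurableT _ _ icA iC.
by apply: (@le_Rintegral _ _ R mu setT _ _ measurableT (integrable_norm iAB) iS) => y _; exact: P.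
Qed.

End young.

(** * Rescaled cutoffs and mollifiers *)

Section scales.
Context {R : realType}.
Local Notation E := (R * R * R)%type.
Local Notation mu := (leb3 R).
Implicit Types (x y z : E).

Lemma step_derive2 : exists (w1 w2 : R -> R) (C : R),
  [/\ forall s : R, is_derive s 1 step (w1 s),
      forall s : R, is_derive s 1 w1 (w2 s), 0 <= C,
      forall s, `|w1 s| <= C /\ `|w2 s| <= C &
      forall s, 2 < s -> w1 s = 0 /\ w2 s = 0].
Proof.
have [w1 [d1 [w2 [d2 [w3 [d3 _]]]]]] := Ck1_step (setT : set R) 2.
have {}d1 (s : R) : is_derive s 1 step (w1 s) by exact: d1.
have {}d2 (s : R) : is_derive s 1 w1 (w2 s) by exact: d2.
have {}d3 (s : R) : is_derive s 1 w2 (w3 s) by exact: d3.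
have [z1 z1'] := derive_cst_outside (fun s hs => step1 (ltW hs))
  (fun s hs => step0 (ltW hs)) d1.
have [z2 z2'] := derive_cst_outside z1 z1' d2.
have out (f : R -> R) : (forall s, s < 1 -> f s = 0) -> (forall s, 2 < s -> f s = 0) ->
    forall s, 2 < `|s| -> f s = 0.
  move=> f1 f2 s; case: (ltrP s 0) => s0; last by rewrite ger0_norm//; exact: f2.
  by move=> _; apply: f1; apply: lt_trans s0 _.
have [C1 C10 B1] := compact_support_bounded (@ler0n R 2) (is_derive_continuous d2) (out _ z1 z1').
have [C2 C20 B2] := compact_support_bounded (@ler0n R 2) (is_derive_continuous d3) (out _ z2 z2').
exists w1, w2, (C1 + C2); split => //.
- exact: addr_ge0.
- move=> s; split; first by apply: (le_trans (B1 s)); rewrite lerDl.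
  by apply: (le_trans (B2 s)); rewrite lerDr.
- by move=> s hs; split; [exact: z1'|exact: z2'].
Qed.

Definition scaled (r t s : R) : R := r * step (t * s).

Lemma bump_scaled (r t : R) c : 0 < t -> bump (rad (scaled r t) c).
Proof.
move=> t0; have ms : measurable_fun setT (scaled r t).
  apply: measurable_funM => //; apply: (measurableT_comp (f := @step R)).
    by apply: continuous_measurable_fun; exact: step_continuous.
  exact: measurable_funM.
split.
- move=> n; apply: Ck3_rad; apply: Ck1Z.
  apply: (@Ck1_comp _ _ setT _ (@step R) (fun s => t * s)) => //.
    exact: Ck1_step.
  by apply: Ck1Z; exact: Ck1_id.
- exact: measurable_rad.
- exists (`|c| + Num.sqrt (2 / t)); apply: rad_eq0; first by rewrite divr_ge0// ltW.
  move=> s; rewrite ltr_pdivrMr// mulrC => h.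
  by rewrite /scaled step0 ?mulr0// ltW.
Qed.

Lemma kernel_scaled (r t : R) : 0 <= r -> 0 < t -> kernel (scaled r t) r (2 / t).
Proof.
move=> r0 t0; split.
- apply: measurable_funM => //; apply: (measurableT_comp (f := @step R)).
    by apply: continuous_measurable_fun; exact: step_continuous.
  exact: measurable_funM.
- by rewrite divr_ge0// ltW.
- move=> s _; rewrite /scaled normrM (ger0_norm r0) ger0_norm ?step_ge0//.
  by rewrite ler_piMr// step_le1.
- move=> s; rewrite ltr_pdivrMr// mulrC => h.
  by rewrite /scaled step0 ?mulr0// ltW.
Qed.

(** e^(-3) step (s / e^2): by [mol_scale] a mollifier of mass [bump_mass]. *)
Definition mol (e : R) := scaled (e^-1 ^+ 3) (e^-1 ^+ 2).

Definition bump_mass : R := \int[mu]_t step (sqd 0 t).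

Lemma mol_scale (e : R) y t : 0 < e ->
  e ^+ 3 * rad (mol e) y (y + e *: t) = step (sqd 0 t).
Proof.
move=> e0; rewrite /rad sqd_affine /mol /scaled mulrA -exprMn mulfV ?gt_eqF//.
by rewrite expr1n mul1r mulrA -exprMn mulVf ?gt_eqF// expr1n mul1r.
Qed.

Lemma mol_ge0 (e s : R) : 0 < e -> 0 <= mol e s.
Proof. by move=> e0; rewrite mulr_ge0 ?step_ge0// exprn_ge0// invr_ge0 ltW. Qed.

Lemma mol_mass (e : R) y : 0 < e -> \int[mu]_x rad (mol e) y x = bump_mass.
Proof.
move=> e0; rewrite (Rintegral_affine y e0).
- by apply: eq_Rintegral => t _; exact: mol_scale.
- by apply: bump_meas; apply: bump_scaled; rewrite exprn_gt0// invr_gt0.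
- by move=> x; exact: mol_ge0.
Qed.

(** The cutoff is 1 on the cube of side 1 centred at 0, where |t|^2 <= 3/4. *)
Lemma bump_mass_ge1 : 1 <= bump_mass.
Proof.
have half0 : 0 <= 2^-1 :> R by rewrite invr_ge0.
have K := @kernel_scaled 1 1 ler01 ltr01.
have i1 := integrable_rad K 0.
have [i2 I2] := @integral_cube R 2^-1 half0.
have -> : bump_mass = \int[mu]_t rad (scaled 1 1) 0 t.
  by apply: eq_Rintegral => t _; rewrite /rad /scaled !mul1r.
have E1 : (1 : R) = \int[mu]_t \1_(cube (2^-1 : R)) t by rewrite I2; field.
rewrite [leLHS]E1; apply: (@le_Rintegral _ _ R mu setT _ _ measurableT i2 i1) => z _.
rewrite indicE; case: (boolP (_ \in _)) => [/set_mem h|_]; last first.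
  by rewrite /= mulr_ge0// step_ge0.
rewrite /rad /scaled !mul1r step1//; apply: (le_trans (sqd_normB 0 z)).
rewrite subr0; have := normr_ge0 z; move: h; rewrite /cube /= => h h0; nra.
Qed.

End scales.

(** * The energy bound, uniformly in the scale *)

Section uniform_bound.
Context {R : realType}.
Local Notation E := (R * R * R)%type.
Local Notation mu := (leb3 R).
Implicit Types (x y z : E).

Definition cutoff (e : R) : E -> R := rad (scaled 1 (e ^+ 2)) 0.

Lemma bump_cutoff (e : R) : 0 < e -> bump (cutoff e).
Proof. by move=> e0; apply: bump_scaled; rewrite exprn_gt0. Qed.

Lemma cutoff_ge0 (e : R) z : 0 <= cutoff e z.
Proof. by rewrite mulr_ge0// step_ge0. Qed.

Lemma cutoff_le1 (e : R) z : cutoff e z <= 1.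
Proof. by rewrite /cutoff /rad /scaled mul1r step_le1. Qed.

Lemma is_derive_scale (f f' : R -> R) (t s : R) : (forall s : R, is_derive s 1 f (f' s)) ->
  is_derive s 1 (fun s => f (t * s)) (t * f' (t * s)).
Proof.
move=> df; have ds : is_derive s 1 (fun s : R => t * s) t.
  have := is_deriveZ t (is_derive_id s (1 : R)).
  by rewrite /GRing.scale/= mulr1.
have := @is_derive1_comp R f (fun s => t * s) s (f' (t * s)) t (df _) ds.
by rewrite /GRing.scale/= mulrC.
Qed.

Lemma is_derive_scaled (w1 : R -> R) (r t s : R) :
  (forall s : R, is_derive s 1 step (w1 s)) ->
  is_derive s 1 (scaled r t) (r * (t * w1 (t * s))).
Proof.
move=> d1; have H := is_derive_scale t s d1.
have := is_deriveZ r H; by apply.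
Qed.

(** The cutoff depends on e z, so that its derivatives of order j are O(e^j),
    and they vanish as soon as e |z| > 2; for e <= 1 the bound O(e) serves for
    both orders. *)
Lemma cutoff_bounds : exists2 K : R, 0 <= K & forall e : R, 0 < e -> e <= 1 -> forall z,
  [/\ forall i, `|partial i (cutoff e) z| <= K * e, `|laplacian (cutoff e) z| <= K * e &
      2 / e < `|z| -> (forall i, partial i (cutoff e) z = 0) /\ laplacian (cutoff e) z = 0].
Proof.
have [w1 [w2 [C [d1 d2 C0 bd z2]]]] := @step_derive2 R.
exists (14 * C); first by rewrite mulr_ge0.
move=> e e0 e1 z.
have D1 (s : R) : is_derive s 1 (scaled 1 (e ^+ 2)) (e ^+ 2 * w1 (e ^+ 2 * s)).
  by have := is_derive_scaled 1 (e ^+ 2) s d1; rewrite mul1r.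
have D2 (s : R) : is_derive s 1 (fun s => e ^+ 2 * w1 (e ^+ 2 * s))
    (e ^+ 2 * (e ^+ 2 * w2 (e ^+ 2 * s))).
  have H := is_derive_scale (e ^+ 2) s d2.
  by have := is_deriveZ (e ^+ 2) H; apply.
have PE i : partial i (cutoff e) z = e ^+ 2 * w1 (e ^+ 2 * sqd 0 z) * (2 * coord i z).
  by rewrite (partial_rad i (D1 _)) linear0 subr0.
have LE : laplacian (cutoff e) z = 6 * (e ^+ 2 * w1 (e ^+ 2 * sqd 0 z)) +
    4 * sqd 0 z * (e ^+ 2 * (e ^+ 2 * w2 (e ^+ 2 * sqd 0 z))).
  by rewrite (laplacian_rad _ (fun s _ => D1 s) (fun s _ => D2 s)).
have [s2|s2] := ltP 2 (e ^+ 2 * sqd 0 z).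
  have [z1 z1'] := z2 _ s2.
  have P0 i : partial i (cutoff e) z = 0 by rewrite PE z1 mulr0 mul0r.
  have L0 : laplacian (cutoff e) z = 0 by rewrite LE z1 z1' !mulr0 addr0.
  by split => [i||//]; rewrite ?P0 ?L0 normr0 !mulr_ge0// ltW.
have sz := normB_sqd 0 z; rewrite subr0 in sz.
have nz0 := normr_ge0 z.
have ez2 : e * `|z| <= 2.
  have h : (e * `|z|) ^+ 2 <= 2 by rewrite exprMn (le_trans _ s2)// ler_wpM2l// sqr_ge0.
  rewrite -(ler_pXn2r (_ : 0 < 2)%N) ?nnegrE//; last by rewrite mulr_ge0// ltW.
  by apply: (le_trans h); rewrite expr2; lra.
have [b1 b2] := bd (e ^+ 2 * sqd 0 z).
have s0 := sqd_ge0 0 z; have e00 := ltW e0; have e20 := sqr_ge0 e.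
have ee : e ^+ 2 <= e by rewrite expr2 ler_piMl// ltW.
split.
- move=> i; rewrite PE !normrM (gtr0_norm e0) (ger0_norm (@ler0n R 2)).
  have cz := coord_le i z; have c0 := normr_ge0 (coord i z).
  set b := `|w1 _| in b1 *; have b0 : 0 <= b by exact: normr_ge0.
  have h1 : e * `|coord i z| <= 2 by apply: le_trans ez2; rewrite ler_wpM2l// ltW.
  have h2 : b * (e * `|coord i z|) <= C * 2 by apply: ler_pM => //; rewrite mulr_ge0// ltW.
  rewrite (_ : _ * b * _ = (b * (e * `|coord i z|)) * (2 * e)); last by ring.
  apply: (@le_trans _ _ (C * 2 * (2 * e))).
    by rewrite ler_wpM2r// mulr_ge0// ltW.
  have Ce : 0 <= C * e by rewrite mulr_ge0// ltW.
  by nra.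
- rewrite LE; set p := w1 _ in b1 *; set q := w2 _ in b2 *.
  apply: (le_trans (ler_normD _ _)).
  have T1 : `|6 * (e ^+ 2 * p)| = 6 * (e ^+ 2 * `|p|).
    by rewrite normrM (ger0_norm (@ler0n R 6)) normrM (ger0_norm e20).
  have T2 : `|4 * sqd 0 z * (e ^+ 2 * (e ^+ 2 * q))| =
      4 * (e ^+ 2 * (e ^+ 2 * sqd 0 z * `|q|)).
    have -> : 4 * sqd 0 z * (e ^+ 2 * (e ^+ 2 * q)) =
       4 * sqd 0 z * e ^+ 2 * e ^+ 2 * q by ring.
    by rewrite normrM ger0_norm ?mulr_ge0//; ring.
  rewrite T1 T2.
  have h1 : e ^+ 2 * `|p| <= e * C by apply: ler_pM.
  have h2 : e ^+ 2 * sqd 0 z * `|q| <= 2 * C.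
    by apply: ler_pM => //; rewrite mulr_ge0.
  have h3 : e ^+ 2 * (e ^+ 2 * sqd 0 z * `|q|) <= e * (2 * C).
    by apply: ler_pM => //; rewrite !mulr_ge0.
  nra.
- rewrite ltr_pdivrMr// mulrC ltNge ez2//.
Qed.

(** With r = s^2, either r <= |w| or |w| <= r, and the larger one dominates. *)
Lemma sobolev_young (s w : R) : (s * w) ^+ 2 <= s ^+ 6 + `|w| ^+ 3.
Proof.
rewrite exprMn -(real_normK (num_real w)); set t := `|w|.
have t0 : 0 <= t by exact: normr_ge0.
rewrite (_ : s ^+ 6 = (s ^+ 2) ^+ 3); last by rewrite -exprM.
move: (s ^+ 2) (sqr_ge0 s) => r r0.
have r3 : 0 <= r ^+ 3 by rewrite exprn_ge0.
have t3 : 0 <= t ^+ 3 by rewrite exprn_ge0.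
have [rt|rt] := leP r t.
  apply: (@le_trans _ _ (t ^+ 3)); last by rewrite lerDr.
  by rewrite exprS ler_wpM2r// sqr_ge0.
apply: (@le_trans _ _ (r ^+ 3)); last by rewrite lerDl.
by rewrite [leRHS]exprS ler_wpM2l// lerXn2r// ?nnegrE// ltW.
Qed.

Lemma sum3E (F : 'I_3 -> R) : \sum_(i < 3) F i =
  F ord0 + (F (lift ord0 ord0) + F (lift ord0 (lift ord0 ord0))).
Proof. by rewrite !big_ord_recl big_ord0 addr0. Qed.

Lemma sqr_sum5 (p q0 q1 q2 r : R) : (p + 2 * (q0 + (q1 + q2)) + r) ^+ 2 <=
  5 * (p ^+ 2 + 4 * (q0 ^+ 2 + (q1 ^+ 2 + q2 ^+ 2)) + r ^+ 2).
Proof.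
rewrite -subr_ge0 (_ : _ - _ = (p - 2 * q0) ^+ 2 + (p - 2 * q1) ^+ 2 +
  (p - 2 * q2) ^+ 2 + (p - r) ^+ 2 + 4 * (q0 - q1) ^+ 2 + 4 * (q0 - q2) ^+ 2 +
  4 * (q1 - q2) ^+ 2 + (2 * q0 - r) ^+ 2 + (2 * q1 - r) ^+ 2 + (2 * q2 - r) ^+ 2); last by ring.
by do ![apply: addr_ge0]; first [exact: sqr_ge0|apply: mulr_ge0; last exact: sqr_ge0].
Qed.

Lemma lap_numeric (X H P0 P1 P2 Y U W k G0 G1 G2 : R) :
  X <= H -> P0 <= k * G0 -> P1 <= k * G1 -> P2 <= k * G2 -> Y <= U + W -> 0 <= W ->
  0 <= G0 -> 0 <= G1 -> 0 <= G2 -> 0 <= H -> 0 <= U -> 0 <= k ->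
  5 * (X + 4 * (P0 + (P1 + P2)) + Y) <=
  (5 + 20 * k) * (H + (G0 + (G1 + G2)) + U + W).
Proof.
move=> X1 g0 g1 g2 y w0 G00 G10 G20 h0 u0 k0.
apply: (@le_trans _ _ (5 * (H + 4 * (k * G0 + (k * G1 + k * G2)) + (U + W)))).
  by rewrite ler_pM2l//; lra.
have a1 : 0 <= k * H by rewrite mulr_ge0.
have a2 : 0 <= k * U by rewrite mulr_ge0.
have a3 : 0 <= k * W by rewrite mulr_ge0.
rewrite -subr_ge0 (_ : _ - _ = 5 * (G0 + G1 + G2) + 20 * (k * H) + 20 * (k * U) + 20 * (k * W)); last by ring.
lra.
Qed.

Lemma sqr_bd (s w : R) (C : R) : `|w| <= C -> (s * w) ^+ 2 <= C ^+ 2 * s ^+ 2.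
Proof.
move=> wC; rewrite exprMn mulrC ler_wpM2r ?sqr_ge0// -(real_normK (num_real w)).
by rewrite lerXn2r// nnegrE// (le_trans _ wC).
Qed.

Section bound.
Variables (a : R) (u v h : E -> R) (g : 'I_3 -> E -> R).
Hypothesis (ul : lint u) (vl : lint v) (gl : forall i, lint (g i)) (hl : lint h).
Hypothesis gu : forall i phi, test_function phi ->
  \int[mu]_x (u x * partial i phi x) = - \int[mu]_x (g i x * phi x).
Hypothesis hu : forall phi, test_function phi ->
  \int[mu]_x (u x * laplacian phi x) = \int[mu]_x (h x * phi x).
Hypothesis uv : forall phi, test_function phi ->
  - (\int[mu]_x (u x * laplacian phi x))
    + a ^+ 2 * (\int[mu]_x (u x * laplacian (laplacian phi) x))
  = (\int[mu]_x (v x * phi x)).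
Hypothesis (g2 : forall i, mu.-integrable setT (EFin \o (fun x => g i x ^+ 2))).
Hypothesis (h2 : mu.-integrable setT (EFin \o (fun x => h x ^+ 2))).
Hypothesis (u6 : mu.-integrable setT (EFin \o (fun x => u x ^+ 6))).

(** A common integrable majorant of the squares of [h] and of the [g i], which
    also controls the terms where the cutoff is differentiated. *)
Definition energy z : R := h z ^+ 2 + (\sum_(i < 3) g i z ^+ 2) + u z ^+ 6.

Lemma integrable_energy : mu.-integrable setT (EFin \o energy).
Proof.
have i12 := @integrableD _ _ R mu setT measurableT _ _ (g2 (lift ord0 ord0))
  (g2 (lift ord0 (lift ord0 ord0))).
have i3 := @integrableD _ _ R mu setT measurableT _ _ (g2 ord0) i12.
have i4 := @integrableD _ _ R mu setT measurableT _ _ h2 i3.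
have := @integrableD _ _ R mu setT measurableT _ _ i4 u6.
apply: (@eq_integrable _ _ R mu) => // x _.
by rewrite /energy /= !big_ord_recl big_ord0 addr0 !EFinD.
Qed.

Lemma u6_ge0 z : 0 <= u z ^+ 6.
Proof. by rewrite (_ : 6%N = (2 * 3)%N)// exprM exprn_ge0// sqr_ge0. Qed.

Lemma g2_le i z : g i z ^+ 2 <= \sum_(i < 3) g i z ^+ 2.
Proof. by rewrite (bigD1 i)//= lerDl sumr_ge0// => j _; exact: sqr_ge0. Qed.

Lemma energy_ge z : [/\ h z ^+ 2 <= energy z, forall i, g i z ^+ 2 <= energy z &
  forall i, g i z ^+ 2 + u z ^+ 6 <= energy z].
Proof.
have h0 := sqr_ge0 (h z); have u0 := u6_ge0 z; have gi i := g2_le i z.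
have g0 i := sqr_ge0 (g i z).
by rewrite /energy; split => [|i|i]; have := gi ord0; have := g0 ord0; 
  try have := gi i; try have := g0 i; lra.
Qed.

(** Its height is O(e^3) and its support has volume O(e^-3), so that its
    integral does not depend on [e]. *)
Definition weight (K e : R) z : R := (K * e) ^+ 3 * \1_(cube (2 / e)) z.

Lemma weight_ge (K e w : R) z : `|w| <= K * e -> (2 / e < `|z| -> w = 0) ->
  `|w| ^+ 3 <= weight K e z.
Proof.
move=> wK w0; rewrite /weight indicE; case: (boolP (_ \in _)) => [_|/negP hz].
  by rewrite mulr1 lerXn2r// nnegrE// (le_trans _ wK).
rewrite mulr0 w0 ?normr0 ?expr0n//=; rewrite ltNge; apply/negP => hz'; apply: hz.
exact/mem_set.
Qed.

Lemma integral_weight (K e : R) : 0 < e ->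
  mu.-integrable setT (EFin \o weight K e) /\ \int[mu]_x weight K e x = 64 * K ^+ 3.
Proof.
move=> e0; have [i2 i1] := @integral_cube R (2 / e) (divr_ge0 (ler0n _ 2) (ltW e0)).
split; first exact: (@integrableZl _ _ R mu setT measurableT ((K * e) ^+ 3) _ i2).
rewrite (@RintegralZl _ _ R mu setT _ ((K * e) ^+ 3) measurableT i2) i1.
by field; rewrite gt_eqF.
Qed.

Lemma gradM_cutoff_le K e z i : 0 <= K -> (forall i, `|partial i (cutoff e) z| <= K * e) ->
  (2 / e < `|z| -> forall i, partial i (cutoff e) z = 0) ->
  gradM u g (cutoff e) i z ^+ 2 <= (5 + 20 * K ^+ 2) * (energy z + weight K e z).
Proof.
move=> K0 wK w0.
have [_ _ e2] := energy_ge z; have {}e2 := e2 i.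
have W := weight_ge (wK i) (fun hz => w0 hz i).
have W0 : 0 <= weight K e z by apply: le_trans W; rewrite exprn_ge0.
have Y := sobolev_young (u z) (partial i (cutoff e) z).
have X1 : (g i z * cutoff e z) ^+ 2 <= 1 ^+ 2 * g i z ^+ 2.
  by apply: sqr_bd; rewrite ger0_norm ?cutoff_ge0// cutoff_le1.
rewrite expr1n mul1r in X1.
have EW : 0 <= energy z + weight K e z.
  by rewrite addr_ge0//; have [h0 _ _] := energy_ge z; apply: le_trans h0; exact: sqr_ge0.
apply: (@le_trans _ _ (2 * (energy z + weight K e z))).
  rewrite /gradM; have := sqr_ge0 (g i z * cutoff e z - u z * partial i (cutoff e) z).
  move: X1 Y; set p := g i z * _; set q := u z * _; nra.
by rewrite ler_wpM2r//; have := sqr_ge0 K; lra.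
Qed.

Lemma lapM_cutoff_le K e z : 0 <= K -> 0 <= e -> e <= 1 ->
  (forall i, `|partial i (cutoff e) z| <= K * e) -> `|laplacian (cutoff e) z| <= K * e ->
  (2 / e < `|z| -> laplacian (cutoff e) z = 0) ->
  lapM u g h (cutoff e) z ^+ 2 <= (5 + 20 * K ^+ 2) * (energy z + weight K e z).
Proof.
move=> K0 e0 e1 wK LK L0.
have W := weight_ge LK L0.
have W0 : 0 <= weight K e z by apply: le_trans W; rewrite exprn_ge0.
pose p i := g i z * partial i (cutoff e) z.
have -> : lapM u g h (cutoff e) z = h z * cutoff e z +
    2 * (p ord0 + (p (lift ord0 ord0) + p (lift ord0 (lift ord0 ord0)))) +
    u z * laplacian (cutoff e) z.
  have LS : \sum_(i < 3) u z * partial i (partial i (cutoff e)) z =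
      u z * laplacian (cutoff e) z by rewrite -mulr_sumr.
  have GS : \sum_(i < 3) p i = p ord0 + (p (lift ord0 ord0) + p (lift ord0 (lift ord0 ord0))).
    exact: sum3E.
  have S : \sum_(i < 3) gradM u g (partial i (cutoff e)) i z =
      \sum_(i < 3) p i + u z * laplacian (cutoff e) z.
    exact: (etrans (big_split _ _ _ _ _) (f_equal2 +%R erefl LS)).
  apply: (etrans (f_equal (fun r => h z * cutoff e z + 2 * r +
    -1 * (u z * laplacian (cutoff e) z)) S)).
  rewrite -GS; move: (u z * laplacian _ z) (\sum_(i < 3) p i) (h z * cutoff e z) => r r1 r2.
  by ring.
apply: (le_trans (sqr_sum5 _ _ _ _ _)).
have X1 : (h z * cutoff e z) ^+ 2 <= h z ^+ 2.
  rewrite -[leRHS]mul1r -(expr1n _ 2).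
  by apply: sqr_bd; rewrite ger0_norm ?cutoff_ge0// cutoff_le1.
have G i : p i ^+ 2 <= K ^+ 2 * g i z ^+ 2.
  by apply: sqr_bd; apply: (le_trans (wK i)); rewrite ler_piMr.
have Y := sobolev_young (u z) (laplacian (cutoff e) z).
have Y2 : (u z * laplacian (cutoff e) z) ^+ 2 <= u z ^+ 6 + weight K e z.
  by apply: (le_trans Y); rewrite lerD2l.
have s i := sqr_ge0 (g i z).
have sh := sqr_ge0 (h z); have s6 := u6_ge0 z; have sK := sqr_ge0 K.
rewrite /energy (sum3E (fun i => g i z ^+ 2)).
exact: (lap_numeric X1 (G _) (G _) (G _) Y2 W0 (s _) (s _) (s _) sh s6 sK).
Qed.

(** Every factor of [energy_identity] has a square bounded by a multiple of
    [energy] plus [weight], whose integral is independent of the scale. *)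
Lemma uniform_bound : exists B : R, forall e, 0 < e -> e <= 1 ->
  `|\int[mu]_y (v y * conv (fun x => u x * cutoff e x) (mol e) y)| <= B.
Proof.
have [K K0 Kb] := cutoff_bounds.
have [w1 [w2 [C [d1 d2 _ _ _]]]] := @step_derive2 R.
(* The square of a sum of 5 terms is at most 5 times the sum of the squares;
   20 K^2 comes from the terms 2 g_i d_i X. *)
pose C0 := 5 + 20 * K ^+ 2.
pose I := \int[mu]_x energy x.
pose B1 := bump_mass * (I + C0 * (I + 64 * K ^+ 3)).
exists (3 * B1 + a ^+ 2 * B1) => e e0 e1.
have bX := bump_cutoff e0.
have D1 (s : R) : is_derive s 1 (mol e) (e^-1 ^+ 3 * (e^-1 ^+ 2 * w1 (e^-1 ^+ 2 * s))).
  exact: is_derive_scaled.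
have D2 (s : R) : is_derive s 1 (fun s => e^-1 ^+ 3 * (e^-1 ^+ 2 * w1 (e^-1 ^+ 2 * s)))
   (e^-1 ^+ 3 * (e^-1 ^+ 2 * (e^-1 ^+ 2 * w2 (e^-1 ^+ 2 * s)))).
  have H := is_derive_scale (e^-1 ^+ 2) s d2.
  have H1 := is_deriveZ (e^-1 ^+ 2) H.
  by have := is_deriveZ (e^-1 ^+ 3) H1; apply.
have bk c : bump (rad (mol e) c) by apply: bump_scaled; rewrite exprn_gt0// invr_gt0.
have -> := energy_identity ul vl gl hl gu hu uv bX bk D1 D2.
have ker : kernel (mol e) (e^-1 ^+ 3) (2 / e^-1 ^+ 2).
  by apply: kernel_scaled; rewrite ?exprn_ge0 ?exprn_gt0 ?invr_ge0 ?invr_gt0// ltW.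
have k0 s : 0 <= mol e s by exact: mol_ge0.
have kc y : \int[mu]_x rad (mol e) y x = bump_mass by exact: mol_mass.
have iE := integrable_energy.
have [iW IW] := integral_weight K e0.
have iS := @integrableD _ _ R mu setT measurableT _ _ iE iW.
have iC := @integrableZl _ _ R mu setT measurableT C0 _ iS.
have IC : \int[mu]_x (C0 * (energy x + weight K e x)) = C0 * (I + 64 * K ^+ 3).
  rewrite (@RintegralZl _ _ R mu setT _ C0 measurableT iS).
  by rewrite (@RintegralD _ _ R mu setT _ _ measurableT iE iW) IW.
have Y A B : lint A -> lint B -> (forall z, A z ^+ 2 <= energy z) ->
    (forall z, B z ^+ 2 <= C0 * (energy z + weight K e z)) ->
    `|\int[mu]_y (A y * conv B (mol e) y)| <= B1.
  move=> lA lB AE BE; rewrite /B1 -IC.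
  exact: (young_pairing ker k0 kc lA lB iE iC AE BE).
apply: (le_trans (ler_normD _ _)); apply: lerD.
  apply: (le_trans (ler_norm_sum _ _ _)).
  have -> : 3 * B1 = \sum_(i < 3) B1 by rewrite sumr_const card_ord mulr_natl.
  apply: ler_sum => i _; apply: Y => //.
  - exact: lint_gradM.
  - by move=> z; have [_ e2 _] := energy_ge z.
  - move=> z; have [p _ q] := Kb e e0 e1 z; apply: gradM_cutoff_le => //.
    by move=> /q[].
rewrite normrM (ger0_norm (sqr_ge0 a)) ler_wpM2l ?sqr_ge0//; apply: Y => //.
- exact: lint_lapM.
- by move=> z; have [e2 _ _] := energy_ge z.
- move=> z; have [p l q] := Kb e e0 e1 z; apply: lapM_cutoff_le => //; first exact: ltW.
  by move=> /q[].
Qed.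

End bound.
End uniform_bound.

(** * Passage to the limit *)

Section fatou_limit.
Context {R : realType}.
Local Notation E := (R * R * R)%type.
Local Notation mu := (leb3 R).
Implicit Types (x y z t : E).

Lemma lint_continuous (f : E -> R) : measurable_fun setT f -> continuous f -> lint f.
Proof.
by move=> mf cf; apply: lint_bounded_on_cubes => // N; exact: bounded_on_cube.
Qed.

Lemma integrable_step : mu.-integrable setT (EFin \o (fun t => step (sqd 0 t))).
Proof.
have K := @kernel_scaled R 1 1 ler01 ltr01.
have := integrable_rad K 0; apply: (@eq_integrable _ _ R mu) => // t _.
by rewrite /= /rad /scaled !mul1r.
Qed.

Section limit.
Variable f : E -> R.
Hypotheses (mf : measurable_fun setT f) (cf : continuous f) (f0 : forall x, 0 <= f x).

Let moll n y := conv (fun x => f x * cutoff (eps n) x) (mol (eps n)) y.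

Lemma moll_ge0 n y : 0 <= moll n y.
Proof.
apply: Rintegral_ge0 => x _; rewrite mulr_ge0 ?mol_ge0 ?eps_gt0// mulr_ge0//.
exact: cutoff_ge0.
Qed.

(** The change of variables x = y + e t turns the mollification into an integral
    over the fixed support of the cutoff, where f(y + e t) and the cutoff
    converge boundedly to f(y) and 1. *)
Lemma moll_cvg y : moll n y @[n --> \oo] --> bump_mass * f y.
Proof.
have ME n : moll n y =
    \int[mu]_t (step (sqd 0 t) * (f (y + eps n *: t) * cutoff (eps n) (y + eps n *: t))).
  have e0 := @eps_gt0 R n; have bX := bump_cutoff e0.
  rewrite /moll /conv (Rintegral_affine y e0).
  - apply: eq_Rintegral => t _; rewrite -(mol_scale y t e0); ring.
  - apply: measurable_funM; first by apply: measurable_funM => //; exact: bump_meas bX.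
    by apply: bump_meas; apply: bump_scaled; rewrite exprn_gt0// invr_gt0.
  - by move=> x; rewrite mulr_ge0 ?mol_ge0// mulr_ge0//; exact: cutoff_ge0.
(* The integrand vanishes for |t| > 2, and the scale is at most 1. *)
have [C C0 hC] := bounded_on_cube (`|y| + 2) cf.
have ms : measurable_fun setT (fun t : E => step (sqd 0 t)).
  by have := measurable_int mu integrable_step => /measurable_EFinP.
have S2 t : 2 < `|t| -> step (sqd 0 t) = 0.
  move=> t2; apply: step0; apply: le_trans (normB_sqd 0 t); rewrite subr0.
  by rewrite expr2; nra.
under eq_fun do rewrite ME.
have [||||_ L] := @Rintegral_dominated_cvg R _ _ mu (fun n t => step (sqd 0 t) *
    (f (y + eps n *: t) * cutoff (eps n) (y + eps n *: t)))
    (fun t => step (sqd 0 t) * (f y * 1)) (fun t => C * step (sqd 0 t)).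
- move=> n; apply: measurable_funM => //.
  have mX := measurable_funM mf (bump_meas (bump_cutoff (@eps_gt0 R n))).
  exact: (measurableT_comp mX (measurable_affine3 y (eps n))).
- exact: (@integrableZl _ _ R mu setT measurableT C _ integrable_step).
- move=> n t; have [t2|t2] := leP `|t| 2; last by rewrite S2// mul0r normr0 mulr0.
  rewrite normrM mulrC (ger0_norm (step_ge0 _)) ler_wpM2r ?step_ge0//.
  rewrite normrM (ger0_norm (cutoff_ge0 _ _)) -[leRHS]mulr1 ler_pM ?cutoff_ge0 ?cutoff_le1//.
  apply: hC; apply: (le_trans (ler_normD _ _)); rewrite lerD2l normrZ.
  rewrite (ger0_norm (ltW (eps_gt0 n))) -[leRHS]mul1r ler_pM//; first exact/ltW/eps_gt0.
  exact: eps_le1.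
- move=> t; apply: cvgMr.
  have yc : y + eps n *: t @[n --> \oo] --> y.
    have : y + eps n *: t @[n --> \oo] --> y + (0 : R) *: t.
      by apply: cvgD; [exact: cvg_cst|apply: cvgZr_tmp; exact: eps_cvg].
    by rewrite scale0r addr0.
  apply: cvgM; first by apply: continuous_cvg; [exact: cf|exact: yc].
  rewrite /cutoff /rad /scaled.
  have sc : sqd 0 (y + eps n *: t) @[n --> \oo] --> sqd 0 y.
    apply: continuous_cvg; last exact: yc.
    exact: differentiable_continuous (differentiable_sqd 0 y).
  have pc : eps n ^+ 2 * sqd 0 (y + eps n *: t) @[n --> \oo] --> 0 * sqd 0 y.
    by apply: cvgM => //; exact: eps2_cvg.
  rewrite mul0r in pc; have := cvg_comp _ _ pc (@step_continuous R 0).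
  by rewrite step1// => h; under eq_fun do rewrite mul1r.
suff -> : bump_mass * f y = \int[mu]_t (step (sqd 0 t) * (f y * 1)) by [].
by rewrite mulr1 (@RintegralZr _ _ R mu setT _ (f y) measurableT integrable_step).
Qed.

(** Fatou's lemma; the mass of the mollifier is at least 1 and only helps. *)
Lemma integral_le_of_moll (v : E -> R) (B : R) : lint v -> (forall x, 0 <= v x) ->
  (forall n, \int[mu]_y (v y * moll n y) <= B) ->
  (\int[mu]_y (v y * f y)%:E <= B%:E)%E.
Proof.
move=> lv v0 vB; have [mv _] := lv; have lf := lint_continuous mf cf.
have ker n : kernel (mol (eps n)) ((@eps R n)^-1 ^+ 3) (2 / (eps n)^-1 ^+ 2).
  have e0 := @eps_gt0 R n.
  by apply: kernel_scaled; rewrite ?exprn_ge0 ?exprn_gt0 ?invr_ge0 ?invr_gt0// ltW.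
have lX n : lint (fun x => f x * cutoff (eps n) x).
  by apply: lint_bump => //; exact: bump_cutoff (eps_gt0 n).
have mm n : measurable_fun setT (moll n) by exact: measurable_conv (lX n) (ker n).
have int n : mu.-integrable setT (EFin \o (fun y => v y * moll n y)).
  have [C [M [XC XM]]] := bump_bounded (bump_cutoff (@eps_gt0 R n)).
  pose N := M + Num.sqrt (2 / (eps n)^-1 ^+ 2).
  have z0 y : N < `|y| -> moll n y = 0.
    move=> yN; rewrite /moll /conv (_ : (fun x => _) = cst 0) ?Rintegral_cst ?mul0r//.
    apply/funext => x /=; have [hx|hx] := leP `|x| M; last by rewrite XM// mulr0 mul0r.
    by rewrite radC (rad_supp (ker n)) ?mulr0// (le_lt_trans _ yN)// lerD2r.
  pose D := (eps n)^-1 ^+ 3 * \int[mu]_y `|trunc (fun x => f x * cutoff (eps n) x)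
     (N + Num.sqrt (2 / (eps n)^-1 ^+ 2)) y|.
  apply: (lint_bounded lv (C := Num.max 0 D) (M := N)) => // z.
  have [zN|zN] := leP `|z| N; last by rewrite z0// normr0 le_max lexx.
  by rewrite le_max; apply/orP; right; exact: (conv_bd (lX n) (ker n) zN).
have FT := @fatou _ _ R mu setT measurableT (fun n y => (v y * moll n y)%:E).
have FE y : limn_einf (fun n => (v y * moll n y)%:E) = (v y * (bump_mass * f y))%:E.
  apply: (cvg_limn_einf_sup _).1.
  apply: cvg_EFin; first exact: nearW.
  by apply: cvgMr; exact: moll_cvg.
apply: (@le_trans _ _ (\int[mu]_y limn_einf (fun n => (v y * moll n y)%:E))%E).
  apply: ge0_le_integral => //.
  - by move=> y _; rewrite lee_fin mulr_ge0.
  - by apply/measurable_EFinP; exact: (measurable_funM mv mf).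
  - under eq_fun do rewrite FE; apply/measurable_EFinP.
    apply: (measurable_funM mv); exact: (measurable_funM (@measurable_cst _ _ _ _ setT bump_mass) mf).
  - move=> y _; rewrite FE lee_fin ler_wpM2l// ler_peMl//; exact: bump_mass_ge1.
apply: (le_trans (FT _ _)).
- by move=> n; apply/measurable_EFinP; exact: (measurable_funM mv (mm n)).
- by move=> n y _; rewrite lee_fin mulr_ge0// moll_ge0.
rewrite limn_einf_lim; apply: lime_le; first exact: is_cvg_einfs.
apply: nearW => n; apply: (@le_trans _ _ (\int[mu]_y (v y * moll n y)%:E)%E).
  by apply: ereal_inf_lbound; exists n => /=.
by rewrite (integrable_EFin_Rintegral measurableT (int n)) lee_fin.
Qed.

End limit.
End fatou_limit.

(** * The solution *)

Section solution.
Context {R : realType}.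
Local Notation E := (R * R * R)%type.
Local Notation mu := (leb3 R).
Implicit Types (x y z : E).

Lemma Lfun_measurable (p : \bar R) (f : E -> R) : f \in Lfun mu p -> measurable_fun setT f.
Proof. by move=> /sub_Lfun_mfun; rewrite inE. Qed.

Lemma Lfun6_integrable (f : E -> R) : f \in Lfun mu 6%:E ->
  mu.-integrable setT (EFin \o (fun x => f x ^+ 6)).
Proof.
move=> f6; have mf := Lfun_measurable f6.
have fin : finite_norm mu 6%:E f by have /sub_Lfun_finLfun := f6; rewrite inE.
have p6 : (6 : R) != 0 by rewrite pnatr_eq0.
apply/integrableP; split; first by apply/measurable_EFinP; exact: measurable_funX.
have := poweR_lty 6 fin; rewrite (powR_Lnorm mu _ p6).
congr (_ < _)%E; apply: eq_integral => x _.
by rewrite /= normrX powR_mulrn.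
Qed.

(** The term in the Laplacian is absorbed in the right-hand side [w + h], which
    leaves a pure bilaplacian equation for [u]. *)
Lemma continuous_representative (a : R) (u w h : E -> R) : 0 < a ->
  lint u -> lint w -> lint h ->
  (forall phi, test_function phi ->
     - (\int[mu]_x (u x * laplacian phi x))
       + a ^+ 2 * (\int[mu]_x (u x * laplacian (laplacian phi) x))
     = (\int[mu]_x (w x * phi x))) ->
  (forall phi, test_function phi ->
     \int[mu]_x (u x * laplacian phi x) = \int[mu]_x (h x * phi x)) ->
  exists v : E -> R, [/\ measurable_fun setT v, forall x, differentiable v x &
    {ae mu, forall x, u x = v x}].
Proof.
move=> a0 ul wl hl sol hu.
have rad_sol k C M c : kernel k C M -> test_function (rad k c) ->
    a ^+ 2 * (\int[mu]_x (u x * laplacian (laplacian (rad k c)) x)) =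
    \int[mu]_x ((w x + h x) * rad k c x).
  move=> K tk.
  have iw := integrable_conv c wl K; have ih := integrable_conv c hl K.
  transitivity (\int[mu]_x (w x * rad k c x) + \int[mu]_x (h x * rad k c x)).
    have solve (p L H W : R) : - L + p = W -> L = H -> p = W + H.
      by move=> <- ->; ring.
    exact: solve (sol _ tk) (hu _ tk).
  rewrite -(@RintegralD _ _ R mu setT _ _ measurableT iw ih).
  by apply: eq_Rintegral => x _; rewrite mulrDl.
have [T [dT cT bT]] := regularization a0 ul (lintD wl hl) rad_sol.
have mT : measurable_fun setT T.
  apply: (@measurable_fun_cvg _ _ R setT (fun n => conv u (dker (eps n ^+ 2))) T) => //.
  move=> n; have e2 : 0 < @eps R n ^+ 2 by rewrite exprn_gt0// eps_gt0.
  by have [C K] := kernel_dker e2; exact: measurable_conv K.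
have m0 := @mass_gt0 R.
exists (fun x => mass^-1 * T x); split.
- exact: measurable_funM.
- by move=> x; apply: differentiableZ.
- apply: ae3S (approximate_identity ul cT bT) => x ->.
  by rewrite mulrA mulVf ?mul1r// gt_eqF.
Qed.

End solution.

Unset Implicit Arguments.

Theorem theorem1p4 (R : realType) (a q : R) (a0 : 0 < a) (q0 : 0 < q)
    (u : R * R * R -> R) (uD : spaceD u)
    (upos : {ae leb3 R, forall x, 0 < u x})
    (usol : distribution_solution a q u) :
  (exists v : R * R * R -> R,
     {ae leb3 R, forall x, u x = v x} /\ forall x, differentiable v x) /\
  u \in Lfun (leb3 R) (q + 1)%:E.
Proof.
have [[u6 /choice[g gP]] [h [h2 [ulo hlo hu]]]] := uD.
have [_ uqlo sol] := usol.
have mu_ := Lfun_measurable u6.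
have muq : measurable_fun setT (fun x => u x `^ q).
  exact: (measurableT_comp (measurable_powR q) mu_).
have ul := lint_loc mu_ ulo; have wl := lint_loc muq uqlo.
have hl := lint_loc (Lfun_measurable h2) hlo.
have gl i : lint (g i).
  by have [g2 [_ glo _]] := gP i; exact: lint_loc (Lfun_measurable g2) glo.
have gu i phi : test_function phi ->
    \int[leb3 R]_x (u x * partial i phi x) = - \int[leb3 R]_x (g i x * phi x).
  by have [_ [_ _ H]] := gP i; exact: H.
have [v [mv dv uv]] := continuous_representative a0 ul wl hl sol hu.
split; first by exists v.
have g2 i : (leb3 R).-integrable setT (EFin \o (fun x => g i x ^+ 2)).
  by have [g2 _] := gP i; exact: (@Lfun2_integrable_sqr _ _ R (leb3 R) _ g2).
have h2' := @Lfun2_integrable_sqr _ _ R (leb3 R) _ h2.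
have u6' := Lfun6_integrable u6.
have [B HB] := uniform_bound ul wl gl hl gu hu sol g2 h2' u6'.
(* The absolute value makes the continuous representative nonnegative
   everywhere, as Fatou's lemma requires. *)
have up : {ae leb3 R, forall x, u x = `|v x|}.
  by apply: ae3S (ae3I upos uv) => x [u0 <-]; rewrite gtr0_norm.
have mav : measurable_fun setT (fun x => `|v x|) by exact: measurableT_comp.
have cav : continuous (fun x => `|v x|).
  move=> x; apply: continuous_comp; first exact: differentiable_continuous.
  exact: norm_continuous.
have fin : (\int[leb3 R]_y (u y `^ q * `|v y|)%:E <= B%:E)%E.
  apply: (integral_le_of_moll mav cav) => //; first by move=> x; exact: powR_ge0.
  move=> n; apply: le_trans (HB (eps n) (eps_gt0 n) (eps_le1 n)).
  apply: le_trans (ler_norm _); rewrite le_eqVlt; apply/orP; left; apply/eqP.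
  apply: eq_Rintegral => y _; congr (_ * _).
  have bX := bump_meas (bump_cutoff (@eps_gt0 R n)).
  have mk : measurable_fun setT (rad (mol (eps n)) y).
    by apply: bump_meas; apply: bump_scaled; rewrite exprn_gt0// invr_gt0 eps_gt0.
  apply: Rintegral_ae_eq.
  - exact: (measurable_funM (measurable_funM mav bX) mk).
  - exact: (measurable_funM (measurable_funM mu_ bX) mk).
  - by apply: ae3S up => x ->.
rewrite inE; apply/andP; split; first by rewrite inE.
rewrite inE /= /finite_norm unlock; apply: poweR_lty.
apply: le_lt_trans (ltry B); apply: le_trans fin.
rewrite le_eqVlt; apply/orP; left; apply/eqP.
have mq1 : measurable_fun setT (fun x => `|u x| `^ (q + 1)).
  by apply: (measurableT_comp (measurable_powR (q + 1))); exact: measurableT_comp.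
apply: (@ae_eq_integral _ _ R (leb3 R) setT _ _ measurableT).
- exact/measurable_EFinP.
- by apply/measurable_EFinP; exact: (measurable_funM muq mav).
- apply: ae3S (ae3I upos up) => x [u0 uvx] _ /=; congr EFin.
  rewrite -uvx gtr0_norm// powRD ?(gt_eqF u0) ?implybT//.
  by rewrite (powRr1 (ltW u0)).
Qed.
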